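(* Let $\mathcal{J}\subseteq G_{\mathcal{B}}$ be nonempty and $\beta\in\mathbb{C}^{n-m}$ generic. Then every holomorphic solution $f$ of $D_nI_{\mathcal{J}}+\langle A\theta-\beta\rangle$ can be written as $f=\sum_{\rho\in\mathcal{J}}f_\rho$, where each $f_\rho$ is a solution of $D_nI_\rho+\langle A\theta-\beta\rangle$. In particular, the solutions of $D_nI_{\mathcal{B}}+\langle A\theta-\beta\rangle$ are linear combinations of solutions of the systems $D_nI_\rho+\langle A\theta-\beta\rangle$, $\rho\in G_{\mathcal{B}}$.
   Context: $n>m$; $\mathcal{B}\in\mathbb{Z}^{n\times m}$ of rank $m$ with rows summing to zero; $A=(a_{kj})\in\mathbb{Z}^{(n-m)\times n}$ of rank $n-m$, first row all ones, $A\mathcal{B}=0$. $L_{\mathcal{B}}=\mathcal{B}\mathbb{Z}^m$, $L=\ker_\mathbb{Z}A$. $I_{\mathcal{B}}=\langle\partial^{u_+}-\partial^{u_-}:u\in L_{\mathcal{B}}\rangle$ (lattice ideal; $u=u_+-u_-$, $u_\pm\ge0$ disjoint supports). $G_{\mathcal{B}}$ is the group of characters $\rho:L\to\mathbb{C}^*$ trivial on $L_{\mathcal{B}}$; $I_\rho=\langle\partial^{u_+}-\rho(u)\partial^{u_-}:u\in L\rangle$; one has $I_{\mathcal{B}}=\bigcap_{\rho\in G_{\mathcal{B}}}I_\rho$. $I_{\mathcal{J}}=\bigcap_{\rho\in\mathcal{J}}I_\rho$. $\langle A\theta-\beta\rangle$ denotes the left ideal generated by $\sum_ja_{kj}x_j\partial_j-\beta_k$.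 Generic: outside an exceptional measure-zero set. *)

(* Defs.v *)
From Stdlib Require Import ClassicalEpsilon.
From mathcomp Require Import all_boot all_order all_algebra.
From mathcomp Require Import reals.
From mathcomp Require Import complex.
From mathcomp Require Import mpoly.

Set Implicit Arguments.
Unset Strict Implicit.
Unset Printing Implicit Defensive.

Import Order.TTheory GRing.Theory Num.Theory.
Local Open Scope ring_scope.

Section Defs.
Variable R : realType.
Local Notation C := (R[i]).

Definition l1norm (n : nat) (h : 'I_n -> C) : C := \sum_i `|h i|.

Definition shiftv (n : nat) (x h : 'I_n -> C) : 'I_n -> C := fun i => x i + h i.

Definition ev (n : nat) (j : 'I_n) (t : C) : 'I_n -> C :=
  fun i => if i == j then t else 0.

Definition is_open (n : nat) (U : ('I_n -> C) -> Prop) : Prop :=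
  forall x, U x -> exists2 r : C, 0 < r &
    forall y : 'I_n -> C, (forall i, `|y i - x i| < r) -> U y.

Definition holomorphic_on (n : nat) (U : ('I_n -> C) -> Prop)
    (f : ('I_n -> C) -> C) : Prop :=
  forall x, U x -> exists l : 'I_n -> C,
    forall eps : C, 0 < eps -> exists2 delta : C, 0 < delta &
      forall h : 'I_n -> C, l1norm h < delta ->
        `|f (shiftv x h) - f x - \sum_i l i * h i| <= eps * l1norm h.

Definition is_pderiv (n : nat) (f : ('I_n -> C) -> C) (j : 'I_n)
    (x : 'I_n -> C) (l : C) : Prop :=
  forall eps : C, 0 < eps -> exists2 delta : C, 0 < delta &
    forall t : C, t != 0 -> `|t| < delta ->
      `|(f (shiftv x (ev j t)) - f x) / t - l| < eps.

Definition pd (n : nat) (j : 'I_n) (f : ('I_n -> C) -> C) : ('I_n -> C) -> C :=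
  fun x => epsilon (inhabits 0) (is_pderiv f j x).

Definition pdn (n : nat) (m : 'X_{1..n}) (f : ('I_n -> C) -> C) :
    ('I_n -> C) -> C :=
  foldr (fun j g => iter (m j) (pd j) g) f (enum 'I_n).

Definition apply_op (n : nat) (P : {mpoly C[n]}) (f : ('I_n -> C) -> C) :
    ('I_n -> C) -> C :=
  fun x => \sum_(m <- msupp P) P@_m * pdn m f x.

Definition posm (n : nat) (u : 'cV[int]_n) : 'X_{1..n} :=
  [multinom `|Num.max (u i ord0) 0|%N | i < n].
Definition negm (n : nat) (u : 'cV[int]_n) : 'X_{1..n} :=
  [multinom `|Num.max (- u i ord0) 0|%N | i < n].

Definition inL (d n : nat) (A : 'M[int]_(d, n)) (u : 'cV[int]_n) : Prop :=
  A *m u = 0.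

(* rho is a character L -> C^* trivial on L_B = B Z^m, i.e. an element of G_B
   (only the values of rho on L are relevant) *)
Definition is_GB_char (d n m : nat) (A : 'M[int]_(d, n)) (B : 'M[int]_(n, m))
    (rho : 'cV[int]_n -> C) : Prop :=
  [/\ forall u v, inL A u -> inL A v -> rho (u + v) = rho u * rho v,
      forall u, inL A u -> rho u != 0
    & forall w : 'cV[int]_m, rho (B *m w) = 1].

Definition binom (n : nat) (c : C) (u : 'cV[int]_n) : {mpoly C[n]} :=
  'X_[posm u] - c *: 'X_[negm u].

Definition in_Irho (d n : nat) (A : 'M[int]_(d, n)) (rho : 'cV[int]_n -> C)
    (P : {mpoly C[n]}) : Prop :=
  exists s : seq ({mpoly C[n]} * 'cV[int]_n),
    (forall p, p \in s -> inL A p.2) /\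
    P = \sum_(p <- s) p.1 * binom (rho p.2) p.2.

Definition in_IB (n m : nat) (B : 'M[int]_(n, m)) (P : {mpoly C[n]}) : Prop :=
  exists s : seq ({mpoly C[n]} * 'cV[int]_m),
    P = \sum_(p <- s) p.1 * binom 1 (B *m p.2).

Definition is_solution (d n : nat) (A : 'M[int]_(d, n)) (beta : 'I_d -> C)
    (I : {mpoly C[n]} -> Prop) (U : ('I_n -> C) -> Prop)
    (f : ('I_n -> C) -> C) : Prop :=
  [/\ holomorphic_on U f,
      forall P, I P -> forall x, U x -> apply_op P f x = 0
    & forall k : 'I_d, forall x, U x ->
        \sum_j (A k j)%:~R * x j * pd j f x - beta k * f x = 0].

(* Lebesgue-null subsets of C^d = R^(2d): coverable by countably many cubes
   of arbitrarily small total volume *)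
Definition nullset (d : nat) (E : ('I_d -> C) -> Prop) : Prop :=
  forall eps : C, 0 < eps ->
    exists (c : nat -> 'I_d -> C) (r : nat -> C),
      [/\ forall k, 0 < r k,
          forall z, E z -> exists k, forall l,
            `|'Re (z l - c k l)| < r k /\ `|'Im (z l - c k l)| < r k
        & forall N, \sum_(k < N) (2 * r k) ^+ (2 * d) < eps].

End Defs.

(* Main.v *)
(** There are polynomials P_rho in d, for rho in J, all A-homogeneous of the
    degree of one monomial d^alpha, such that the sum of the P_rho is d^alpha
    modulo I_J and each P_rho f is a rho-eigenvector of the monomials in d (that
    is, it is killed by I_rho).  So d^alpha f splits as the sum of the P_rho f,
    and it remains to invert d^alpha.

    Let S be the set of k such that k - m - alpha lies in L_B for some m in N^n.
    There are finitely many integral affine forms l(A k) - c, with l nonzero,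
    such that every k in N^n outside S is a zero of one of them.  Their product b,
    written in normal order, is b(A theta) = sum_(k in S) y_k x^k d^k, so that
      b(beta) f = sum_(k in S) y_k x^k d^k f,
    and b(beta) is nonzero unless beta lies on one of countably many hyperplanes.
    For k in S the "derivative" d^(k - alpha) makes sense on a rho-eigenvector,
    hence f is the sum of
      f_rho = b(beta)^-1 sum_(k in S) y_k x^k d^(k - alpha) P_rho f.
    Conjugating b(A theta) by d^u shifts its argument by A u only, and for this
    reason f_rho is again a rho-eigenvector.

    Holomorphic functions are infinitely differentiable by Goursat's argument
    run on trapezoid sums, which are additive under subdivision and exact on
    affine functions, so that no integral is needed; the Cauchy estimate comes
    from the sums of (f z - f 0) / z^2 around 0. *)

Require Import Defs.
From HB Require Import structures.
From mathcomp Require Import all_boot all_order all_algebra.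
From mathcomp Require Import reals complex ssrcomplements mpoly.
From mathcomp Require Import boolp classical_sets functions.
From mathcomp Require Import cyclic separable cyclotomic.
From mathcomp Require Import ring lra zify.
Import Order.TTheory GRing.Theory Num.Theory.
Local Open Scope ring_scope.

(** The ideals I_rho are homogeneous and all vanish at the origin, so as soon as there are two of
    them no polynomials with sum 1 can separate the characters: only a monomial d^alpha can be
    split, and d^alpha may kill solutions for special beta. Genericity enters only in the division
    by b(beta), which takes the place of inverting d^alpha. The forms l come from sets of
    coordinates whose columns in A do not span Q^d, and Newton's interpolation formula accounts for
    the vanishing of y_k off S. The exceptional set is the union of all hyperplanes l(beta) = c with
    l and c integral and l nonzero, so it depends on none of J, the open set U and f. Each f_rho
    arises from f by a differential operator with polynomial coefficients, hence lives on the same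
    U, whatever its shape. *)

Module Hypergeometric.
Set Implicit Arguments.
Unset Strict Implicit.
Unset Printing Implicit Defensive.

(** * Trapezoid sums and the Cauchy estimate *)

Section ComplexBasics.
Variable R : realType.
Local Notation C := R[i].

(** The norm of [R[i]] takes its values in [R[i]], whose order is only partial; a modulus in [R]
    gives access to suprema and linear arithmetic. *)
Definition cabs (z : C) : R := complex.Re `|z|.

Lemma normc_cabs (z : C) : `|z| = (cabs z)%:C%C.
Proof. by rewrite /cabs RRe_real // normr_real. Qed.

Lemma cabs_ge0 z : 0 <= cabs z.
Proof. by rewrite -ler0c -normc_cabs. Qed.

Lemma cabsD x y : cabs (x + y) <= cabs x + cabs y.
Proof. by rewrite -lecR rmorphD /= -!normc_cabs ler_normD. Qed.

Lemma cabsM x y : cabs (x * y) = cabs x * cabs y.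
Proof. by apply: (@complexI R); rewrite rmorphM /= -!normc_cabs normrM. Qed.

Lemma cabsN x : cabs (- x) = cabs x.
Proof. by apply: (@complexI R); rewrite -!normc_cabs normrN. Qed.

Lemma cabsB x y : cabs (x - y) <= cabs x + cabs y.
Proof. by rewrite (le_trans (cabsD _ _)) // cabsN. Qed.

Lemma cabsV x : cabs x^-1 = (cabs x)^-1.
Proof. by apply: (@complexI R); rewrite fmorphV /= -!normc_cabs normfV. Qed.

Lemma cabsf_div x y : cabs (x / y) = cabs x / cabs y.
Proof. by rewrite cabsM cabsV. Qed.

Lemma cabs0 : cabs 0 = 0.
Proof. by rewrite /cabs normr0. Qed.

Lemma cabs_eq0 x : (cabs x == 0) = (x == 0).
Proof. by rewrite -(inj_eq (@complexI R)) -normc_cabs normr_eq0. Qed.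

Lemma cabs_gt0 x : (0 < cabs x) = (x != 0).
Proof. by rewrite lt_neqAle cabs_ge0 andbT eq_sym cabs_eq0. Qed.

Lemma cabsR (x : R) : cabs x%:C%C = `|x|.
Proof. by rewrite /cabs normc_def /= expr0n /= addr0 sqrtr_sqr. Qed.

Lemma cabs_pos (x : R) : 0 <= x -> cabs x%:C%C = x.
Proof. by rewrite cabsR => /ger0_norm. Qed.

Lemma cabs_nat n : cabs n%:R = n%:R.
Proof. by rewrite /cabs normr_nat -(rmorph_nat (real_complex R)). Qed.

Lemma cabsi : cabs 'i%C = 1.
Proof. by rewrite /cabs normc_def /= expr0n /= add0r expr1n sqrtr1. Qed.

Lemma cReD (x y : C) : complex.Re (x + y) = complex.Re x + complex.Re y.
Proof. by case: x; case: y. Qed.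
Lemma cImD (x y : C) : complex.Im (x + y) = complex.Im x + complex.Im y.
Proof. by case: x; case: y. Qed.
Lemma cReN (x : C) : complex.Re (- x) = - complex.Re x.
Proof. by case: x. Qed.
Lemma cImN (x : C) : complex.Im (- x) = - complex.Im x.
Proof. by case: x. Qed.
Lemma cReMr (x : R) (z : C) : complex.Re (x%:C%C * z) = x * complex.Re z.
Proof. by case: z => a b; rewrite /= mul0r subr0. Qed.
Lemma cImMr (x : R) (z : C) : complex.Im (x%:C%C * z) = x * complex.Im z.
Proof. by case: z => a b; rewrite /= mul0r addr0. Qed.
Lemma ReiM (z : C) : complex.Re ('i%C * z) = - complex.Im z.
Proof. by case: z => a b; rewrite /= mul0r mul1r sub0r. Qed.
Lemma ImiM (z : C) : complex.Im ('i%C * z) = complex.Re z.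
Proof. by case: z => a b; rewrite /= mul0r mul1r add0r. Qed.
Lemma half_realc : (2^-1 : C) = (2^-1 : R)%:C%C.
Proof. by rewrite fmorphV /= rmorph_nat. Qed.
Lemma Re_half (z : C) : complex.Re (z / 2) = complex.Re z / 2.
Proof. by rewrite mulrC half_realc cReMr mulrC. Qed.
Lemma Im_half (z : C) : complex.Im (z / 2) = complex.Im z / 2.
Proof. by rewrite mulrC half_realc cImMr mulrC. Qed.

Definition ReImE := (cReD, cImD, cReN, cImN, cReMr, cImMr, ReiM, ImiM, Re_half, Im_half).

Lemma cabs_Re (z : C) : `|complex.Re z| <= cabs z.
Proof. by rewrite -lecR -normc_cabs normc_ge_Re. Qed.

Lemma cabs_Im (z : C) : `|complex.Im z| <= cabs z.
Proof.
have -> : cabs z = cabs ('i%C * z) by rewrite cabsM cabsi mul1r.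
by rewrite -normrN -ReiM cabs_Re.
Qed.

Lemma cabs_le_ReIm (z : C) : cabs z <= `|complex.Re z| + `|complex.Im z|.
Proof.
rewrite {1}(complexE z) (le_trans (cabsD _ _)) // cabsM cabsi mul1r !cabsR //.
Qed.

Lemma cabs_sqr (z : C) : cabs z ^+ 2 = complex.Re z ^+ 2 + complex.Im z ^+ 2.
Proof.
by rewrite /cabs normc_def /= sqr_sqrtr // addr_ge0 // sqr_ge0.
Qed.

Lemma gt0c (e : C) : 0 < e -> exists2 r : R, 0 < r & e = r%:C%C.
Proof.
move=> e0; exists (complex.Re e); last by rewrite RRe_real // gtr0_real.
by rewrite -ltcR RRe_real // gtr0_real.
Qed.

Lemma norm_ltc (z : C) (r : R) : (`|z| < r%:C%C) = (cabs z < r).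
Proof. by rewrite normc_cabs ltcR. Qed.

Lemma norm_lec (z : C) (r : R) : (`|z| <= r%:C%C) = (cabs z <= r).
Proof. by rewrite normc_cabs lecR. Qed.

Lemma exists_pow2_lt (l d : R) : 0 < d -> exists s, l / 2 ^+ s < d.
Proof.
move=> d0; exists (Num.bound (l / d)).
have := upper_nthrootP (leqnn (Num.bound (l / d))).
by rewrite ltr_pdivrMr // ltr_pdivrMr ?exprn_gt0 // mulrC.
Qed.

Lemma le_eps (x y : R) : (forall e, 0 < e -> x <= y + e) -> x <= y.
Proof. by move=> h; apply/ler_addgt0Pr => e /h. Qed.

(** The left endpoints increase and are bounded by every right endpoint, so their supremum lies in
    all the intervals. *)
Lemma nested_intervals (a : nat -> R) (l : R) : 0 <= l ->
  (forall s, a s <= a s.+1 /\ a s.+1 + l / 2 ^+ s.+1 <= a s + l / 2 ^+ s) ->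
  exists x, forall s, a s <= x <= a s + l / 2 ^+ s.
Proof.
move=> l0 H.
have up s k : a s <= a (s + k)%N.
  elim: k => [|k IH]; rewrite ?addn0 // addnS (le_trans IH) //.
  by case: (H (s + k)%N).
have dn s k : a (s + k)%N + l / 2 ^+ (s + k) <= a s + l / 2 ^+ s.
  elim: k => [|k IH]; rewrite ?addn0 // addnS (le_trans _ IH) //.
  by case: (H (s + k)%N).
have pos s : 0 <= l / 2 ^+ s by rewrite divr_ge0 // exprn_ge0.
have ub s : ubound [set a k | k in setT] (a s + l / 2 ^+ s).
  move=> _ [k _ <-]; case: (leqP s k) => [sk|/ltnW ks].
    by apply: le_trans (dn s (k - s)%N); rewrite subnKC // lerDl.
  by apply: le_trans (up k (s - k)%N) _; rewrite subnKC // lerDl.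
exists (sup [set a k | k in setT]) => s; apply/andP; split.
  by apply: ub_le_sup; [exists (a 0%N + l / 2 ^+ 0); exact: ub|exists s].
by apply: ge_sup; [exists (a 0%N), 0%N|exact: ub].
Qed.

End ComplexBasics.

Section Trapezoid.
Variable R : realType.
Local Notation C := R[i].
Implicit Types (g : C -> C) (a b c z : C) (l : R).

Definition cdiff g z (d : C) := forall e : R, 0 < e -> exists2 del : R, 0 < del &
  forall h, cabs h < del -> cabs (g (z + h) - g z - d * h) <= e * cabs h.

(* The trapezoid rule for the integral of g along [a, b], with 2^p steps. *)
Fixpoint seg p g a b : C :=
  if p is p'.+1 then seg p' g a ((a + b) / 2) + seg p' g ((a + b) / 2) b
  else (g a + g b) / 2 * (b - a).

Definition square_sum p g c l : C :=
  let L := l%:C%C in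
  seg p g c (c + L) + seg p g (c + L) (c + L + 'i%C * L)
  + seg p g (c + L + 'i%C * L) (c + 'i%C * L) + seg p g (c + 'i%C * L) c.

Lemma segN p g a b : seg p g b a = - seg p g a b.
Proof.
elim: p a b => [|p IH] a b /=.
  by ring.
by rewrite (addrC b) (IH a) (IH _ b); ring.
Qed.

(** Halving an edge uses up one level of refinement, so its two halves carry exactly the level [p]
    sums of the small squares; the inner edges are run through twice in opposite directions and
    cancel. *)
Lemma square_sum_split p g c l : let h := l / 2 in
  square_sum p.+1 g c l = square_sum p g c h + square_sum p g (c + h%:C%C) h
    + square_sum p g (c + 'i%C * h%:C%C) h
    + square_sum p g (c + h%:C%C + 'i%C * h%:C%C) h.
Proof.
move=> h; rewrite /square_sum /=.
have -> : l%:C%C = h%:C%C + h%:C%C :> C by rewrite -rmorphD /= -splitr.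
set H := h%:C%C; set j := 'i%C.
have -> : (c + (c + (H + H))) / 2 = c + H by field.
have -> : (c + (H + H) + (c + (H + H) + j * (H + H))) / 2 = c + (H + H) + j * H by field.
have -> : (c + (H + H) + j * (H + H) + (c + j * (H + H))) / 2 = c + H + j * (H + H) by field.
have -> : (c + j * (H + H) + c) / 2 = c + j * H by field.
rewrite (segN _ _ (c + H + j * H) (c + H)) (segN _ _ (c + j * H) (c + H + j * H)).
have -> : c + H + H = c + (H + H) by ring.
have -> : c + j * H + H = c + H + j * H by ring.
have -> : c + H + j * H + H = c + (H + H) + j * H by ring.
have -> : c + j * H + j * H = c + j * (H + H) by ring.
have -> : c + H + j * H + j * H = c + H + j * (H + H) by ring.
have -> : c + (H + H) + j * H + j * H = c + (H + H) + j * (H + H) by ring.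
rewrite (segN _ _ (c + H + j * H) (c + (H + H) + j * H)).
rewrite (segN _ _ (c + H + j * (H + H)) (c + H + j * H)).
by ring.
Qed.

(** All nodes are iterated midpoints of the endpoints, so a set closed under midpoints contains
    them; the bound does not depend on [p]. *)
Lemma seg_bound (K : C -> Prop) M p g a b :
  (forall x y, K x -> K y -> K ((x + y) / 2)) -> K a -> K b ->
  (forall z, K z -> cabs (g z) <= M) -> cabs (seg p g a b) <= M * cabs (b - a).
Proof.
move=> Kmid Ka Kb gM; elim: p a b Ka Kb => [|p IH] a b Ka Kb /=.
  rewrite cabsM ler_wpM2r ?cabs_ge0 // cabsf_div cabs_nat.
  rewrite ler_pdivrMr // (le_trans (cabsD _ _)) //.
  by have := gM _ Ka; have := gM _ Kb; lra.
apply: le_trans (cabsD _ _) _.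
apply: le_trans (lerD (IH _ _ Ka (Kmid _ _ Ka Kb)) (IH _ _ (Kmid _ _ Ka Kb) Kb)) _.
have -> : (a + b) / 2 - a = (b - a) / 2 by field.
have -> : b - (a + b) / 2 = (b - a) / 2 by field.
by rewrite cabsf_div cabs_nat -mulrDr -splitr.
Qed.

Lemma seg_affine p (al be : C) a b :
  seg p (fun z => al * z + be) a b = al / 2 * (b ^+ 2 - a ^+ 2) + be * (b - a).
Proof. by elim: p a b => [|p IH] a b /=; rewrite ?IH; field. Qed.

Lemma segD p g1 g2 a b : seg p (fun z => g1 z + g2 z) a b = seg p g1 a b + seg p g2 a b.
Proof. by elim: p a b => [|p IH] a b /=; rewrite ?IH; ring. Qed.

Lemma segZ p g (k : C) a b : seg p (fun z => k * g z) a b = k * seg p g a b.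
Proof. by elim: p a b => [|p IH] a b /=; rewrite ?IH; ring. Qed.

Lemma eq_seg p g1 g2 : g1 =1 g2 -> seg p g1 =2 seg p g2.
Proof. by move=> eg; elim: p => [|p IH] a b /=; rewrite ?IH // !eg. Qed.

Definition box c l z :=
  (complex.Re c <= complex.Re z <= complex.Re c + l) /\
  (complex.Im c <= complex.Im z <= complex.Im c + l).

Definition frame c l z := box c l z /\
  (complex.Re z = complex.Re c \/ complex.Re z = complex.Re c + l \/
   complex.Im z = complex.Im c \/ complex.Im z = complex.Im c + l).

Lemma square_sum_bound M p g c l : 0 <= l ->
  (forall z, frame c l z -> cabs (g z) <= M) -> cabs (square_sum p g c l) <= 4 * l * M.
Proof.
move=> l0 gM; rewrite /square_sum.
have jL : complex.Re ('i%C * l%:C%C) = 0 :> R by rewrite ReImE oppr0.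
have jI : complex.Im ('i%C * l%:C%C) = l :> R by rewrite ReImE.
have LR : complex.Re l%:C%C = l :> R by [].
have LI : complex.Im l%:C%C = 0 :> R by [].
pose K1 z := box c l z /\ complex.Im z = complex.Im c.
pose K2 z := box c l z /\ complex.Re z = complex.Re c + l.
pose K3 z := box c l z /\ complex.Im z = complex.Im c + l.
pose K4 z := box c l z /\ complex.Re z = complex.Re c.
have m1 x y : K1 x -> K1 y -> K1 ((x + y) / 2) by rewrite /K1 /box !ReImE; lra.
have m2 x y : K2 x -> K2 y -> K2 ((x + y) / 2) by rewrite /K2 /box !ReImE; lra.
have m3 x y : K3 x -> K3 y -> K3 ((x + y) / 2) by rewrite /K3 /box !ReImE; lra.
have m4 x y : K4 x -> K4 y -> K4 ((x + y) / 2) by rewrite /K4 /box !ReImE; lra.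
have g1 z : K1 z -> cabs (g z) <= M by move=> [bz e]; apply: gM; split => //; lra.
have g2 z : K2 z -> cabs (g z) <= M by move=> [bz e]; apply: gM; split => //; lra.
have g3 z : K3 z -> cabs (g z) <= M by move=> [bz e]; apply: gM; split => //; lra.
have g4 z : K4 z -> cabs (g z) <= M by move=> [bz e]; apply: gM; split => //; lra.
have b1 : cabs (seg p g c (c + l%:C%C)) <= M * l.
  have -> : M * l = M * cabs (c + l%:C%C - c) by rewrite addrAC subrr add0r cabs_pos.
  by apply: (seg_bound _ m1) => //; rewrite /K1 /box ?(cReD, cImD, jL, jI, LR, LI); lra.
have b2 : cabs (seg p g (c + l%:C%C) (c + l%:C%C + 'i%C * l%:C%C)) <= M * l.
  have -> : M * l = M * cabs (c + l%:C%C + 'i%C * l%:C%C - (c + l%:C%C)).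
    by rewrite addrAC subrr add0r cabsM cabsi mul1r cabs_pos.
  by apply: (seg_bound _ m2) => //; rewrite /K2 /box ?(cReD, cImD, jL, jI, LR, LI); lra.
have b3 : cabs (seg p g (c + l%:C%C + 'i%C * l%:C%C) (c + 'i%C * l%:C%C)) <= M * l.
  have -> : M * l = M * cabs (c + 'i%C * l%:C%C - (c + l%:C%C + 'i%C * l%:C%C)).
    rewrite (_ : _ - _ = - l%:C%C); last by ring.
    by rewrite cabsN cabs_pos.
  by apply: (seg_bound _ m3) => //; rewrite /K3 /box ?(cReD, cImD, jL, jI, LR, LI); lra.
have b4 : cabs (seg p g (c + 'i%C * l%:C%C) c) <= M * l.
  have -> : M * l = M * cabs (c - (c + 'i%C * l%:C%C)).
    rewrite (_ : _ - _ = - ('i%C * l%:C%C)); last by ring.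
    by rewrite cabsN cabsM cabsi mul1r cabs_pos.
  by apply: (seg_bound _ m4) => //; rewrite /K4 /box ?(cReD, cImD, jL, jI, LR, LI); lra.
have -> : 4 * l * M = M * l + M * l + M * l + M * l by ring.
by do 3! (apply: le_trans (cabsD _ _) _; apply: lerD => //).
Qed.

Lemma square_sum_affine p (al be : C) c l : square_sum p (fun z => al * z + be) c l = 0.
Proof. by rewrite /square_sum !seg_affine; field. Qed.

Lemma square_sumD p g1 g2 c l :
  square_sum p (fun z => g1 z + g2 z) c l = square_sum p g1 c l + square_sum p g2 c l.
Proof. by rewrite /square_sum !segD; ring. Qed.

Lemma square_sumZ p g (k : C) c l :
  square_sum p (fun z => k * g z) c l = k * square_sum p g c l.
Proof. by rewrite /square_sum !segZ; ring. Qed.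

Lemma eq_square_sum p g1 g2 c l : g1 =1 g2 -> square_sum p g1 c l = square_sum p g2 c l.
Proof. by move=> e; rewrite /square_sum !(eq_seg _ e). Qed.

End Trapezoid.

(** * Goursat's bisection argument for trapezoid sums *)

Section Goursat.
Variable R : realType.
Local Notation C := R[i].
Implicit Types (g : C -> C) (a b c z : C) (l : R).

Definition subcorner (k : bool * bool) c l : C :=
  c + (k.1%:R * l)%:C%C + 'i%C * (k.2%:R * l)%:C%C.

Lemma square_sum_split_corner p g c l :
  square_sum p.+1 g c l = \sum_(k : bool * bool) square_sum p g (subcorner k c (l / 2)) (l / 2).
Proof.
rewrite square_sum_split -(pair_bigA _ (fun i j => square_sum p g (subcorner (i, j) c (l / 2)) (l / 2))) /=.
rewrite !big_bool /subcorner /= !mul0r !mul1r !(mulr0, addr0).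
by ring.
Qed.

Lemma box_dist c l z w : box c l z -> box c l w -> cabs (z - w) <= 2 * l.
Proof.
move=> [z1 z2] [w1 w2]; apply: le_trans (cabs_le_ReIm _) _; rewrite !ReImE.
have h1 : `|complex.Re z - complex.Re w| <= l by rewrite ler_norml; lra.
have h2 : `|complex.Im z - complex.Im w| <= l by rewrite ler_norml; lra.
lra.
Qed.

(** The vanishing of the integral is replaced by smallness of the sums at all sufficiently fine
    levels. If this fails, it fails on a quarter with the bound scaled to the area; the nested
    quarters shrink to a point near which [g] is affine up to a small error, and affine functions
    have sum 0. *)
Lemma goursat g c l : 0 < l -> (forall z, box c l z -> exists d, cdiff g z d) ->
  forall e : R, 0 < e ->
    exists P, forall p, (P <= p)%N -> cabs (square_sum p g c l) <= e.
Proof.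
move=> l0 gd e0 e0_gt0.
pose e := e0 / l ^+ 2.
have e_gt0 : 0 < e by rewrite divr_gt0 // exprn_gt0.
pose side s : R := l / 2 ^+ s.
have sideS s : side s.+1 = side s / 2 by rewrite /side exprSr invfM mulrA.
have side_gt0 s : 0 < side s by rewrite divr_gt0 // exprn_gt0.
(* The bound is proportional to the area, so that the bounds for the four quarters add up to it. *)
pose good c' s := exists P, forall p, (P <= p)%N ->
  cabs (square_sum p g c' (side s)) <= e * side s ^+ 2.
suff : good c 0%N.
  move=> [P HP]; exists P => p /HP; rewrite /side expr0 divr1 /e divfK //.
  by rewrite expf_neq0 // gt_eqF.
have next c' s : ~ good c' s -> exists k, ~ good (subcorner k c' (side s.+1)) s.+1.
  move=> ng; apply: contrapT => h; apply: ng.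
  have {}h k : good (subcorner k c' (side s.+1)) s.+1.
    by apply: contrapT => hk; apply: h; exists k.
  have [P HP] := boolp.choice h.
  (* The sum is at least each of the four thresholds, and one more level is spent on the
     subdivision. *)
  exists (\sum_k P k).+1 => -[//|p] hp.
  rewrite square_sum_split_corner -sideS.
  have -> : e * side s ^+ 2 = \sum_(k : bool * bool) e * side s.+1 ^+ 2.
    rewrite sumr_const card_prod card_bool sideS -[RHS]mulr_natl natrM.
    by field.
  have : forall k, cabs (square_sum p g (subcorner k c' (side s.+1)) (side s.+1)) <= e * side s.+1 ^+ 2.
    move=> k; apply: HP; apply: (@leq_trans (\sum_k P k)) => //.
    by rewrite (bigD1 k) //= leq_addr.
  move=> H; elim/big_ind2 : _ => [|x1 x2 y1 y2 h1 h2|k _]; rewrite ?cabs0 ?H //.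
  by apply: le_trans (cabsD _ _) _; apply: lerD.
apply: contrapT => bad0.
have [nxt nxtP] : {nxt : C * nat -> bool * bool & forall q, ~ good q.1 q.2 ->
    ~ good (subcorner (nxt q) q.1 (side q.2.+1)) q.2.+1}.
  apply: (boolp.choice (P := fun q k => ~ good q.1 q.2 -> ~ good (subcorner k q.1 (side q.2.+1)) q.2.+1)).
  move=> [c' s] /=; have [hg|/next [k hk]] := pselect (good c' s); last by exists k.
  by exists (true, true).
pose cs := fix cs s := if s is s'.+1 then
  subcorner (nxt (cs s', s')) (cs s') (side s'.+1) else c.
have bad s : ~ good (cs s) s by elim: s => [//|s IH] /=; apply: (nxtP (cs s, s)).
have step s : exists k, cs s.+1 = subcorner k (cs s) (side s.+1) by eexists; reflexivity.
have bnat (b : bool) : 0 <= b%:R :> R /\ b%:R <= 1 :> R by case: b => /=; lra.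
have [x xP] : exists x, forall s, complex.Re (cs s) <= x <= complex.Re (cs s) + l / 2 ^+ s.
  apply: nested_intervals; first exact: ltW.
  move=> s; have [k ->] := step s; rewrite -!/(side _) /subcorner !ReImE /= sideS.
  have := bnat k.1; have := side_gt0 s; nra.
have [y yP] : exists x, forall s, complex.Im (cs s) <= x <= complex.Im (cs s) + l / 2 ^+ s.
  apply: nested_intervals; first exact: ltW.
  move=> s; have [k ->] := step s; rewrite -!/(side _) /subcorner !ReImE /= sideS.
  have := bnat k.2; have := side_gt0 s; nra.
pose z0 : C := (x +i* y)%C.
have z0b s : box (cs s) (side s) z0 by split => /=.
have z0c : box c l z0 by have := z0b 0%N; rewrite /side expr0 divr1.
have [d dP] := gd z0 z0c.
(* Points of the square are at distance at most 2 [side s] and the perimeter is 4 [side s]; 8 is the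
   product of the two factors. *)
have e8 : 0 < e / 8 by lra.
have [del del0 Hdel] := dP _ e8.
have [s Hs] := exists_pow2_lt (2 * l) del0.
apply: (bad s); exists 0%N => p _.
pose r z := g z - (d * z + (g z0 - d * z0)).
have -> : square_sum p g (cs s) (side s) = square_sum p r (cs s) (side s).
  rewrite -[RHS]addr0 -(square_sum_affine p d (g z0 - d * z0) (cs s) (side s)) -square_sumD.
  by apply: eq_square_sum => z; rewrite /r subrK.
have -> : e * side s ^+ 2 = 4 * side s * (e / 8 * (2 * side s)) by field.
apply: square_sum_bound; first exact: ltW.
move=> z [bz _].
have hz := box_dist bz (z0b s).
have -> : r z = g (z0 + (z - z0)) - g z0 - d * (z - z0).
  by rewrite /r (addrC z0) subrK; ring.
apply: le_trans (Hdel _ _) _; last by rewrite ler_wpM2l // ltW.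
by apply: le_lt_trans hz _; rewrite /side mulrA.
Qed.

End Goursat.

(** * The Cauchy estimate at the centre of a square *)

Section CauchyEstimate.
Variable R : realType.
Local Notation C := R[i].
Implicit Types (g f : C -> C) (a b c z : C) (l r : R).

Definition centered r : C := (- r +i* - r)%C.

Lemma frame_centered r z : 0 < r -> frame (centered r) (2 * r) z ->
  r <= cabs z <= 2 * r /\ box (centered r) (2 * r) z.
Proof.
move=> r0 [bz fz]; split => //; have [] := bz; rewrite /= => z1 z2.
have h1 := cabs_Re z; have h2 := cabs_Im z; have h3 := cabs_le_ReIm z.
have h4 := ler_norm (complex.Re z); have h5 := ler_norm (complex.Im z).
have h6 := ler_norm (- complex.Re z); have h7 := ler_norm (- complex.Im z).
rewrite !normrN in h6 h7.
have h8 : `|complex.Re z| <= r by rewrite ler_norml; lra.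
have h9 : `|complex.Im z| <= r by rewrite ler_norml; lra.
by move: fz => /=; lra.
Qed.

(** The square is cut into 16 cells of side [r / 2]: the four around the origin make up the centred
    square of half the size, and the other twelve avoid the origin, so [goursat] applies to them.
    Levels [p.+2] and [p.+1] both become level [p] on the cells. *)
Lemma square_sum_shrink g r : 0 < r ->
  (forall z, z != 0 -> box (centered r) (2 * r) z -> exists d, cdiff g z d) ->
  forall e : R, 0 < e -> exists P, forall p, (P <= p)%N ->
    cabs (square_sum p.+2 g (centered r) (2 * r) - square_sum p.+1 g (centered (r / 2)) r) <= e.
Proof.
move=> r0 gd e e0.
(* Within quadrant [k], the quarter touching the origin is the one in the opposite position. *)
pose neg (k : bool * bool) := (~~ k.1, ~~ k.2).
pose cell (k k' : bool * bool) := subcorner k' (subcorner k (centered r) r) (r / 2).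
have cellin k : cell k (neg k) = subcorner k (centered (r / 2)) (r / 2).
  case: k => [[] []]; apply/eqP; rewrite eq_complex /cell /subcorner /centered /=;
    by apply/andP; split; apply/eqP; field.
have r2 : 0 < r / 2 by rewrite divr_gt0.
have eqs p : square_sum p.+2 g (centered r) (2 * r) - square_sum p.+1 g (centered (r / 2)) r
  = \sum_k \sum_(k' | k' != neg k) square_sum p g (cell k k') (r / 2).
  rewrite !square_sum_split_corner -sumrB; apply: eq_bigr => k _.
  rewrite (_ : 2 * r / 2 = r); last by field.
  rewrite square_sum_split_corner (bigD1 (neg k)) //= -/(cell _ _) cellin.
  by rewrite addrAC subrr add0r.
have G k k' : exists P, k' != neg k -> forall p, (P <= p)%N ->
    cabs (square_sum p g (cell k k') (r / 2)) <= e / 16.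
  have [/eqP ->|knk] := boolP (k' == neg k); first by exists 0%N.
  have [] := @goursat R g (cell k k') (r / 2) r2 _ (e / 16) _; [|lra|by move=> P HP; exists P].
  move=> z bz.
  have : z != 0 /\ box (centered r) (2 * r) z.
    case: k k' knk bz => [[] []] [[] []] //= _; rewrite /box /cell /subcorner /centered /=;
      case: z => x y /= [h1 h2]; rewrite eq_complex /=; (split; [apply/negP => /andP[/eqP ? /eqP ?]; lra|lra]).
  by move=> [z0 zb]; apply: gd.
have G2 k : {P & forall k', k' != neg k -> forall p, (P k' <= p)%N ->
    cabs (square_sum p g (cell k k') (r / 2)) <= e / 16}.
  exact: (boolp.choice (G k)).
pose P k k' := projT1 (G2 k) k'.
exists (\sum_k \sum_k' P k k')%N => p hp; rewrite eqs.
have c4 : #|{: bool * bool}| = 4%N by rewrite card_prod card_bool.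
have -> : e = \sum_(k : bool * bool) \sum_(k' : bool * bool) e / 16.
  rewrite !sumr_const c4 -mulrnA -[RHS]mulr_natr (_ : (4 * 4)%N = 16%N) //.
  by rewrite divfK // pnatr_eq0.
have cabs_sum (I : finType) (Q : pred I) (F : I -> C) (m : R) : 0 <= m ->
   (forall i, Q i -> cabs (F i) <= m) -> cabs (\sum_(i | Q i) F i) <= \sum_(i : I) m.
  move=> m0 H; rewrite [leRHS](bigID Q) /=.
  rewrite -[leLHS]addr0 lerD ?sumr_ge0 //.
  elim/big_ind2 : _ => [|x1 x2 y1 y2 h1 h2|k Qk]; rewrite ?cabs0 ?H //.
  by apply: le_trans (cabsD _ _) _; apply: lerD.
apply: (cabs_sum _ predT) => [|k _]; first by apply: sumr_ge0 => ? _; lra.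
apply: cabs_sum => [|k' kk]; first lra.
apply: (projT2 (G2 k)) => //; apply: leq_trans _ hp.
by rewrite (bigD1 k) //= (bigD1 k') //= -addnA leq_addr.
Qed.

Lemma square_sum_shrink_iter g r : 0 < r ->
  (forall z, z != 0 -> box (centered r) (2 * r) z -> exists d, cdiff g z d) ->
  forall s (e : R), 0 < e -> exists P, forall p, (P <= p)%N ->
    cabs (square_sum (p + s).+1 g (centered r) (2 * r)
      - square_sum p.+1 g (centered (r / 2 ^+ s)) (2 * (r / 2 ^+ s))) <= e.
Proof.
move=> r0 gd; elim=> [|s IH] e e0.
  by exists 0%N => p _; rewrite expr0 divr1 addn0 subrr cabs0 ltW.
have e2 : 0 < e / 2 by lra.
have [P HP] := IH _ e2.
have p2 : (1 : R) <= 2 ^+ s by rewrite exprn_ege1 // ler1n.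
have rs : 0 < r / 2 ^+ s by rewrite divr_gt0 // exprn_gt0.
have rsr : r / 2 ^+ s <= r by rewrite ler_pdivrMr; [nra|lra].
have [|P' HP'] := @square_sum_shrink g _ rs _ _ e2.
  by move=> z z0 bz; apply: gd => //; move: bz; rewrite /box /=; lra.
exists (P + P')%N => p hp.
have := HP p.+1; have := HP' p.
have -> : 2 * (r / 2 ^+ s.+1) = r / 2 ^+ s by rewrite exprS; field; rewrite expf_neq0 ?pnatr_eq0.
have -> : r / 2 ^+ s.+1 = r / 2 ^+ s / 2 by rewrite exprSr invfM mulrA.
have -> : (p + s.+1 = p.+1 + s)%N by rewrite addnS addSn.
move=> /(_ (leq_trans (leq_addl _ _) hp)) h1 /(_ (leq_trans (leq_addr _ _) (leq_trans hp (leqnSn _)))) h2.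
set x := square_sum _ _ _ _ in h2 *; set y := square_sum _ _ _ (2 * _) in h1 h2.
set w := square_sum p.+1 _ _ _ in h1 *.
rewrite (_ : x - w = (x - y) + (y - w)); last by ring.
by apply: le_trans (cabsD _ _) _; lra.
Qed.

(** The form dz / z is invariant under rotation and scaling, so the four edges of a centred square
    contribute equally. *)
Lemma seg_inv_rot p (u a b : C) : u != 0 -> seg p (fun z => z^-1) (u * a) (u * b) = seg p (fun z => z^-1) a b.
Proof.
move=> u0; elim: p a b => [|p IH] a b /=.
  rewrite !invfM (_ : _ * _ = (u^-1 * u) * ((a^-1 + b^-1) / 2 * (b - a))); last by ring.
  by rewrite mulVf // mul1r.
by rewrite -mulrDr -mulrA !IH.
Qed.

Lemma Re_inv (z : C) : complex.Re z^-1 = complex.Re z / cabs z ^+ 2.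
Proof. by rewrite cabs_sqr; case: z. Qed.

(** On this edge dz = i dy, and Re (1 / z) = r / |z|^2 is at least 1 / (2 r) because |z|^2 <= 2 r^2.
    The bound is additive under subdivision, so it holds at every level. *)
Lemma seg_inv_right p r (a b : C) : 0 < r ->
  complex.Re a = r -> complex.Re b = r -> `|complex.Im a| <= r -> `|complex.Im b| <= r ->
  complex.Im a <= complex.Im b ->
  (complex.Im b - complex.Im a) / (2 * r) <= complex.Im (seg p (fun z => z^-1) a b).
Proof.
move=> r0; elim: p a b => [|p IH] a b ra rb ia ib ab; last first.
  have h1 : complex.Re ((a + b) / 2) = r by rewrite !ReImE ra rb; lra.
  have h2 : complex.Im ((a + b) / 2) = (complex.Im a + complex.Im b) / 2 by rewrite !ReImE.
  have h3 : `|complex.Im ((a + b) / 2)| <= r.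
    by move: ia ib; rewrite h2 !ler_norml; lra.
  rewrite /= cImD.
  have := IH a ((a + b) / 2) ra h1 ia h3; have := IH ((a + b) / 2) b h1 rb h3 ib.
  rewrite h2 => H1 H2.
  have {}H1 := H1 ltac:(lra); have {}H2 := H2 ltac:(lra).
  apply: le_trans (lerD H2 H1); rewrite -mulrDl ler_pM2r ?invr_gt0; lra.
rewrite /=.
have inv_ge (z : C) : complex.Re z = r -> `|complex.Im z| <= r -> (2 * r)^-1 <= complex.Re z^-1.
  move=> rz iz; rewrite Re_inv rz cabs_sqr rz.
  have h : complex.Im z ^+ 2 <= r ^+ 2 by rewrite -(real_normK (num_real _)) lerXn2r ?nnegrE // ltW.
  have i0 : 0 <= complex.Im z ^+ 2 by rewrite sqr_ge0.
  rewrite ler_pdivlMr; last by nra.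
  by rewrite mulrC ler_pdivrMr; nra.
have -> : b - a = 'i%C * (complex.Im b - complex.Im a)%:C%C.
  by apply/eqP; rewrite eq_complex; apply/andP; split; apply/eqP;
    rewrite ?ReImE ?ra ?rb /=; ring.
rewrite mulrCA ImiM [X in complex.Re X]mulrC cReMr Re_half cReD.
rewrite ler_wpM2l ?subr_ge0 //.
have := inv_ge _ ra ia; have := inv_ge _ rb ib; lra.
Qed.

(** The sums tend to 2 pi i, but a lower bound uniform in [p] suffices for the Cauchy estimate: each
    of the four edges has the same sum, with imaginary part at least 1. *)
Lemma square_sum_inv p r : 0 < r ->
  4 <= cabs (square_sum p (fun z => z^-1) (centered r) (2 * r)).
Proof.
move=> r0; set j : C := 'i%C.
have j0 : j != 0 by rewrite -cabs_eq0 cabsi oner_eq0.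
pose S := seg p (fun z => z^-1) (r +i* - r)%C (r +i* r)%C.
have hS : 1 <= complex.Im S.
  have /= h := @seg_inv_right p r (r +i* - r)%C (r +i* r)%C r0 erefl erefl.
  have {}h := h ltac:(by rewrite normrN (ger0_norm (ltW r0))) ltac:(by rewrite (ger0_norm (ltW r0))) ltac:(lra).
  by apply: le_trans h; rewrite ler_pdivlMr; lra.
have -> : square_sum p (fun z => z^-1) (centered r) (2 * r) = 4 * S.
  rewrite /square_sum /centered.
  set c1 := (_ +i* _)%C.
  have -> : c1 = (- j) * (r +i* - r)%C by apply/eqP; rewrite eq_complex /=; apply/andP; split; apply/eqP; ring.
  have -> : - j * (r +i* - r)%C + (2 * r)%:C%C = (- j) * (r +i* r)%C.
    by apply/eqP; rewrite eq_complex /=; apply/andP; split; apply/eqP; ring.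
  have e2 : - j * (r +i* r)%C = (r +i* - r)%C.
    by apply/eqP; rewrite eq_complex /=; apply/andP; split; apply/eqP; ring.
  have e3 : - j * (r +i* r)%C + j * (2 * r)%:C%C = (r +i* r)%C.
    by apply/eqP; rewrite eq_complex /=; apply/andP; split; apply/eqP; ring.
  have e4 : - j * (r +i* - r)%C + j * (2 * r)%:C%C = j * (r +i* r)%C.
    by apply/eqP; rewrite eq_complex /=; apply/andP; split; apply/eqP; ring.
  have e5 : (r +i* r)%C = j * (r +i* - r)%C.
    by apply/eqP; rewrite eq_complex /=; apply/andP; split; apply/eqP; ring.
  have e6 : j * (r +i* r)%C = - 1 * (r +i* - r)%C.
    by apply/eqP; rewrite eq_complex /=; apply/andP; split; apply/eqP; ring.
  have e7 : - j * (r +i* - r)%C = - 1 * (r +i* r)%C.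
    by apply/eqP; rewrite eq_complex /=; apply/andP; split; apply/eqP; ring.
  rewrite e3 e4 seg_inv_rot ?oppr_eq0 // e2 -/S.
  rewrite {1}e5 seg_inv_rot // -/S e6 e7 seg_inv_rot ?oppr_eq0 ?oner_eq0 // -/S.
  by ring.
rewrite cabsM cabs_nat; have := cabs_Im S; have := ler_norm (complex.Im S); lra.
Qed.

Lemma cdiff_const (k z : C) : cdiff (fun _ => k) z 0.
Proof.
move=> e e0; exists 1 => // h _.
by rewrite subrr mul0r subr0 cabs0 mulr_ge0 ?cabs_ge0 // ltW.
Qed.

Lemma cdiffD f g z (d d' : C) : cdiff f z d -> cdiff g z d' ->
  cdiff (fun z => f z + g z) z (d + d').
Proof.
move=> hf hg e e0; have e2 : 0 < e / 2 by lra.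
have [d1 d10 H1] := hf _ e2; have [d2 d20 H2] := hg _ e2.
exists (Num.min d1 d2); first by rewrite lt_min d10.
move=> h; rewrite lt_min => /andP[/H1 h1 /H2 h2].
rewrite (_ : _ - _ = (f (z + h) - f z - d * h) + (g (z + h) - g z - d' * h)); last by ring.
by apply: le_trans (cabsD _ _) _; lra.
Qed.

Lemma cdiffM f g z (d d' : C) : cdiff f z d -> cdiff g z d' ->
  cdiff (fun z => f z * g z) z (d * g z + f z * d').
Proof.
move=> hf hg e e0.
pose K := cabs (f z) + cabs (g z) + (cabs d + 1) * (cabs d' + 1).
have f0 := cabs_ge0 (f z); have g0 := cabs_ge0 (g z).
have a0 := cabs_ge0 d; have a0' := cabs_ge0 d'.
have K0 : 0 < K by rewrite /K; nra.
have [t [t0 t1 tK]] : exists t, [/\ 0 < t, t <= 1 & t * K <= e].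
  exists (Num.min 1 (e / K)); rewrite lt_min ltr01 divr_gt0 // ge_min lexx; split => //.
  by rewrite -ler_pdivlMr // ge_min lexx orbT.
have [d1 d10 H1] := hf _ t0; have [d2 d20 H2] := hg _ t0.
exists (Num.min t (Num.min d1 d2)); first by rewrite !lt_min t0 d10.
move=> h; rewrite !lt_min => /and3P[ht /H1 + /H2].
set r1 := f (z + h) - f z - d * h; set r2 := g (z + h) - g z - d' * h => h1 h2.
rewrite (_ : _ - _ = f z * r2 + g z * r1 + (d * h + r1) * (d' * h + r2)); last by rewrite /r1 /r2; ring.
have hh := cabs_ge0 h.
have b1 : cabs (d * h + r1) <= (cabs d + 1) * cabs h.
  by apply: le_trans (cabsD _ _) _; rewrite cabsM; nra.
have b2 : cabs (d' * h + r2) <= (cabs d' + 1) * cabs h.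
  by apply: le_trans (cabsD _ _) _; rewrite cabsM; nra.
have b3 : cabs (d * h + r1) * cabs (d' * h + r2) <= (cabs d + 1) * cabs h * ((cabs d' + 1) * t).
  apply: le_trans (ler_pM _ _ b1 b2) _; rewrite ?cabs_ge0 //.
  by apply: ler_wpM2l; [nra|apply: ler_wpM2l; lra].
have b4 : cabs (f z) * cabs r2 <= cabs (f z) * (t * cabs h) by apply: ler_wpM2l.
have b5 : cabs (g z) * cabs r1 <= cabs (g z) * (t * cabs h) by apply: ler_wpM2l.
apply: le_trans (cabsD _ _) _; rewrite [cabs (_ * (_ + _))]cabsM.
apply: (@le_trans _ _ (t * K * cabs h)); last by rewrite ler_wpM2r.
have := cabsD (f z * r2) (g z * r1); rewrite !cabsM /K; lra.
Qed.

Lemma cdiff_inv z : z != 0 -> cdiff (fun z => z^-1) z (- z ^- 2).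
Proof.
move=> z0 e e0.
have c0 : 0 < cabs z by rewrite cabs_gt0.
exists (Num.min (cabs z / 2) (e * cabs z ^+ 3 / 2)).
  by rewrite lt_min !divr_gt0 ?mulr_gt0 ?exprn_gt0.
move=> h; rewrite lt_min => /andP[h1 h2].
have h3 : cabs z / 2 <= cabs (z + h).
  have := cabsB (z + h) h; rewrite addrK; lra.
have zh : z + h != 0 by rewrite -cabs_gt0; lra.
rewrite (_ : _ - _ = h ^+ 2 / (z ^+ 2 * (z + h))); last first.
  by field; rewrite z0 zh.
have h0 := cabs_ge0 h.
have c3 : 0 < cabs z ^+ 2 by rewrite exprn_gt0.
rewrite cabsf_div !expr2 !cabsM ler_pdivrMr; last by rewrite !mulr_gt0 //; lra.
rewrite -!expr2 [cabs h ^+ 2]expr2 mulrAC ler_wpM2r //.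
apply: le_trans (ltW h2) _.
have -> : e * cabs z ^+ 3 / 2 = (e * cabs z ^+ 2) * (cabs z / 2) by field.
by rewrite [leRHS]mulrA; apply: ler_wpM2l h3; rewrite mulr_ge0 ?ltW.
Qed.

Lemma eq_cdiff f g z (d : C) : f =1 g -> cdiff f z d -> cdiff g z d.
Proof. by move=> /funext ->. Qed.

(** On the frame of side 2 r the sums of (f z - f 0) / z^2 are at most 8 r * 2 M / r^2 = 16 M / r;
    near 0 they are almost d times the sums of 1 / z, which have modulus at least 4. The quotient is
    4 M / r. *)
Lemma cauchy_estimate f r M d : 0 < r ->
  (forall z, box (centered r) (2 * r) z -> exists d, cdiff f z d) ->
  (forall z, box (centered r) (2 * r) z -> cabs (f z) <= M) ->
  cdiff f 0 d -> cabs d <= 4 * M / r.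
Proof.
move=> r0 fd fM f0.
have b0 : box (centered r) (2 * r) 0 by rewrite /box /=; lra.
pose g z := (f z - f 0) / z ^+ 2.
have gd z : z != 0 -> box (centered r) (2 * r) z -> exists d, cdiff g z d.
  move=> z0 /fd[d' hd'].
  have h1 := cdiffD hd' (cdiff_const (- f 0) z).
  have h2 := cdiffM h1 (cdiffM (cdiff_inv z0) (cdiff_inv z0)).
  by eexists; apply: eq_cdiff h2 => w; rewrite /g expr2 invfM.
apply: le_eps => e e0.
(* The errors are [e'] from shrinking and [8 * e'] from the remainder, in all [3 * e], while the
   factor 4 in front of |d| allows [4 * e]. *)
pose e' := e / 3.
have e'0 : 0 < e' by rewrite divr_gt0.
have [del del0 Hdel] := f0 _ e'0.
have [s Hs] := exists_pow2_lt (2 * r) del0.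
have [P HP] := square_sum_shrink_iter r0 gd s e'0.
have {HP} := HP P (leqnn _).
set r' := r / 2 ^+ s.
have r'0 : 0 < r' by rewrite divr_gt0 // exprn_gt0.
set X := square_sum _ _ _ _; set Y := square_sum _ _ _ _ => XY.
have hX : cabs X <= 16 * M / r.
  have -> : 16 * M / r = 4 * (2 * r) * (2 * M / r ^+ 2) by field; rewrite gt_eqF.
  apply: square_sum_bound => [|z fz]; first lra.
  have [/andP[z1 _] bz] := frame_centered r0 fz.
  rewrite /g cabsf_div expr2 cabsM.
  apply: ler_pM; rewrite ?cabs_ge0 ?invr_ge0 ?mulr_ge0 ?cabs_ge0 //.
    by apply: le_trans (cabsB _ _) _; have := fM _ bz; have := fM _ b0; lra.
  by rewrite lef_pV2 ?posrE ?expr2; [apply: ler_pM => //; lra|nra|nra].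
(* Near 0, g z = d / z + o(1 / z), and the sums of 1 / z around 0 do not vanish. *)
have hY : 4 * cabs d <= cabs Y + 8 * e'.
  pose rho z := (f z - f 0 - d * z) / z ^+ 2.
  have -> : Y = d * square_sum P.+1 (fun z => z^-1) (centered r') (2 * r')
      + square_sum P.+1 rho (centered r') (2 * r').
    rewrite -square_sumZ -square_sumD; apply: eq_square_sum => z.
    rewrite /g /rho; have [->|z0] := eqVneq z 0; last by field.
    by rewrite expr2 mulr0 invr0 !mulr0 addr0.
  have hr : cabs (square_sum P.+1 rho (centered r') (2 * r')) <= 8 * e'.
    have -> : 8 * e' = 4 * (2 * r') * (e' / r') by field; rewrite gt_eqF.
    apply: square_sum_bound => [|z fz]; first lra.
    have [/andP[z1 z2] bz] := frame_centered r'0 fz.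
    have cz : 0 < cabs z by lra.
    have h : cabs (f z - f 0 - d * z) <= e' * cabs z.
      have := Hdel z; rewrite add0r; apply.
      by apply: le_lt_trans z2 _; rewrite /r' mulrA.
    rewrite /rho cabsf_div expr2 cabsM.
    rewrite ler_pdivrMr ?mulr_gt0 // (le_trans h) //.
    rewrite mulrA ler_wpM2r ?cabs_ge0 // -mulrA; apply: ler_peMr; first exact: ltW.
    by rewrite mulrC ler_pdivlMr // mul1r.
  have := square_sum_inv P.+1 r'0.
  set S := square_sum _ _ _ _ => hS; set T := square_sum _ _ _ _ in hr *.
  have h1 : cabs (d * S) <= cabs (d * S + T) + cabs T.
    by apply: le_trans (cabsB _ _); rewrite addrK.
  have h2 : 4 * cabs d <= cabs (d * S).
    by rewrite cabsM mulrC ler_wpM2l ?cabs_ge0.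
  lra.
have h3 : cabs Y <= cabs X + cabs (X - Y).
  by rewrite (le_trans _ (cabsB _ _)) // opprB addrC subrK.
have -> : 4 * M / r = (16 * M / r) / 4 by field; rewrite gt_eqF.
rewrite /e' in hY XY; lra.
Qed.

End CauchyEstimate.

(** * Holomorphic functions of several variables *)

Section SeveralVariables.
Variable R : realType.
Local Notation C := R[i].

(** Complex values admit no intermediate point with the mean slope, so the interval is bisected: one
    of the two halves always keeps a slope above [L + e], which contradicts the derivative at the
    limit point. *)
Lemma mean_value (g : C -> C) (L : R) :
  (forall t : R, 0 <= t <= 1 -> exists2 d, cdiff g t%:C%C d & cabs d <= L) ->
  cabs (g 1 - g 0) <= L.
Proof.
move=> gd; rewrite leNgt; apply/negP => gL.
pose e := (cabs (g 1 - g 0) - L) / 2.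
have e0 : 0 < e by rewrite /e; lra.
pose side s : R := 1 / 2 ^+ s.
have sideS s : side s.+1 = side s / 2 by rewrite /side exprSr invfM mulrA.
have side_gt0 s : 0 < side s by rewrite divr_gt0 // exprn_gt0.
pose bad (a : R) s := (L + e) * side s < cabs (g (a + side s)%:C%C - g a%:C%C).
have bad0 : bad 0 0%N.
  rewrite /bad /side expr0 divr1 mulr1 add0r rmorph1 rmorph0 /e; lra.
have next q : exists k : bool, bad q.1 q.2 -> bad (q.1 + k%:R * side q.2.+1) q.2.+1.
  case: q => a s /=.
  have [h|h] := pselect (bad a s.+1); first by exists false; rewrite mul0r addr0.
  exists true; rewrite mul1r; move: h; rewrite /bad => /negP; rewrite -leNgt.
  set m := g (a + side s.+1)%:C%C => h1.
  have -> : a + side s.+1 + side s.+1 = a + side s by rewrite sideS; lra.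
  move=> h2; have := cabsD (g (a + side s)%:C%C - m) (m - g a%:C%C).
  rewrite addrA subrK; move: h1 h2; rewrite sideS; nra.
have [nxt nxtP] := boolp.choice next.
pose a := fix a s := if s is s'.+1 then a s' + (nxt (a s', s'))%:R * side s'.+1 else 0.
have abad s : bad (a s) s.
  by elim: s => [//|s IH] /=; apply: (nxtP (a s, s)).
have bnat (b : bool) : 0 <= b%:R :> R /\ b%:R <= 1 :> R by case: b => /=; lra.
have [x xP] : exists x, forall s, a s <= x <= a s + 1 / 2 ^+ s.
  apply: nested_intervals => // s; rewrite -!/(side _) /= sideS.
  have [] := bnat (nxt (a s, s)); have := side_gt0 s; nra.
have x01 : 0 <= x <= 1 by have := xP 0%N; rewrite /= expr0; lra.
have [d dP dL] := gd x x01.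
have [del del0 Hdel] := dP _ e0.
have [s Hs] := exists_pow2_lt 1 del0.
have := abad s; rewrite /bad; apply/negP; rewrite -leNgt.
have := xP s; rewrite -/(side s) => /andP[x1 x2].
rewrite -/(side s) in Hs.
have D (y : R) : `|y - x| < del -> cabs (g y%:C%C - g x%:C%C - d * (y - x)%:C%C) <= e * `|y - x|.
  have yE : x%:C%C + (y - x)%:C%C = y%:C%C :> C by rewrite -rmorphD /= addrC subrK.
  by move=> yx; have := Hdel (y - x)%:C%C; rewrite cabsR yE; exact.
have a1 : `|a s - x| = x - a s by rewrite ler0_norm; lra.
have a2 : `|a s + side s - x| = a s + side s - x by rewrite ger0_norm; lra.
have := D (a s); rewrite a1 => /(_ ltac:(lra)).
have := D (a s + side s); rewrite a2 => /(_ ltac:(lra)).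
set r2 := (_ - _ - _); set r1 := (_ - _ - _) => h2 h1.
have -> : g (a s + side s)%:C%C - g (a s)%:C%C = r2 - r1 + d * (side s)%:C%C.
  by rewrite /r1 /r2 !rmorphB !rmorphD /=; ring.
apply: le_trans (cabsD _ _) _; rewrite cabsM (cabs_pos (ltW (side_gt0 s))).
have := cabsB r2 r1; have := side_gt0 s; nra.
Qed.

(** The limit is the supremum of the eventual lower bounds of [q] near 0, that is, its lower
    limit. *)
Lemma real_cauchy_lim (q : C -> R) :
  (forall e : R, 0 < e -> exists c : R, exists2 del : R, 0 < del &
     forall t : C, t != 0 -> cabs t < del -> `|c - q t| <= e) ->
  exists l : R, forall e : R, 0 < e -> exists2 del : R, 0 < del &
     forall t : C, t != 0 -> cabs t < del -> `|q t - l| <= e.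
Proof.
move=> H.
pose S : set R := fun a => exists2 del : R, 0 < del & forall t : C, t != 0 -> cabs t < del -> a <= q t.
have exs (d1 d2 : R) : 0 < d1 -> 0 < d2 -> exists t : C, [/\ t != 0, cabs t < d1 & cabs t < d2].
  move=> d10 d20; exists (Num.min d1 d2 / 2)%:C%C.
  have m0 : 0 < Num.min d1 d2 by rewrite lt_min d10.
  have m1 : Num.min d1 d2 <= d1 by rewrite ge_min lexx.
  have m2 : Num.min d1 d2 <= d2 by rewrite ge_min lexx orbT.
  have h : cabs (Num.min d1 d2 / 2)%:C%C = Num.min d1 d2 / 2 by rewrite cabs_pos //; lra.
  by rewrite -cabs_gt0 h; split; lra.
have inS e c del : 0 < del -> (forall t : C, t != 0 -> cabs t < del -> `|c - q t| <= e) ->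
    S (c - e) /\ ubound S (c + e).
  move=> del0 Hc; split.
    by exists del => // t t0 /(Hc _ t0); rewrite ler_norml; lra.
  move=> a [d2 d20 Ha]; have [t [t0 t1 t2]] := exs _ _ del0 d20.
  by have := Ha _ t0 t2; have := Hc _ t0 t1; rewrite ler_norml; lra.
exists (sup S) => e e0.
have e2 : 0 < e / 2 by lra.
have [c [del del0 Hc]] := H _ e2; exists del => // t t0 td.
have [s1 s2] := inS _ _ _ del0 Hc.
have u1 : c - e / 2 <= sup S by apply: ub_le_sup => //; exists (c + e / 2).
have u2 : sup S <= c + e / 2 by apply: ge_sup => //; exists (c - e / 2).
have := Hc _ t0 td; rewrite !ler_norml; lra.
Qed.

Lemma cauchy_lim (q : C -> C) :
  (forall e : R, 0 < e -> exists c : C, exists2 del : R, 0 < del &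
     forall t : C, t != 0 -> cabs t < del -> cabs (c - q t) <= e) ->
  exists l : C, forall e : R, 0 < e -> exists2 del : R, 0 < del &
     forall t : C, t != 0 -> cabs t < del -> cabs (q t - l) <= e.
Proof.
move=> H.
have [|a Ha] := real_cauchy_lim (q := fun t => complex.Re (q t)).
  move=> e /H[c [del del0 Hc]]; exists (complex.Re c), del => // t t0 td.
  by rewrite -cReN -cReD (le_trans (cabs_Re _)) // Hc.
have [|b Hb] := real_cauchy_lim (q := fun t => complex.Im (q t)).
  move=> e /H[c [del del0 Hc]]; exists (complex.Im c), del => // t t0 td.
  by rewrite -cImN -cImD (le_trans (cabs_Im _)) // Hc.
exists (a +i* b)%C => e e0; have e2 : 0 < e / 2 by lra.
have [d1 d10 H1] := Ha _ e2; have [d2 d20 H2] := Hb _ e2.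
exists (Num.min d1 d2); first by rewrite lt_min d10.
move=> t t0; rewrite lt_min => /andP[/(H1 _ t0) h1 /(H2 _ t0) h2].
by apply: le_trans (cabs_le_ReIm _) _; rewrite !ReImE /=; lra.
Qed.

Variable n : nat.
Local Notation V := ('I_n -> C).
Implicit Types (x y h v : V) (f : V -> C).

Definition l1 h : R := \sum_i cabs (h i).
Definition dot (l h : V) : C := \sum_i l i * h i.

Lemma l1norm_l1 h : l1norm h = (l1 h)%:C%C.
Proof. by rewrite /l1norm /l1 rmorph_sum; apply: eq_bigr => i _; rewrite normc_cabs. Qed.

Lemma l1_ge0 h : 0 <= l1 h.
Proof. by apply: sumr_ge0 => i _; exact: cabs_ge0. Qed.

Lemma l1D h v : l1 (h + v) <= l1 h + l1 v.
Proof. by rewrite /l1 -big_split; apply: ler_sum => i _; exact: cabsD. Qed.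

Lemma l1Z (t : C) h : l1 (t *: h) = cabs t * l1 h.
Proof. by rewrite /l1 mulr_sumr; apply: eq_bigr => i _; rewrite -cabsM. Qed.

Lemma l1_0 : l1 0 = 0.
Proof. by apply: big1 => i _; rewrite cabs0. Qed.

Lemma l1_eq0 h : l1 h = 0 -> h = 0.
Proof.
move=> /eqP; rewrite psumr_eq0 => [/allP H|i _]; last exact: cabs_ge0.
by apply/funext => i; apply/eqP; rewrite -cabs_eq0; apply: (H i); rewrite mem_index_enum.
Qed.

Lemma l1_ev j (t : C) : l1 (ev j t) = cabs t.
Proof.
rewrite /l1 (bigD1 j) //= /ev eqxx big1 ?addr0 // => i /negbTE ->.
exact: cabs0.
Qed.

Lemma dot_ev (l : V) j (t : C) : dot l (ev j t) = l j * t.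
Proof.
rewrite /dot (bigD1 j) //= /ev eqxx big1 ?addr0 // => i /negbTE ->.
by rewrite mulr0.
Qed.

Lemma dotZr (l h : V) t : dot l (t *: h) = t * dot l h.
Proof. by rewrite /dot mulr_sumr; apply: eq_bigr => i _; rewrite mulrCA. Qed.

Lemma dotBl (l l' h : V) : dot (l - l') h = dot l h - dot l' h.
Proof. by rewrite /dot -sumrB; apply: eq_bigr => i _; rewrite -mulrBl. Qed.

Lemma dotDl (l l' h : V) : dot (l + l') h = dot l h + dot l' h.
Proof. by rewrite /dot -big_split; apply: eq_bigr => i _; exact: mulrDl. Qed.

Lemma dotZl (l h : V) t : dot (t *: l) h = t * dot l h.
Proof. by rewrite /dot mulr_sumr; apply: eq_bigr => i _; rewrite mulrA. Qed.

Definition fdiff f x (l : V) := forall e : R, 0 < e -> exists2 del : R, 0 < del &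
  forall h, l1 h < del -> cabs (f (x + h) - f x - dot l h) <= e * l1 h.

Lemma fdiff_cdiff f y h (t : C) (l : V) : fdiff f (y + t *: h) l ->
  cdiff (fun t => f (y + t *: h)) t (dot l h).
Proof.
move=> H e e0.
have h0 := l1_ge0 h.
have k0 : 0 < e / (l1 h + 1) by rewrite divr_gt0 //; lra.
have [del del0 Hd] := H _ k0.
exists (del / (l1 h + 1)); first by rewrite divr_gt0 //; lra.
move=> s hs; have := Hd (s *: h); rewrite l1Z dotZr scalerDl addrA [s * dot _ _]mulrC.
have s0 := cabs_ge0 s.
have hs2 : cabs s * l1 h < del.
  apply: le_lt_trans (_ : cabs s * (l1 h + 1) < _); first by nra.
  by rewrite -ltr_pdivlMr //; lra.
move=> /(_ hs2) /le_trans; apply.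
rewrite mulrCA [leRHS]mulrC ler_wpM2l // mulrAC ler_pdivrMr; last by lra.
by nra.
Qed.

Definition holo_ball f x (r M : R) := forall y, l1 (y - x) < r ->
  (exists l, fdiff f y l) /\ cabs (f y) <= M.

(** The Cauchy estimate on the complex line through [x] in direction [h], with a square of half-side
    r / (4 |h|): its points t satisfy |t| <= r / (2 |h|), so x + t h stays in the ball, and 4 M
    divided by the half-side is the bound. *)
Lemma holo_ball_grad f x (r M : R) l h : 0 < r -> holo_ball f x r M -> fdiff f x l ->
  cabs (dot l h) <= 16 * M * l1 h / r.
Proof.
move=> r0 H fl; have [/l1_eq0 ->|h1] := eqVneq (l1 h) 0.
  rewrite l1_0 mulr0 mul0r /dot big1 ?cabs0 // => i _; exact: mulr0.
have h0 : 0 < l1 h by rewrite lt_neqAle eq_sym h1 l1_ge0.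
have -> : 16 * M * l1 h / r = 4 * M / (r / (4 * l1 h)) by field; rewrite !gt_eqF.
have q0 : 0 < r / (4 * l1 h) by rewrite divr_gt0 // mulr_gt0.
have inb z : box (centered (r / (4 * l1 h))) (2 * (r / (4 * l1 h))) z -> l1 (x + z *: h - x) < r.
  move=> [z1 z2]; rewrite addrAC subrr add0r l1Z.
  have a1 : `|complex.Re z| <= r / (4 * l1 h) by rewrite ler_norml; move: z1; rewrite /=; lra.
  have a2 : `|complex.Im z| <= r / (4 * l1 h) by rewrite ler_norml; move: z2; rewrite /=; lra.
  have a3 : cabs z <= r / (2 * l1 h).
    apply: le_trans (cabs_le_ReIm _) _.
    have -> : r / (2 * l1 h) = r / (4 * l1 h) + r / (4 * l1 h) by field; rewrite gt_eqF.
    exact: lerD.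
  apply: le_lt_trans (_ : r / 2 < _); last by lra.
  apply: le_trans (ler_wpM2r (ltW h0) a3) _.
  by rewrite le_eqVlt; apply/orP; left; apply/eqP; field; rewrite gt_eqF.
apply: (cauchy_estimate (f := fun t => f (x + t *: h)) q0).
- by move=> z /inb /H[[l' hl'] _]; exists (dot l' h); apply: fdiff_cdiff.
- by move=> z /inb /H[].
- by apply: fdiff_cdiff; rewrite scale0r addr0.
Qed.

(** Gradients along the segment are estimated on balls of radius [r / 2] around its points, which
    doubles the constant of [holo_ball_grad]. *)
Lemma holo_ball_lip f x (r M : R) v : 0 < r -> holo_ball f x r M -> l1 v < r / 2 ->
  cabs (f (x + v) - f x) <= 32 * M * l1 v / r.
Proof.
move=> r0 H vr.
have -> : f (x + v) - f x = f (x + 1 *: v) - f (x + 0 *: v).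
  by rewrite scale1r scale0r addr0.
apply: (mean_value (g := fun t => f (x + t *: v))) => t /andP[t0 t1].
have v0 := l1_ge0 v.
have tv : l1 (x + t%:C%C *: v - x) < r / 2.
  by rewrite addrAC subrr add0r l1Z cabs_pos //; nra.
have [|[l hl] _] := H (x + t%:C%C *: v); first by lra.
exists (dot l v); first exact: fdiff_cdiff.
have r2 : 0 < r / 2 by lra.
have -> : 32 * M * l1 v / r = 16 * M * l1 v / (r / 2) by field; rewrite gt_eqF.
apply: (@holo_ball_grad f (x + t%:C%C *: v) _ M) => // y hy.
apply: H; have -> : y - x = (y - (x + t%:C%C *: v)) + (x + t%:C%C *: v - x) by rewrite addrA subrK.
by apply: le_lt_trans (l1D _ _) _; lra.
Qed.

Lemma fdiff_shift f y v l : fdiff f (y + v) l -> fdiff (fun y => f (y + v)) y l.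
Proof.
move=> H e /H[del del0 Hd]; exists del => // h /Hd.
by rewrite (addrAC y v h).
Qed.

Lemma fdiffB f g y l l' : fdiff f y l -> fdiff g y l' -> fdiff (fun y => f y - g y) y (l - l').
Proof.
move=> H H' e e0; have e2 : 0 < e / 2 by lra.
have [d1 d10 H1] := H _ e2; have [d2 d20 H2] := H' _ e2.
exists (Num.min d1 d2); first by rewrite lt_min d10.
move=> h; rewrite lt_min => /andP[/H1 h1 /H2 h2]; rewrite dotBl.
rewrite (_ : _ - _ = (f (y + h) - f y - dot l h) - (g (y + h) - g y - dot l' h)); last by ring.
by apply: le_trans (cabsB _ _) _; lra.
Qed.

(** Increments of a bounded holomorphic function are again bounded and holomorphic, with a bound
    linear in [v]; applying the estimates to increments is what yields quadratic error terms. *)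
Lemma holo_ball_diff f x (r M : R) v : 0 < r -> holo_ball f x r M -> l1 v < r / 4 ->
  holo_ball (fun y => f (y + v) - f y) x (r / 4) (64 * M * l1 v / r).
Proof.
move=> r0 H vr y yr; split.
  have [|[l hl] _] := H y; first by lra.
  have [|[l' hl'] _] := H (y + v).
    by rewrite addrAC; apply: le_lt_trans (l1D _ _) _; lra.
  by exists (l' - l); apply: fdiffB => //; apply: fdiff_shift.
have r2 : 0 < r / 2 by lra.
have -> : 64 * M * l1 v / r = 32 * M * l1 v / (r / 2) by field; rewrite gt_eqF.
apply: holo_ball_lip => //; last by lra.
move=> w hw; apply: H; have -> : w - x = (w - y) + (y - x) by rewrite addrA subrK.
by apply: le_lt_trans (l1D _ _) _; lra.
Qed.

Lemma cdiff_lin (k z : C) : cdiff (fun t => t * k) z k.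
Proof.
move=> e e0; exists 1 => // h _.
rewrite (_ : _ - _ = 0); last by ring.
by rewrite cabs0 mulr_ge0 ?cabs_ge0 // ltW.
Qed.

(** The derivative of the remainder along the segment is the gradient at [x] of the increment y |->
    f (y + t h) - f y, applied to [h]. The increment is O(|h|) by [holo_ball_diff], and
    [holo_ball_grad] on the ball of radius r / 4 adds one more factor |h|; the constant is 16 * 64 *
    4. *)
Lemma holo_ball_taylor f x (r M : R) l h : 0 < r -> holo_ball f x r M -> fdiff f x l ->
  l1 h < r / 4 ->
  cabs (f (x + h) - f x - dot l h) <= 4096 * M * l1 h ^+ 2 / r ^+ 2.
Proof.
move=> r0 H fl hr.
have h0 := l1_ge0 h.
have M0 : 0 <= M.
  have [|_] := H x; first by rewrite subrr l1_0.
  by apply: le_trans; rewrite cabs_ge0.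
have -> : f (x + h) - f x - dot l h =
   (f (x + 1 *: h) - 1 * dot l h) - (f (x + 0 *: h) - 0 * dot l h).
  by rewrite scale1r scale0r addr0 mul0r mul1r; ring.
apply: (mean_value (g := fun t => f (x + t *: h) - t * dot l h)) => t /andP[t0 t1].
have th : l1 (t%:C%C *: h) <= l1 h by rewrite l1Z cabs_pos //; nra.
have [|[l' hl'] _] := H (x + t%:C%C *: h); first by rewrite addrAC subrr add0r; lra.
exists (dot l' h - dot l h).
  rewrite -[- dot l h]mulN1r.
  have -> : (fun t => f (x + t *: h) - t * dot l h) = (fun t => f (x + t *: h) + t * (-1 * dot l h)).
    by apply/funext => s; rewrite mulN1r mulrN.
  by apply: cdiffD; [exact: fdiff_cdiff|exact: cdiff_lin].
have th4 : l1 (t%:C%C *: h) < r / 4 by lra.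
have r4 : 0 < r / 4 by lra.
have HB := holo_ball_diff r0 H th4.
rewrite -dotBl.
have := holo_ball_grad h r4 HB (fdiffB (fdiff_shift hl') fl).
move=> /le_trans; apply.
have -> : 16 * (64 * M * l1 (t%:C%C *: h) / r) * l1 h / (r / 4)
   = 4096 * M / r ^+ 2 * (l1 (t%:C%C *: h) * l1 h) by field; rewrite gt_eqF.
have -> : 4096 * M * l1 h ^+ 2 / r ^+ 2 = 4096 * M / r ^+ 2 * (l1 h * l1 h) by field; rewrite gt_eqF.
apply: ler_wpM2l; first by rewrite divr_ge0 ?exprn_ge0 ?mulr_ge0 // ltW.
by apply: ler_wpM2r.
Qed.

Lemma finite_min_gt0 (I : finType) (d : I -> R) : (forall i, 0 < d i) ->
  exists2 e : R, 0 < e & forall i, e <= d i.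
Proof.
move=> d0; have s0 : 0 <= \sum_i (d i)^-1 by apply: sumr_ge0 => i _; rewrite invr_ge0 ltW.
(* This witness also serves an empty index type. *)
exists (1 + \sum_i (d i)^-1)^-1; first by rewrite invr_gt0; lra.
move=> i; rewrite -[leRHS]invrK lef_pV2 ?posrE ?invr_gt0 //; last by lra.
rewrite (bigD1 i) //= addrCA lerDl addr_ge0 //.
by apply: sumr_ge0 => k _; rewrite invr_ge0 ltW.
Qed.

Lemma dot_le (l h : V) : cabs (dot l h) <= l1 l * l1 h.
Proof.
rewrite /dot {2}/l1 mulr_sumr.
elim/big_ind2 : _ => [|x1 x2 y1 y2 h1 h2|k _]; rewrite ?cabs0 //.
  by apply: le_trans (cabsD _ _) _; apply: lerD.
rewrite cabsM ler_wpM2r ?cabs_ge0 // /l1 (bigD1 k) //= lerDl.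
by apply: sumr_ge0 => i _; exact: cabs_ge0.
Qed.

Lemma fdiff_pderiv f y l j (e : R) : fdiff f y l -> 0 < e -> exists2 del : R, 0 < del &
  forall t : C, t != 0 -> cabs t < del -> cabs ((f (y + ev j t) - f y) / t - l j) <= e.
Proof.
move=> H e0; have [del del0 Hd] := H _ e0; exists del => // t t0 td.
have := Hd (ev j t); rewrite l1_ev dot_ev => /(_ td).
have -> : f (y + ev j t) - f y - l j * t = ((f (y + ev j t) - f y) / t - l j) * t.
  by rewrite mulrBl divfK.
by rewrite cabsM ler_pM2r // cabs_gt0.
Qed.

(** Differentiability at the centre, with error factor 1, already bounds [f] on a small ball. *)
Lemma holo_ball_exists f x (r : R) : 0 < r -> (forall y, l1 (y - x) < r -> exists l, fdiff f y l) ->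
  exists r1 M : R, [/\ 0 < r1, r1 <= r, 0 <= M & holo_ball f x r1 M].
Proof.
move=> r0 H; have [|l hl] := H x; first by rewrite subrr l1_0.
have [del del0 Hd] := hl _ ltr01.
exists (Num.min r del), (cabs (f x) + r + l1 l * r).
rewrite lt_min r0 ge_min lexx; split => //.
  by rewrite !addr_ge0 ?cabs_ge0 ?mulr_ge0 ?l1_ge0 // ltW.
move=> y; rewrite lt_min => /andP[yr yd]; split; first exact: H.
have xy : x + (y - x) = y by rewrite addrC subrK.
have := Hd _ yd; rewrite xy mul1r => h1.
have -> : f y = f x + dot l (y - x) + (f y - f x - dot l (y - x)) by ring.
apply: le_trans (cabsD _ _) _; have := cabsD (f x) (dot l (y - x)).
have := dot_le l (y - x); have := l1_ge0 l; have := l1_ge0 (y - x); nra.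
Qed.

(* By the Cauchy estimate for y |-> f (y + v) - f y, which is O(v): the factor
   l1 v is what allows dividing by v in the proof of holomorphic_partials. *)
Lemma second_difference f (G : V -> V) x (r : R) : 0 < r ->
  (forall y, l1 (y - x) < r -> fdiff f y (G y)) ->
  exists r1 K : R, [/\ 0 < r1, r1 <= r, 0 <= K & forall h v, l1 h < r1 -> l1 v < r1 ->
    cabs ((f (x + h + v) - f (x + h)) - (f (x + v) - f x) - dot (G (x + v) - G x) h)
      <= K * l1 v * l1 h ^+ 2].
Proof.
move=> r0 HG.
have [|r1 [M [r10 r1r M0 HB]]] := @holo_ball_exists f x r r0.
  by move=> y /HG hy; exists (G y).
have c4 : 0 < r1 / 4 by lra.
exists (r1 / 16), (4096 * 64 * 16 * M / r1 ^+ 3); split.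
- by lra.
- by lra.
- have := exprn_gt0 3 r10; move=> /ltW h3; rewrite divr_ge0 //; nra.
move=> h v hr vr; have v4 : l1 v < r1 / 4 by lra.
have HBv := holo_ball_diff r10 HB v4.
have F : fdiff (fun y => f (y + v) - f y) x (G (x + v) - G x).
  apply: fdiffB; last by apply: HG; rewrite subrr l1_0.
  by apply: fdiff_shift; apply: HG; rewrite addrAC subrr add0r; lra.
have := holo_ball_taylor (h := h) c4 HBv F ltac:(lra).
move=> /le_trans; apply; rewrite le_eqVlt; apply/orP; left; apply/eqP.
by field; rewrite gt_eqF.
Qed.

Lemma fdiff_unique f x l l' : fdiff f x l -> fdiff f x l' -> l = l'.
Proof.
move=> H H'; apply/funext => j; apply/eqP; rewrite -subr_eq0 -cabs_eq0 eq_le cabs_ge0 andbT.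
apply: le_eps => e e0; rewrite add0r.
have e2 : 0 < e / 2 by lra.
have [d1 d10 H1] := fdiff_pderiv j H e2; have [d2 d20 H2] := fdiff_pderiv j H' e2.
have m0 : 0 < Num.min d1 d2 / 2 by rewrite divr_gt0 // lt_min d10.
have m1 : Num.min d1 d2 <= d1 by rewrite ge_min lexx.
have m2 : Num.min d1 d2 <= d2 by rewrite ge_min lexx orbT.
have ht : cabs (Num.min d1 d2 / 2)%:C%C = Num.min d1 d2 / 2 by rewrite cabs_pos // ltW.
have t0 : (Num.min d1 d2 / 2)%:C%C != 0 :> C by rewrite -cabs_gt0 ht.
have := H1 _ t0; have := H2 _ t0; rewrite ht => /(_ ltac:(lra)) h2 /(_ ltac:(lra)) h1.
set q := (_ / _) in h1 h2.
have -> : l j - l' j = (q - l' j) - (q - l j) by ring.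
by apply: le_trans (cabsB _ _) _; lra.
Qed.

(** For v = t e_j, the second difference divided by t shows that the increment of the j-th partial
    is, as t tends to 0, the linear form [q j t] in [h] up to K |h|^2, with K independent of [h].
    Therefore [q j t] converges, and its limit is the derivative of the j-th partial. *)
Theorem holomorphic_partials f (G : V -> V) x (r : R) : 0 < r ->
  (forall y, l1 (y - x) < r -> fdiff f y (G y)) ->
  exists H : 'I_n -> V, (forall j, fdiff (fun y => G y j) x (H j)) /\
    forall i j, H i j = H j i.
Proof.
move=> r0 HG.
have [r1 [K [r10 r1r K0 HK]]] := second_difference r0 HG.
pose q j (t : C) : V := t^-1 *: (G (x + ev j t) - G x).
pose D0 j h := G (x + h) j - G x j.
have claimA j h : l1 h < r1 -> forall e : R, 0 < e -> exists2 del : R, 0 < del &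
    forall t : C, t != 0 -> cabs t < del -> cabs (D0 j h - dot (q j t) h) <= K * l1 h ^+ 2 + e.
  move=> hr e e0; have e2 : 0 < e / 2 by lra.
  have [d1 d10 H1] := fdiff_pderiv j (HG (x + h) ltac:(by rewrite addrAC subrr add0r; lra)) e2.
  have [d2 d20 H2] := fdiff_pderiv j (HG x ltac:(by rewrite subrr l1_0)) e2.
  exists (Num.min r1 (Num.min d1 d2)); first by rewrite !lt_min r10 d10.
  move=> t t0; rewrite !lt_min => /and3P[tr /(H1 _ t0) h1 /(H2 _ t0) h2].
  have tv : l1 (ev j t) < r1 by rewrite l1_ev.
  have := HK h (ev j t) hr tv; rewrite l1_ev.
  set F1 := _ - f (x + h) in h1 *; set F2 := _ - f x in h2 * => h3.
  have h4 : cabs (F1 / t - F2 / t - dot (q j t) h) <= K * l1 h ^+ 2.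
    rewrite /q dotZl [t^-1 * _]mulrC -!mulrBl cabsf_div ler_pdivrMr ?cabs_gt0 //.
    by rewrite mulrAC.
  have -> : D0 j h - dot (q j t) h = (F1 / t - F2 / t - dot (q j t) h)
      - (F1 / t - G (x + h) j) + (F2 / t - G x j) by rewrite /D0; ring.
  apply: le_trans (cabsD _ _) _.
  have := cabsB (F1 / t - F2 / t - dot (q j t) h) (F1 / t - G (x + h) j); lra.
have claimB j i : exists l : C, forall e : R, 0 < e -> exists2 del : R, 0 < del &
     forall t : C, t != 0 -> cabs t < del -> cabs (q j t i - l) <= e.
  apply: cauchy_lim => e e0.
  have K1 : 0 < K + 1 by lra.
  (* Testing on h = s e_i confines [q j t i], for small t, to distance (K + 1) s from a fixed
     number. *)
  pose s := Num.min (r1 / 2) (e / (K + 1)).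
  have s0 : 0 < s by rewrite lt_min !divr_gt0.
  have s1 : s <= r1 / 2 by rewrite ge_min lexx.
  have s2 : s * (K + 1) <= e by rewrite -ler_pdivlMr // ge_min lexx orbT.
  have hs : cabs s%:C%C = s by rewrite cabs_pos // ltW.
  have sC0 : s%:C%C != 0 :> C by rewrite -cabs_gt0 hs.
  have hsr : l1 (ev i s%:C%C) < r1 by rewrite l1_ev hs; lra.
  have ss0 : 0 < s ^+ 2 by rewrite exprn_gt0.
  have [del del0 Hd] := claimA j _ hsr _ ss0.
  exists (D0 j (ev i s%:C%C) / s%:C%C), del => // t t0 /(Hd _ t0).
  rewrite l1_ev dot_ev hs.
  have -> : D0 j (ev i s%:C%C) - q j t i * s%:C%C = (D0 j (ev i s%:C%C) / s%:C%C - q j t i) * s%:C%C.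
    by rewrite mulrBl divfK.
  rewrite cabsM hs => h1.
  rewrite -(ler_pM2r s0); apply: le_trans h1 _.
  by rewrite expr2; nra.
pose H j := projT1 (boolp.choice (claimB j)).
have HP j i (e : R) : 0 < e -> exists2 del : R, 0 < del &
    forall t : C, t != 0 -> cabs t < del -> cabs (q j t i - H j i) <= e.
  exact: (projT2 (boolp.choice (claimB j)) i e).
have HF j : fdiff (fun y => G y j) x (H j).
  move=> e e0; have K1 : 0 < K + 1 by lra.
  exists (Num.min r1 (e / (K + 1))); first by rewrite lt_min r10 divr_gt0.
  move=> h; rewrite lt_min => /andP[hr he].
  apply: (@le_trans _ _ (K * l1 h ^+ 2)); last first.
    have h0 := l1_ge0 h; rewrite expr2 mulrA ler_wpM2r //.
    by move: he; rewrite ltr_pdivlMr //; nra.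
  apply: le_eps => e' e'0.
  have e2 : 0 < e' / 2 by lra.
  have [d1 d10 H1] := claimA j _ hr _ e2.
  have h0 := l1_ge0 h.
  have e3 : 0 < e' / 2 / (l1 h + 1) by rewrite divr_gt0 //; lra.
  have {}HP i := HP j i _ e3.
  pose d2 i := s2val (cid2 (HP i)).
  have [d3 d30 d3P] := finite_min_gt0 (fun i => s2valP (cid2 (HP i)) : 0 < d2 i).
  have m0 : 0 < Num.min d1 d3 / 2 by rewrite divr_gt0 // lt_min d10.
  have m1 : Num.min d1 d3 <= d1 by rewrite ge_min lexx.
  have m2 : Num.min d1 d3 <= d3 by rewrite ge_min lexx orbT.
  pose t : C := (Num.min d1 d3 / 2)%:C%C.
  have ht : cabs t = Num.min d1 d3 / 2 by rewrite cabs_pos // ltW.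
  have t0 : t != 0 by rewrite -cabs_gt0 ht.
  have h1 := H1 _ t0 ltac:(rewrite ht; lra).
  have h2 : cabs (dot (q j t - H j) h) <= e' / 2.
    apply: (@le_trans _ _ (e' / 2 / (l1 h + 1) * l1 h)); last first.
      by rewrite mulrAC ler_pdivrMr; nra.
    rewrite /dot {2}/l1 mulr_sumr.
    elim/big_ind2 : _ => [|x1 x2 y1 y2 b1 b2|k _]; rewrite ?cabs0 //.
      by apply: le_trans (cabsD _ _) _; apply: lerD.
    rewrite cabsM ler_wpM2r ?cabs_ge0 //.
    by apply: (s2valP' (cid2 (HP k))) => //; rewrite ht; have := d3P k; rewrite /d2; lra.
  rewrite -/(D0 j h).
  have -> : D0 j h - dot (H j) h = (D0 j h - dot (q j t) h) + dot (q j t - H j) h.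
    by rewrite dotBl; ring.
  by apply: le_trans (cabsD _ _) _; lra.
exists H; split => // i j.
(* The i-th entry of [q j t] is also the difference quotient of the i-th partial in direction j, so
   it tends to both mixed derivatives. *)
apply/eqP; rewrite -subr_eq0 -cabs_eq0 eq_le cabs_ge0 andbT.
apply: le_eps => e e0; rewrite add0r.
have e2 : 0 < e / 2 by lra.
have [d1 d10 H1] := fdiff_pderiv j (HF i) e2.
have [d2 d20 H2] := HP j i _ e2.
have m0 : 0 < Num.min d1 d2 / 2 by rewrite divr_gt0 // lt_min d10.
have m1 : Num.min d1 d2 <= d1 by rewrite ge_min lexx.
have m2 : Num.min d1 d2 <= d2 by rewrite ge_min lexx orbT.
pose t : C := (Num.min d1 d2 / 2)%:C%C.
have ht : cabs t = Num.min d1 d2 / 2 by rewrite cabs_pos // ltW.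
have t0 : t != 0 by rewrite -cabs_gt0 ht.
have := H1 _ t0 ltac:(rewrite ht; lra); have := H2 _ t0 ltac:(rewrite ht; lra).
have -> : q j t i = (G (x + ev j t) i - G x i) / t by rewrite /q mulrC.
set Q := (_ / _) => h2 h1.
have -> : H i j - H j i = (Q - H j i) - (Q - H i j) by ring.
by apply: le_trans (cabsB _ _) _; lra.
Qed.

End SeveralVariables.

(** * Holomorphic functions on an open set as a Weyl module *)

Section HolomorphicModule.
Variables (R : realType) (n : nat).
Local Notation C := R[i].
Local Notation V := ('I_n -> C).
Implicit Types (x y h : V) (f g : V -> C).

Lemma fdiff_near f g x l (r : R) : 0 < r -> (forall y, l1 (y - x) < r -> f y = g y) ->
  fdiff f x l -> fdiff g x l.
Proof.
move=> r0 fg H e /H[del del0 Hd]; exists (Num.min r del); first by rewrite lt_min r0.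
move=> h; rewrite lt_min => /andP[hr /Hd].
rewrite !fg // ?subrr ?l1_0 //.
by rewrite addrAC subrr add0r.
Qed.

Lemma fdiff_lin (a : C) f g x l l' : fdiff f x l -> fdiff g x l' ->
  fdiff (a *: f + g) x (a *: l + l').
Proof.
move=> H H' e e0.
have a0 := cabs_ge0 a.
have e2 : 0 < e / 2 / (cabs a + 1) by rewrite divr_gt0 //; lra.
have e3 : 0 < e / 2 by lra.
have [d1 d10 H1] := H _ e2; have [d2 d20 H2] := H' _ e3.
exists (Num.min d1 d2); first by rewrite lt_min d10.
move=> h; rewrite lt_min => /andP[/H1 h1 /H2 h2].
have h0 := l1_ge0 h.
have -> : (a *: f + g) (x + h) - (a *: f + g) x - dot (a *: l + l') h =
   a * (f (x + h) - f x - dot l h) + (g (x + h) - g x - dot l' h).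
  have -> : dot (a *: l + l') h = a * dot l h + dot l' h.
    by rewrite dotDl dotZl.
  rewrite -[(a *: f + g) (x + h)]/(a * f (x + h) + g (x + h)) -[(a *: f + g) x]/(a * f x + g x).
  by ring.
apply: le_trans (cabsD _ _) _; rewrite cabsM.
suff : cabs a * cabs (f (x + h) - f x - dot l h) <= e / 2 * l1 h by lra.
apply: le_trans (ler_wpM2l a0 h1) _.
rewrite mulrA ler_wpM2r // mulrCA -[leRHS]mulr1 ler_wpM2l ?(ltW e3) //.
by rewrite ler_pdivrMr; lra.
Qed.

Lemma fdiff_mulX f x l j : fdiff f x l ->
  fdiff (fun y => y j * f y) x (x j *: l + ev j (f x)).
Proof.
move=> H e e0.
have xj0 := cabs_ge0 (x j).
have e2 : 0 < e / 2 / (cabs (x j) + 1) by rewrite divr_gt0 //; lra.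
have [d1 d10 H1] := H _ e2; have [d2 d20 H2] := H _ ltr01.
have ll := l1_ge0 l.
have e3 : 0 < e / 2 / (1 + l1 l) by rewrite divr_gt0 //; lra.
exists (Num.min (e / 2 / (1 + l1 l)) (Num.min d1 d2)); first by rewrite !lt_min e3 d10.
move=> h; rewrite !lt_min => /and3P[he /H1 h1 /H2 h2].
have h0 := l1_ge0 h.
have -> : (x + h) j * f (x + h) - x j * f x - dot (x j *: l + ev j (f x)) h =
   x j * (f (x + h) - f x - dot l h) + h j * (dot l h + (f (x + h) - f x - dot l h)).
  have -> : dot (x j *: l + ev j (f x)) h = x j * dot l h + f x * h j.
    have -> : f x * h j = dot (ev j (f x)) h.
      rewrite /dot (bigD1 j) //= /ev eqxx big1 ?addr0 // => i /negbTE ->.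
      by rewrite mul0r.
    by rewrite dotDl dotZl.
  rewrite -[(x + h) j]/(x j + h j); ring.
apply: le_trans (cabsD _ _) _; rewrite !cabsM.
have hj : cabs (h j) <= l1 h.
  by rewrite /l1 (bigD1 j) //= lerDl; apply: sumr_ge0 => i _; exact: cabs_ge0.
have b1 : cabs (x j) * cabs (f (x + h) - f x - dot l h) <= e / 2 * l1 h.
  apply: le_trans (ler_wpM2l xj0 h1) _.
  rewrite mulrA ler_wpM2r // mulrCA -[leRHS]mulr1 ler_wpM2l //; first lra.
  by rewrite ler_pdivrMr; lra.
have b2 : cabs (dot l h + (f (x + h) - f x - dot l h)) <= (1 + l1 l) * l1 h.
  by apply: le_trans (cabsD _ _) _; have := dot_le l h; lra.
have b3 : cabs (h j) * cabs (dot l h + (f (x + h) - f x - dot l h)) <= l1 h * ((1 + l1 l) * l1 h).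
  by apply: ler_pM => //; exact: cabs_ge0.
have b4 : (1 + l1 l) * l1 h <= e / 2 by rewrite mulrC -ler_pdivlMr ?ltW //; lra.
have := ler_wpM2l h0 b4; lra.
Qed.

Variable U : V -> Prop.

(* Extension by 0 outside U makes equality on U the Leibniz equality. *)
Definition hol_pred : {pred V -> C} := fun F =>
  `[< (forall x, U x -> exists l, fdiff F x l) /\ (forall x, ~ U x -> F x = 0) >].

Lemma hol_pred_submod : submod_closed hol_pred.
Proof.
split.
  apply/asboolP; split=> // x _; exists 0 => e e0; exists 1 => // h _.
  have -> : dot 0 h = 0 by rewrite /dot big1 // => i _; exact: mul0r.
  by rewrite -[(0 : V -> C) _]/0 !subr0 cabs0 mulr_ge0 ?l1_ge0 // ltW.
move=> a F G /asboolP[F1 F2] /asboolP[G1 G2]; apply/asboolP; split=> x Ux.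
  have [l hl] := F1 x Ux; have [l' hl'] := G1 x Ux.
  by exists (a *: l + l'); exact: fdiff_lin.
by rewrite -[LHS]/(a * F x + G x) F2 // G2 // mulr0 addr0.
Qed.

HB.instance Definition _ := GRing.isSubmodClosed.Build C (V -> C) hol_pred hol_pred_submod.

Record hol := Hol { hol_fun :> V -> C; _ : hol_fun \in hol_pred }.
HB.instance Definition _ := [isSub for hol_fun].
HB.instance Definition _ := [Choice of hol by <:].
HB.instance Definition _ := [SubChoice_isSubLmodule of hol by <:].

Implicit Types F G : hol.

Lemma hol_fdiff (F : hol) x : U x -> exists l, fdiff F x l.
Proof. by move=> Ux; have /asboolP[H _] := valP F; exact: H. Qed.

Lemma hol_out (F : hol) x : ~ U x -> F x = 0.
Proof. by move=> Ux; have /asboolP[_ H] := valP F; exact: H. Qed.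

Lemma hol_eq (F G : hol) : (forall x, U x -> F x = G x) -> F = G.
Proof.
move=> FG; apply: val_inj; apply/funext => x /=.
by have [/FG//|Ux] := pselect (U x); rewrite !hol_out.
Qed.

Definition grad f x : V :=
  if pselect (exists l, fdiff f x l) is left H then projT1 (cid H) else 0.

Lemma gradP f x l : fdiff f x l -> grad f x = l.
Proof.
move=> H; rewrite /grad; case: pselect => [H'|/(_ (ex_intro _ l H))//].
exact: fdiff_unique (projT2 (cid H')) H.
Qed.

Lemma hol_grad (F : hol) x : U x -> fdiff F x (grad F x).
Proof. by move=> /(hol_fdiff F)[l hl]; rewrite (gradP hl). Qed.

Definition restr f : V -> C := fun x => if `[< U x >] then f x else 0.

Lemma restrE f x : U x -> restr f x = f x.
Proof. by move=> Ux; rewrite /restr asboolT. Qed.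

Hypothesis Uopen : is_open U.

Lemma open_ball x : U x -> exists2 r : R, 0 < r & forall y, l1 (y - x) < r -> U y.
Proof.
move=> /Uopen[r0 /gt0c[r r_gt0 ->] Hr]; exists r => // y hy; apply: Hr => i.
rewrite norm_ltc; apply: le_lt_trans hy.
rewrite /l1 (bigD1 i) //= lerDl; apply: sumr_ge0 => k _; exact: cabs_ge0.
Qed.

Lemma restr_hol f : (forall x, U x -> exists l, fdiff f x l) -> restr f \in hol_pred.
Proof.
move=> H; apply/asboolP; split=> x Ux; last by rewrite /restr asboolF.
have [l hl] := H x Ux; exists l; have [r r0 Hr] := open_ball Ux.
by apply: fdiff_near r0 _ hl => y /Hr /restrE ->.
Qed.

Lemma hol_partials (F : hol) x : U x -> exists H : 'I_n -> V,
  (forall j, fdiff (fun y => grad F y j) x (H j)) /\ forall i j, H i j = H j i.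
Proof.
move=> Ux; have [r r0 Hr] := open_ball Ux.
by apply: (holomorphic_partials r0) => y /Hr; exact: hol_grad.
Qed.

Lemma pder_hol (j : 'I_n) (F : hol) : restr (fun y => grad F y j) \in hol_pred.
Proof.
by apply: restr_hol => x /(hol_partials F)[H [H1 _]]; exists (H j).
Qed.
Definition pder j F := Hol (pder_hol j F).

Lemma mulx_hol (j : 'I_n) (F : hol) : restr (fun y => y j * F y) \in hol_pred.
Proof.
by apply: restr_hol => x /(hol_fdiff F)[l hl]; eexists; exact: fdiff_mulX hl.
Qed.
Definition mulx j F := Hol (mulx_hol j F).

Lemma pderE j F x : U x -> pder j F x = grad F x j.
Proof. exact: restrE. Qed.

Lemma mulxE j F x : U x -> mulx j F x = x j * F x.
Proof. exact: restrE. Qed.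

Lemma pder_linear j : linear (pder j).
Proof.
move=> a F G; apply: hol_eq => x Ux.
rewrite -[RHS]/(a * pder j F x + pder j G x) !pderE //.
by rewrite (gradP (fdiff_lin a (hol_grad F Ux) (hol_grad G Ux))).
Qed.
HB.instance Definition _ j := GRing.isLinear.Build C hol hol _ (pder j) (pder_linear j).

Lemma mulx_linear j : linear (mulx j).
Proof.
move=> a F G; apply: hol_eq => x Ux.
rewrite -[RHS]/(a * mulx j F x + mulx j G x) !mulxE //.
by rewrite -[(a *: F + G : hol) x]/(a * F x + G x); ring.
Qed.
HB.instance Definition _ j := GRing.isLinear.Build C hol hol _ (mulx j) (mulx_linear j).

Lemma grad_pder j F x : U x -> forall H : 'I_n -> V,
  (forall j, fdiff (fun y => grad F y j) x (H j)) -> grad (pder j F) x = H j.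
Proof.
move=> Ux H HH; apply: gradP; have [r r0 Hr] := open_ball Ux.
by apply: fdiff_near r0 _ (HH j) => y /Hr /(pderE j F) ->.
Qed.

Lemma pderC i j F : pder i (pder j F) = pder j (pder i F).
Proof.
apply: hol_eq => x Ux; rewrite !pderE //.
have [H [H1 H2]] := hol_partials F Ux.
by rewrite !(grad_pder _ Ux H1) H2.
Qed.

Lemma mulxC i j F : mulx i (mulx j F) = mulx j (mulx i F).
Proof. by apply: hol_eq => x Ux; rewrite !mulxE //; ring. Qed.

Lemma pder_mulx i j F : pder j (mulx i F) = (i == j)%:R *: F + mulx i (pder j F).
Proof.
apply: hol_eq => x Ux.
rewrite -[RHS]/((i == j)%:R * F x + mulx i (pder j F) x) mulxE // !pderE //.
have [r r0 Hr] := open_ball Ux.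
have E : fdiff (mulx i F) x (x i *: grad F x + ev i (F x)).
  by apply: fdiff_near r0 _ (fdiff_mulX i (hol_grad F Ux)) => y /Hr /(mulxE i F) ->.
rewrite (gradP E) -[LHS]/(x i * grad F x j + ev i (F x) j) addrC /ev eq_sym.
by case: eqP => _; rewrite ?mul1r ?mul0r.
Qed.

Lemma holomorphic_fdiff f : holomorphic_on U f <-> forall x, U x -> exists l, fdiff f x l.
Proof.
split=> H x /H[l hl]; exists l.
  move=> e e0; have [|d /gt0c[del del0 ->] Hd] := hl e%:C%C; first by rewrite ltcR.
  exists del => // h hd; have := Hd h; rewrite l1norm_l1 ltcR => /(_ hd).
  by rewrite -rmorphM /= norm_lec.
move=> _ /gt0c[e e0 ->]; have [del del0 Hd] := hl e e0.
exists del%:C%C; first by rewrite ltcR.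
move=> h; rewrite l1norm_l1 ltcR => /Hd.
by rewrite -rmorphM /= norm_lec.
Qed.

(** [pd] selects by [epsilon] a number satisfying [is_pderiv]; such a number exists by [fdiff], and
    uniqueness of limits pins it down. *)
Lemma pd_fdiff f j x l : fdiff f x l -> pd j f x = l j.
Proof.
move=> H.
have D : is_pderiv f j x (l j).
  move=> _ /gt0c[e e0 ->]; have e2 : 0 < e / 2 by lra.
  have [del del0 Hd] := fdiff_pderiv j H e2.
  exists del%:C%C; first by rewrite ltcR.
  move=> t t0; rewrite norm_ltc => /(Hd _ t0) ht; rewrite norm_ltc.
  by apply: le_lt_trans ht _; lra.
have := ClassicalEpsilon.epsilon_spec (inhabits (0 : C)) (is_pderiv f j x) (ex_intro _ _ D).
rewrite -/(pd j f x) => D'.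
apply/eqP; rewrite -subr_eq0 -cabs_eq0 eq_le cabs_ge0 andbT.
apply: le_eps => e e0; rewrite add0r.
have e2 : 0 < (e / 2)%:C%C :> C by rewrite ltcR; lra.
have [_ /gt0c[d1 d10 ->] H1] := D _ e2; have [_ /gt0c[d2 d20 ->] H2] := D' _ e2.
have m0 : 0 < Num.min d1 d2 / 2 by rewrite divr_gt0 // lt_min d10.
have m1 : Num.min d1 d2 <= d1 by rewrite ge_min lexx.
have m2 : Num.min d1 d2 <= d2 by rewrite ge_min lexx orbT.
pose t : C := (Num.min d1 d2 / 2)%:C%C.
have ht : cabs t = Num.min d1 d2 / 2 by rewrite cabs_pos // ltW.
have t0 : t != 0 by rewrite -cabs_gt0 ht.
have := H1 _ t0; have := H2 _ t0; rewrite !norm_ltc ht => /(_ ltac:(lra)) h2 /(_ ltac:(lra)) h1.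
set Q := (_ / _) in h1 h2.
have -> : pd j f x - l j = (Q - l j) - (Q - pd j f x) by ring.
by apply: le_trans (cabsB _ _) _; lra.
Qed.

Lemma pd_hol f (F : hol) j : (forall x, U x -> f x = F x) -> forall x, U x -> pd j f x = pder j F x.
Proof.
move=> fF x Ux; rewrite pderE //; apply: pd_fdiff.
have [r r0 Hr] := open_ball Ux.
by apply: fdiff_near r0 _ (hol_grad F Ux) => y /Hr /fF.
Qed.

End HolomorphicModule.

(** * Normal ordering in the Weyl algebra *)

Lemma mnm_ind (n : nat) (P : 'X_{1..n} -> Prop) :
  P 0%MM -> (forall i m, P m -> P (U_(i) + m)%MM) -> forall m, P m.
Proof.
move=> P0 PS m; have [d] := ubnP (mdeg m); elim: d m => // d IH m.
have [->//|m0] := eqVneq m 0%MM.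
have [i mi] : exists i, m i != 0%N.
  apply/existsP; apply: contraNT m0; rewrite negb_exists => /forallP h.
  by apply/eqP/mnmP => i; rewrite mnm0E; apply/eqP; have := h i; rewrite negbK.
have le : (U_(i) <= m)%MM by rewrite lep1mP.
rewrite ltnS => md; rewrite -(submK le) addmC; apply/PS/IH.
by move: md; rewrite -{1}(submK le) mdegD mdeg1 addn1.
Qed.

Section IteratedOperators.
Variables (V : Type) (n : nat) (T : 'I_n -> V -> V).
Hypothesis TC : forall i j v, T i (T j v) = T j (T i v).

Definition opm (m : 'X_{1..n}) (v : V) : V := foldr (fun j g => iter (m j) (T j) g) v (enum 'I_n).

Let opl (s : seq 'I_n) (m : 'X_{1..n}) (v : V) : V := foldr (fun j g => iter (m j) (T j) g) v s.

Lemma opmD m m' v : opm (m + m')%MM v = opm m (opm m' v).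
Proof.
have oplC i s u w : T i (opl s u w) = opl s u (T i w).
  elim: s => //= j s <-.
  by elim: (u j) => //= k <-; rewrite TC.
rewrite /opm -!/(opl _ _ _); elim: (enum _) => //= j s ->.
rewrite mnmDE iterD; congr iter.
elim: (m' j) => //= k ->; exact: oplC.
Qed.

Lemma opm0 v : opm 0%MM v = v.
Proof. by rewrite /opm; elim: (enum _) => //= j s ->; rewrite mnm0E. Qed.

Lemma opm1 i v : opm U_(i)%MM v = T i v.
Proof.
have H s : uniq s -> opl s U_(i)%MM v = if i \in s then T i v else v.
  elim: s => //= j s IH /andP[js /IH ->]; rewrite in_cons mnm1E.
  by have [eij|_] //= := eqVneq i j; rewrite eij (negbTE js).
by rewrite /opm -/(opl _ _ _) H ?enum_uniq // mem_enum.
Qed.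

Lemma opmS i m v : opm (U_(i) + m)%MM v = T i (opm m v).
Proof. by rewrite opmD opm1. Qed.

End IteratedOperators.

Section LinearExtension.
Variables (K : fieldType) (V : lmodType K) (n : nat).
Implicit Types (p q : {mpoly K[n]}) (psi : 'X_{1..n} -> V).

Definition mlin psi p : V := \sum_(m <- msupp p) p@_m *: psi m.

Lemma mlinwE psi p (k : nat) : (msize p <= k)%N ->
  mlin psi p = \sum_(m : 'X_{1..n < k}) p@_m *: psi m.
Proof.
move=> pk; set I : subFinType _ := 'X_{1..n < k}.
rewrite /mlin (big_mksub I) ?msupp_uniq //=; last first.
  by move=> x /msize_mdeg_lt /leq_trans; apply.
by rewrite big_rmcond //= => j /memN_msupp_eq0 ->; rewrite scale0r.
Qed.

Lemma mlin_linear psi : linear (mlin psi).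
Proof.
move=> a p q.
pose k := maxn (msize (a *: p + q)) (maxn (msize p) (msize q)).
rewrite !(@mlinwE _ _ k) ?leq_max ?leqnn ?orbT //.
rewrite scaler_sumr -big_split; apply: eq_bigr => m _ /=.
by rewrite mcoeffD mcoeffZ scalerDl scalerA.
Qed.
HB.instance Definition _ psi := GRing.isLinear.Build K {mpoly K[n]} V _ (mlin psi) (mlin_linear psi).

Lemma mlinX psi m : mlin psi 'X_[m] = psi m.
Proof. by rewrite /mlin msuppX big_seq1 mcoeffX eqxx scale1r. Qed.

Lemma eq_mlin psi psi' p : (forall m, m \in msupp p -> psi m = psi' m) ->
  mlin psi p = mlin psi' p.
Proof. by move=> H; apply: eq_big_seq => m /H ->. Qed.

Lemma mlinE (f : {linear {mpoly K[n]} -> V}) p : f p = mlin (fun m => f 'X_[m]) p.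
Proof. by rewrite {1}[p]mpolyE linear_sum; apply: eq_bigr => m _; rewrite linearZ. Qed.

Lemma mlinMX psi m p : mlin psi ('X_[m] * p) = mlin (fun k => psi (m + k)%MM) p.
Proof.
rewrite {1}[p]mpolyE mulr_sumr raddf_sum; apply: eq_bigr => k _ /=.
by rewrite -scalerAr linearZ /= -mpolyXD mlinX.
Qed.

Lemma mlinM psi p q : mlin psi (p * q) = mlin (fun m => mlin (fun k => psi (m + k)%MM) q) p.
Proof.
rewrite {1}[p]mpolyE mulr_suml raddf_sum; apply: eq_bigr => k _ /=.
by rewrite -scalerAl linearZ /= mlinMX.
Qed.

Lemma mlin_sum (I : Type) (r : seq I) (Q : pred I) (psi : I -> 'X_{1..n} -> V) p :
  mlin (fun m => \sum_(i <- r | Q i) psi i m) p = \sum_(i <- r | Q i) mlin (psi i) p.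
Proof. by rewrite /mlin exchange_big; apply: eq_bigr => m _; rewrite scaler_sumr. Qed.

Lemma mlin_scale (a : K) psi p : a *: mlin psi p = mlin (fun m => a *: psi m) p.
Proof.
by rewrite /mlin scaler_sumr; apply: eq_bigr => m _; rewrite !scalerA mulrC.
Qed.

Lemma linear_mlin (W : lmodType K) (f : {linear V -> W}) psi p :
  f (mlin psi p) = \sum_(m <- msupp p) p@_m *: f (psi m).
Proof. by rewrite linear_sum; apply: eq_bigr => m _; rewrite linearZ. Qed.

End LinearExtension.

Section WeylModule.
Variables (K : numFieldType) (V : lmodType K) (n : nat).
Variables (D X : 'I_n -> {linear V -> V}).
Hypothesis DC : forall i j v, D i (D j v) = D j (D i v).
Hypothesis XC : forall i j v, X i (X j v) = X j (X i v).
Hypothesis DX : forall i j v, D j (X i v) = (i == j)%:R *: v + X i (D j v).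
Implicit Types (p q : {mpoly K[n]}) (u v : V) (m k : 'X_{1..n}).

Lemma opmXS i m v : opm X (U_(i) + m)%MM v = X i (opm X m v).
Proof. exact: opmS XC i m v. Qed.

Lemma opmDS i m v : opm D (U_(i) + m)%MM v = D i (opm D m v).
Proof. exact: opmS DC i m v. Qed.

Lemma opmDD m m' v : opm D (m + m')%MM v = opm D m (opm D m' v).
Proof. exact: opmD DC m m' v. Qed.

Lemma opm_linear (T : 'I_n -> {linear V -> V}) m : linear (opm T m).
Proof.
rewrite /opm => a u v; elim: (enum _) => //= j s ->.
by elim: (m j) => //= k ->; rewrite linearP.
Qed.
HB.instance Definition _ (T : 'I_n -> {linear V -> V}) m :=
  GRing.isLinear.Build K V V _ (opm T m) (opm_linear T m).

Definition act p v : V := mlin (fun m => opm D m v) p.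

Lemma actX m v : act 'X_[m] v = opm D m v.
Proof. exact: mlinX. Qed.

Lemma actM p q v : act (p * q) v = act p (act q v).
Proof.
rewrite /act mlinM; apply: eq_mlin => m _; rewrite linear_mlin.
by apply: eq_bigr => k _; rewrite opmDD.
Qed.

Lemma D_opmX k j v : D j (opm X k v) = (k j)%:R *: opm X (k - U_(j))%MM v + opm X k (D j v).
Proof.
elim/mnm_ind: k v => [|i k IH] v; first by rewrite !opm0 mnm0E scale0r add0r.
rewrite !opmXS DX IH linearD linearZ /= addrA; congr (_ + _).
rewrite mnmDE mnm1E natrD scalerDl.
have [->|ij] := eqVneq i j.
  rewrite [(U_(j) + k)%MM]addmC addmK; congr (_ + _).
  have [k0|k0] := eqVneq (k j) 0%N; first by rewrite k0 !scale0r.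
  by rewrite -opmXS addmC submK // lep1mP.
rewrite /= !scale0r !add0r.
have [k0|k0] := eqVneq (k j) 0%N; first by rewrite k0 !scale0r.
rewrite -opmXS; congr (_ *: opm _ _ _); apply/mnmP => l.
rewrite mnmBE !mnmDE mnmBE !mnm1E; have [<-|_] := eqVneq j l.
  by rewrite (negbTE ij).
by rewrite !subn0.
Qed.

(** If xi^k stands for the falling factorial [theta]_k = x^k d^k, then 1 + d/dxi_j is the
    substitution of theta_j + 1 for theta_j, and xi_j (1 + d/dxi_j) is multiplication by theta_j. *)
Definition tr (j : 'I_n) p : {mpoly K[n]} := p + p^`M(j).
Definition theta (j : 'I_n) p : {mpoly K[n]} := 'X_j * tr j p.

Lemma tr_linear j : linear (tr j).
Proof. by move=> a p q; rewrite /tr linearP scalerDr addrACA. Qed.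
HB.instance Definition _ j := GRing.isLinear.Build K _ _ _ (tr j) (tr_linear j).

Lemma theta_linear j : linear (theta j).
Proof. by move=> a p q; rewrite /theta linearP mulrDr scalerAr. Qed.
HB.instance Definition _ j := GRing.isLinear.Build K _ _ _ (theta j) (theta_linear j).

Lemma trC i j p : tr i (tr j p) = tr j (tr i p).
Proof. by rewrite /tr !mderivD (mderiv_comm i j) addrACA. Qed.

Lemma opm_trS i m p : opm tr (U_(i) + m)%MM p = tr i (opm tr m p).
Proof. exact: opmS trC i m p. Qed.

Lemma tr_theta i j p : tr i (theta j p) = theta j (tr i p) + (i == j)%:R *: tr i p.
Proof.
have dX : ('X_j : {mpoly K[n]})^`M(i) = (i == j)%:R.
  rewrite mderivX mnm1E eq_sym; case: eqP => [->|_]; last by rewrite scale0r.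
  by rewrite scale1r -[X in (X - _)%MM]addm0 addmC addmK mpolyX0.
rewrite {1}/tr {1}/theta mderivM dX -/(theta j p) /theta.
have -> : tr j (tr i p) = tr j p + (tr j p)^`M(i) by rewrite -trC.
have [->|_] /= := eqVneq i j; last by rewrite scale0r mul0r; ring.
by rewrite scale1r mul1r; ring.
Qed.

Lemma thetaX j k : theta j 'X_[k] = 'X_[U_(j) + k] + (k j)%:R *: 'X_[k].
Proof.
rewrite /theta /tr mderivX mulrDr -mpolyXD -scalerAr -mpolyXD; congr (_ + _).
have [k0|k0] := eqVneq (k j) 0%N; first by rewrite k0 !scale0r.
by rewrite addmC submK // lep1mP.
Qed.

(* sum of p_k x^k d^k v *)
Definition nop v p : V := mlin (fun k => opm X k (opm D k v)) p.

Lemma nop_linear v : linear (nop v).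
Proof. exact: mlin_linear. Qed.
HB.instance Definition _ v := GRing.isLinear.Build K _ _ _ (nop v) (nop_linear v).

Lemma nop_theta v j p : nop v (theta j p) = X j (D j (nop v p)).
Proof.
rewrite -[LHS]/((mlin _ \o theta j) p) mlinE /nop !linear_mlin; apply: eq_bigr => k _.
congr (_ *: _); rewrite /= thetaX linearD linearZ /= !mlinX D_opmX linearD linearZ /=.
rewrite addrC opmXS opmDS; congr (_ + _).
have [k0|k0] := eqVneq (k j) 0%N; first by rewrite k0 !scale0r.
by rewrite -opmXS addmC submK // lep1mP.
Qed.

(** * Polynomials in A theta and eigenvectors of the Euler operators *)

Section Gradings.
Variables (d : nat) (A : 'M[int]_(d, n)).
Implicit Types (l : 'rV[int]_d) (c : int) (w : 'cV[int]_n).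

Definition mcol m : 'cV[int]_n := \col_i (m i)%:Z.

Lemma mcolD m k : mcol (m + k)%MM = mcol m + mcol k.
Proof. by apply/colP => i; rewrite !mxE mnmDE PoszD. Qed.

Lemma mcol0 : mcol 0%MM = 0.
Proof. by apply/colP => i; rewrite !mxE mnm0E. Qed.

Lemma mulmx_mcol1 (r : nat) (M : 'M[int]_(r, n)) i (j : 'I_n) :
  (M *m mcol U_(j)) i 0 = M i j.
Proof.
rewrite mxE (bigD1 j) //= [mcol _ _ _]mxE mnm1E eqxx mulr1 big1 ?addr0 // => k kj.
by rewrite [mcol _ _ _]mxE mnm1E eq_sym (negbTE kj) mulr0.
Qed.

Definition pairing l w : int := (l *m (A *m w)) 0 0.

Lemma pairingD l w w' : pairing l (w + w') = pairing l w + pairing l w'.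
Proof. by rewrite /pairing mulmxDr mulmxDr mxE. Qed.

Lemma pairing_mcol1 l (j : 'I_n) : pairing l (mcol U_(j)) = (l *m A) 0 j.
Proof.
by rewrite /pairing mulmxA mulmx_mcol1.
Qed.

(* The polynomial y such that y(x d) in normal ordering equals the product of
   the l(A theta + A w) - c. *)
Fixpoint normal_symbol (bs : seq ('rV[int]_d * int)) w : {mpoly K[n]} :=
  if bs is (l, c) :: bs' then
    \sum_j ((l *m A) 0 j)%:~R *: theta j (normal_symbol bs' w)
    + (pairing l w - c)%:~R *: normal_symbol bs' w
  else 1.

(** Raising theta_i by 1 moves A theta by the i-th column of A. *)
Lemma tr_normal_symbol bs w i : tr i (normal_symbol bs w) = normal_symbol bs (w + mcol U_(i)).
Proof.
elim: bs => [|[l c] bs IH] /=; first by rewrite /tr -mpolyC1 mderivC addr0.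
rewrite linearD raddf_sum /= linearZ /= IH pairingD pairing_mcol1.
have -> : \sum_j tr i (((l *m A) 0 j)%:~R *: theta j (normal_symbol bs w)) =
   \sum_j ((l *m A) 0 j)%:~R *: theta j (normal_symbol bs (w + mcol U_(i)))
   + ((l *m A) 0 i)%:~R *: normal_symbol bs (w + mcol U_(i)).
  rewrite (eq_bigr (fun j => ((l *m A) 0 j)%:~R *: theta j (normal_symbol bs (w + mcol U_(i)))
     + ((i == j)%:R * ((l *m A) 0 j)%:~R) *: normal_symbol bs (w + mcol U_(i)))).
    rewrite big_split /=; congr (_ + _).
    rewrite (bigD1 i) //= eqxx mul1r big1 ?addr0 // => j ji.
    by rewrite eq_sym (negbTE ji) mul0r scale0r.
  by move=> j _; rewrite linearZ /= tr_theta IH scalerDr scalerA mulrC.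
rewrite -addrA -scalerDl; congr (_ + _ *: _).
by rewrite -rmorphD /=; congr (_%:~R); ring.
Qed.

Lemma opm_tr_normal_symbol bs k : opm tr k (normal_symbol bs 0) = normal_symbol bs (mcol k).
Proof.
elim/mnm_ind: k => [|i k IH]; first by rewrite opm0 mcol0.
by rewrite opm_trS IH tr_normal_symbol mcolD addrC.
Qed.

Lemma eq_normal_symbol bs w w' : A *m w = A *m w' -> normal_symbol bs w = normal_symbol bs w'.
Proof. by move=> e; elim: bs => //= [[l c] bs ->]; rewrite /pairing e. Qed.

Lemma normal_symbol_coef0 bs w :
  (normal_symbol bs w)@_0%MM = \prod_(b <- bs) (pairing b.1 w - b.2)%:~R.
Proof.
elim: bs => [|[l c] bs IH] /=; first by rewrite big_nil mcoeff1 eqxx.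
rewrite big_cons -IH mcoeffD mcoeffZ raddf_sum /= big1 ?add0r // => j _.
rewrite mcoeffZ /theta rmorphM /= mcoeffX.
by rewrite mnm1_eq0 mul0r mulr0.
Qed.

(** Newton's formula: k! times the coefficient at [k] is the k-th derivative of the symbol at 0.
    Since d/dxi_j is [tr j] minus the identity, a forward difference, this is a combination of the
    values of the product at the k' <= k, all of which vanish. *)
Lemma normal_symbol_supp (bs : seq ('rV[int]_d * int)) k :
  (forall k', (k' <= k)%MM -> exists2 b, b \in bs & pairing b.1 (mcol k') = b.2) ->
  k \notin msupp (normal_symbol bs 0).
Proof.
move=> H.
have {}H k' : (k' <= k)%MM -> (normal_symbol bs (mcol k'))@_0%MM = 0.
  move=> /H[b bb e]; rewrite normal_symbol_coef0 (big_rem b) //= e subrr.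
  by rewrite mul0r.
have {}H s : forall u : 'X_{1..n}, (s + u <= k)%MM -> ((normal_symbol bs (mcol u))^`M[s])@_0%MM = 0.
  elim/mnm_ind: s => [|j s IH] u.
    by rewrite add0m mderivm0m; exact: H.
  move=> le; rewrite addmC mderivmDm mderivmU1m.
  have -> : (normal_symbol bs (mcol u))^`M[s]^`M(j) = ((normal_symbol bs (mcol u))^`M(j))^`M[s].
    by rewrite -!mderivmU1m -!mderivmDm addmC.
  have -> : (normal_symbol bs (mcol u))^`M(j) =
    normal_symbol bs (mcol (U_(j) + u)) - normal_symbol bs (mcol u).
    by rewrite mcolD [mcol _ + _]addrC -tr_normal_symbol /tr addrAC subrr add0r.
  rewrite mderivmB mcoeffB !IH ?subrr //.
    by apply: lepm_trans le; apply/mnm_lepP => i; rewrite !mnmDE -addnA leq_addl.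
  by rewrite addmA [(s + _)%MM]addmC.
have := H k 0%MM; rewrite addm0 mcol0 => /(_ (lepm_refl _)).
rewrite mcoeff_mderivm addm0 => /eqP; rewrite -mulr_natr mulf_eq0 pnatr_eq0.
have -> : (\prod_(i < n) (k i) ^_ (k i) == 0)%N = false.
  by apply/negbTE; rewrite -lt0n prodn_gt0 // => i; rewrite ffactnn fact_gt0.
by rewrite orbF mcoeff_eq0.
Qed.

Definition euler (i : 'I_d) v : V := \sum_j (A i j)%:~R *: X j (D j v).

Lemma euler_linear i : linear (euler i).
Proof.
move=> a u v; rewrite /euler scaler_sumr -big_split; apply: eq_bigr => j _ /=.
by rewrite (linearP (D j)) (linearP (X j)) scalerDr !scalerA mulrC.
Qed.
HB.instance Definition _ i := GRing.isLinear.Build K V V _ (euler i) (euler_linear i).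

Definition euler_eigen (beta : 'I_d -> K) v := forall i, euler i v = beta i *: v.

Definition affine_form (beta : 'I_d -> K) l c : K := \sum_i (l 0 i)%:~R * beta i - c%:~R.

(** Each l(A theta) is a combination of Euler operators, which act on [v] through [beta]. *)
Lemma nop_normal_symbol beta v bs : euler_eigen beta v ->
  nop v (normal_symbol bs 0) = (\prod_(b <- bs) affine_form beta b.1 b.2) *: v.
Proof.
move=> Ev; elim: bs => [|[l c] bs IH] /=.
  by rewrite big_nil -mpolyX0 /nop mlinX !opm0 scale1r.
rewrite big_cons linearD raddf_sum /= linearZ /= IH.
have -> : pairing l 0 = 0 by rewrite /pairing !mulmx0 mxE.
rewrite sub0r mulrC -scalerA /affine_form scalerBl scalerDr.
congr (_ + _); last by rewrite rmorphN scaleNr scalerN !scalerA mulrC.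
rewrite (eq_bigr (fun j => \sum_i ((l 0 i * A i j)%:~R *: X j (D j
   ((\prod_(b <- bs) affine_form beta b.1 b.2) *: v))))); last first.
  move=> j _; rewrite linearZ /= nop_theta IH mxE rmorph_sum /=.
  by rewrite scaler_suml.
rewrite exchange_big /= scaler_suml scaler_sumr; apply: eq_bigr => i _.
rewrite (eq_bigr (fun j => (l 0 i)%:~R *: ((A i j)%:~R *: X j (D j
   ((\prod_(b <- bs) affine_form beta b.1 b.2) *: v))))); last first.
  by move=> j _; rewrite rmorphM scalerA.
rewrite -scaler_sumr -/(euler i _) linearZ /= Ev !scalerA; congr (_ *: _); ring.
Qed.

Definition mdegA m : 'I_d -> K := fun i => ((A *m mcol m) i 0)%:~R.

Lemma mdegAS j m i : mdegA (U_(j) + m)%MM i = (A i j)%:~R + mdegA m i.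
Proof.
by rewrite /mdegA mcolD mulmxDr [X in X%:~R]mxE rmorphD mulmx_mcol1.
Qed.

Lemma mdegA0 i : mdegA 0%MM i = 0.
Proof. by rewrite /mdegA mcol0 mulmx0 mxE. Qed.

Lemma euler_D i j v : euler i (D j v) = D j (euler i v) - (A i j)%:~R *: D j v.
Proof.
rewrite /euler raddf_sum [X in X - _](bigD1 j) //= [LHS](bigD1 j) //=.
rewrite linearZ /= DX eqxx scale1r scalerDr [X in X - _]addrAC [X in _ = X]addrAC.
rewrite (eq_bigr (fun k : 'I_n => D j ((A i k)%:~R *: X k (D k v)))); last first.
  by move=> k kj; rewrite linearZ /= DX (negbTE kj) scale0r add0r (DC j k).
by rewrite [X in _ = X - _ + _]addrC addrK addrC.
Qed.

Lemma euler_X i j v : euler i (X j v) = X j (euler i v) + (A i j)%:~R *: X j v.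
Proof.
rewrite /euler raddf_sum [X in X + _](bigD1 j) //= [LHS](bigD1 j) //=.
rewrite linearZ /= DX eqxx scale1r linearD scalerDr.
rewrite (eq_bigr (fun k : 'I_n => X j ((A i k)%:~R *: X k (D k v)))); last first.
  move=> k kj; rewrite linearZ /= DX eq_sym (negbTE kj) scale0r add0r XC //.
rewrite -addrA addrC; congr (_ + _).
Qed.

Lemma euler_opmD i m v : euler i (opm D m v) = opm D m (euler i v) - mdegA m i *: opm D m v.
Proof.
elim/mnm_ind: m => [|j m IH]; first by rewrite !opm0 mdegA0 scale0r subr0.
rewrite !opmDS euler_D IH linearB linearZ /= -addrA -opprD -scalerDl mdegAS.
by rewrite [mdegA _ _ + _]addrC.
Qed.

Lemma euler_opmX i m v : euler i (opm X m v) = opm X m (euler i v) + mdegA m i *: opm X m v.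
Proof.
elim/mnm_ind: m => [|j m IH]; first by rewrite !opm0 mdegA0 scale0r addr0.
rewrite !opmXS euler_X IH linearD linearZ /= -addrA -scalerDl mdegAS.
by rewrite [mdegA _ _ + _]addrC.
Qed.

Lemma mcolB m k : (k <= m)%MM -> mcol (m - k)%MM = mcol m - mcol k.
Proof. by move=> km; rewrite -{2}(submK km) mcolD addrK. Qed.

Lemma inLD (u v : 'cV[int]_n) : inL A u -> inL A v -> inL A (u + v).
Proof. by rewrite /inL mulmxDr => -> ->; rewrite addr0. Qed.

Lemma inLN (u : 'cV[int]_n) : inL A u -> inL A (- u).
Proof. by rewrite /inL mulmxN => ->; rewrite oppr0. Qed.

Definition lattice_char (rho : 'cV[int]_n -> K) :=
  (forall u v : 'cV[int]_n, inL A u -> inL A v -> rho (u + v) = rho u * rho v) /\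
  (forall u : 'cV[int]_n, inL A u -> rho u != 0).

(** Annihilation by I_rho in terms of monomials alone; [char_eigenP] proves the equivalence. *)
Definition char_eigen (rho : 'cV[int]_n -> K) (h : V) := forall m k,
  inL A (mcol m - mcol k) -> opm D m h = rho (mcol m - mcol k) *: opm D k h.

Definition representable (e : 'cV[int]_n) := exists m, inL A (e - mcol m).

(* The value of d^e h for e in Z^n, available when e is congruent modulo L to
   a vector of N^n; it is 0 otherwise. *)
Definition shifted_deriv (rho : 'cV[int]_n -> K) (h : V) (e : 'cV[int]_n) : V :=
  if pselect (representable e) is left H then
    let m := projT1 (cid H) in rho (e - mcol m) *: opm D m h
  else 0.

(** * Derivatives of negative order on an eigenvector *)

Section OneCharacter.
Variables (rho : 'cV[int]_n -> K) (h : V).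
Hypothesis rho_char : lattice_char rho.
Hypothesis h_eigen : char_eigen rho h.

(** Two choices of [m] differ by an element of L, and [char_eigen] with the multiplicativity of
    [rho] compensates for the change. *)
Lemma shifted_derivE e m : inL A (e - mcol m) ->
  shifted_deriv rho h e = rho (e - mcol m) *: opm D m h.
Proof.
move=> He; rewrite /shifted_deriv; case: pselect => [H|[]]; last by exists m.
set k := projT1 _; have Hk : inL A (e - mcol k) := projT2 (cid H).
have Hkm : inL A (mcol m - mcol k).
  have -> : mcol m - mcol k = (e - mcol k) + - (e - mcol m).
    by rewrite opprB [e - _]addrC addrACA subrr addr0 addrC.
  exact: inLD Hk (inLN He).
rewrite (h_eigen Hkm) scalerA -(proj1 rho_char) //.
by congr (rho _ *: _); rewrite addrA subrK.
Qed.

Lemma representableD e j : representable e -> representable (e + mcol U_(j)).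
Proof. by move=> [m Hm]; exists (U_(j) + m)%MM; rewrite mcolD addrKA. Qed.

Lemma D_shifted_deriv e j : representable e ->
  D j (shifted_deriv rho h e) = shifted_deriv rho h (e + mcol U_(j)).
Proof.
move=> [m Hm]; rewrite (shifted_derivE Hm) linearZ /= -opmDS.
have Hm' : inL A (e + mcol U_(j) - mcol (U_(j) + m)).
  by rewrite mcolD addrKA.
by rewrite (shifted_derivE Hm') mcolD addrKA.
Qed.

Lemma shifted_derivL e (u : 'cV[int]_n) : representable e -> inL A u ->
  shifted_deriv rho h (u + e) = rho u *: shifted_deriv rho h e.
Proof.
move=> [m Hm] Hu.
have Hm' : inL A (u + e - mcol m) by rewrite -addrA; exact: inLD.
by rewrite (shifted_derivE Hm) (shifted_derivE Hm') scalerA -(proj1 rho_char) // addrA.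
Qed.

(** This is [nop] applied to d^e h, although d^e h itself need not exist: only the orders e + k have
    to be representable. *)
Definition nshift e p : V := mlin (fun k => opm X k (shifted_deriv rho h (e + mcol k))) p.

Lemma nshift_linear e : linear (nshift e).
Proof. exact: mlin_linear. Qed.
HB.instance Definition _ e := GRing.isLinear.Build K _ _ _ (nshift e) (nshift_linear e).

(** In the term k_j x^(k - U_j) d^(e + k) the order e + k equals (e + U_j) + (k - U_j), so both
    terms of the commutation rule belong to the shift e + U_j. *)
Lemma D_nshift e j p : (forall k, k \in msupp p -> representable (e + mcol k)) ->
  D j (nshift e p) = nshift (e + mcol U_(j)) (tr j p).
Proof.
move=> Hp; rewrite -[RHS]/((nshift _ \o tr j) p) [RHS]mlinE /nshift linear_mlin.
apply: eq_big_seq => k /Hp Hk; congr (_ *: _).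
rewrite /= /tr mderivX linearD linearZ /= /nshift !mlinX D_opmX addrC D_shifted_deriv //.
have [k0|k0] := eqVneq (k j) 0%N.
  by rewrite k0 !scale0r addrAC.
rewrite mcolB ?lep1mP //.
have -> : e + mcol U_(j) + (mcol k - mcol U_(j)) = e + mcol k.
  by rewrite addrACA subrr addr0.
by rewrite addrAC.
Qed.

Lemma representable_tr e j p : (forall k, k \in msupp p -> representable (e + mcol k)) ->
  forall k, k \in msupp (tr j p) -> representable (e + mcol U_(j) + mcol k).
Proof.
move=> Hp k /msuppD_le; rewrite mem_cat => /orP[/Hp|].
  by move=> /representableD -/(_ j); rewrite addrAC.
rewrite mcoeff_msupp mcoeff_deriv => H.
have /Hp : (k + U_(j))%MM \in msupp p.
  by rewrite mcoeff_msupp; apply: contraNneq H => ->; rewrite mul0rn.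
by rewrite mcolD addrA addrAC.
Qed.

Lemma opmD_nshift e m p : (forall k, k \in msupp p -> representable (e + mcol k)) ->
  opm D m (nshift e p) = nshift (e + mcol m) (opm tr m p) /\
  (forall k, k \in msupp (opm tr m p) -> representable (e + mcol m + mcol k)).
Proof.
move=> Hp; elim/mnm_ind: m => [|j m [IH1 IH2]]; first by rewrite !opm0 mcol0 addr0.
have -> : e + mcol (U_(j) + m) = e + mcol m + mcol U_(j).
  by rewrite mcolD addrA addrAC.
rewrite opmDS opm_trS IH1 D_nshift //; split => //.
exact: representable_tr.
Qed.

Lemma nshift_symbol_eigen e bs :
  (forall k, k \in msupp (normal_symbol bs 0) -> representable (e + mcol k)) ->
  char_eigen rho (nshift e (normal_symbol bs 0)).
Proof.
move=> Hp m m' Hm.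
have [-> _] := opmD_nshift m Hp; have [-> Hp'] := opmD_nshift m' Hp.
rewrite !opm_tr_normal_symbol in Hp' *.
have -> : normal_symbol bs (mcol m) = normal_symbol bs (mcol m').
  by apply: eq_normal_symbol; apply/eqP; rewrite -subr_eq0 -mulmxBr Hm.
rewrite /nshift mlin_scale; apply: eq_mlin => k /Hp' Hk.
rewrite -linearZ -shifted_derivL //; congr (opm _ _ (shifted_deriv _ _ _)).
by rewrite addrA; congr (_ + _); rewrite addrCA subrK.
Qed.

End OneCharacter.

Theorem eigen_decomposition (mB : nat) (B : 'M[int]_(n, mB)) (I : finType)
  (P : I -> {mpoly K[n]}) (rho : I -> 'cV[int]_n -> K) (alpha : 'X_{1..n})
  (bs : seq ('rV[int]_d * int)) (beta : 'I_d -> K) (f : V) :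
  A *m B = 0 ->
  (forall i, lattice_char (rho i)) -> (forall i (w : 'cV[int]_mB), rho i (B *m w) = 1) ->
  (forall m k (w : 'cV[int]_mB), mcol m - mcol k = B *m w -> opm D m f = opm D k f) ->
  euler_eigen beta f ->
  (forall i m, m \in msupp (P i) -> A *m mcol m = A *m mcol alpha) ->
  \sum_i act (P i) f = opm D alpha f ->
  (forall i, char_eigen (rho i) (act (P i) f)) ->
  (forall k, (forall m (w : 'cV[int]_mB), mcol k - mcol m - mcol alpha <> B *m w) ->
     exists2 b, b \in bs & pairing b.1 (mcol k) = b.2) ->
  \prod_(b <- bs) affine_form beta b.1 b.2 != 0 ->
  exists fs : I -> V, f = \sum_i fs i /\
    forall i, euler_eigen beta (fs i) /\ char_eigen (rho i) (fs i).
Proof.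
move=> AB rho_char rhoB fB fE Pdeg Psum Pker bsP.
set s := \prod_(b <- bs) _ => s0.
pose y := normal_symbol bs 0.
have suppy k : k \in msupp y -> exists m (w : 'cV[int]_mB), mcol k - mcol m - mcol alpha = B *m w.
  move=> ky; apply: contrapT => Hk; move: ky; apply/negP; apply: normal_symbol_supp.
  (* S is closed upwards, because m can be increased by k - k'; so every k' below a [k] outside S is
     outside S as well. *)
  move=> k' kk'; apply: bsP => m w e; apply: Hk; exists (m + (k - k'))%MM, w.
  rewrite -e mcolD mcolB //; congr (_ - _).
  by apply/colP => i; rewrite !mxE; ring.
have LB (w : 'cV[int]_mB) : inL A (B *m w) by rewrite /inL mulmxA AB mul0mx.
have suppy_rep k : k \in msupp y -> representable (- mcol alpha + mcol k).
  move=> /suppy[m [w e]]; exists m; have -> : - mcol alpha + mcol k - mcol m = B *m w.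
    by rewrite -e; apply/colP => i; rewrite !mxE; ring.
  exact: LB.
pose h i := act (P i) f.
have hE i (k : 'I_d) : euler k (h i) = (beta k - mdegA alpha k) *: h i.
  rewrite /h /act linear_mlin /mlin scaler_sumr; apply: eq_big_seq => m /Pdeg Hm.
  by rewrite /= euler_opmD fE linearZ /= -scalerBl !scalerA mulrC /mdegA Hm.
exists (fun i => s^-1 *: nshift (rho i) (h i) (- mcol alpha) y); split.
  rewrite -scaler_sumr -mlin_sum.
  apply: (scalerI s0); rewrite scalerA mulfV // scale1r -(nop_normal_symbol bs fE).
  apply: eq_mlin => k /suppy[m [w e]].
  rewrite -linear_sum; congr (opm _ _ _).
  have e' : - mcol alpha + mcol k - mcol m = B *m w.
    by rewrite -e; apply/colP => i; rewrite !mxE; ring.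
  (* Since k and m + alpha differ by an element of L_B, d^k f equals d^m d^alpha f, which is the sum
     of the d^m P_i f. *)
  transitivity (opm D (m + alpha)%MM f).
    by apply: (fB _ _ w); rewrite mcolD opprD addrA.
  rewrite opmDD -Psum linear_sum; apply: eq_bigr => i _.
  by rewrite (@shifted_derivE _ _ (rho_char i) (Pker i) _ m) e' ?rhoB ?scale1r.
move=> i; split.
  move=> k; rewrite linearZ /= scalerA mulrC -scalerA; congr (_ *: _).
  rewrite /nshift linear_mlin /mlin scaler_sumr; apply: eq_big_seq => k' ky.
  have [m Hm] := suppy_rep _ ky.
  rewrite (shifted_derivE (rho_char i) (Pker i) Hm) scalerA mulrC -scalerA; congr (_ *: _).
  set r := rho i _; set w := opm _ m _.
  rewrite /= [opm _ k' (r *: w)]linearZ linearZ /= scalerA [beta k * r]mulrC -scalerA.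
  congr (_ *: _); rewrite /w.
  rewrite euler_opmX euler_opmD hE linearZ /= -scalerBl linearZ /= -scalerDl; congr (_ *: _).
  (* The weights balance: x^k' adds A k', d^m subtracts A m, and [h i] has weight beta - A alpha. *)
  have : A *m mcol k' = A *m mcol alpha + A *m mcol m.
    apply/eqP; rewrite -subr_eq0 opprD addrA -!mulmxBr; apply/eqP.
    by rewrite -[mcol k' - _]addrC; exact: Hm.
  by move=> e; rewrite /mdegA e [(A *m mcol alpha + A *m mcol m) k 0]mxE rmorphD /=; ring.
move=> m m' Hm; rewrite !linearZ /=.
by rewrite (nshift_symbol_eigen (rho_char i) (Pker i) suppy_rep Hm) scalerA mulrC -scalerA.
Qed.

End Gradings.
End WeylModule.

(** * Affine forms vanishing off S *)

Section IntegerLinearAlgebra.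

Local Notation toQ := (map_mx (intr : int -> rat)).

Lemma toQ_inj (p q : nat) : injective (toQ : 'M[int]_(p, q) -> 'M[rat]_(p, q)).
Proof.
move=> M N /matrixP H; apply/matrixP => i j; have := H i j.
by rewrite !mxE => /intr_inj.
Qed.

Lemma clear_denominators (p q : nat) (M : 'M[rat]_(p, q)) :
  exists (c : nat) (N : 'M[int]_(p, q)), (0 < c)%N /\ toQ N = c%:R *: M.
Proof.
pose c := (\prod_(x : 'I_p * 'I_q) `|denq (M x.1 x.2)|)%N.
have c0 : (0 < c)%N by rewrite prodn_gt0 // => x; rewrite absz_gt0 denq_neq0.
exists c, (\matrix_(i, j) ((c %/ `|denq (M i j)|)%N%:Z * numq (M i j))); split => //.
apply/matrixP => i j; rewrite !mxE.
have /dvdnP[k ck] : (`|denq (M i j)| %| c)%N.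
  by rewrite /c (bigD1 (i, j)) //= dvdn_mulr.
have d0 : (0 < `|denq (M i j)|)%N by rewrite absz_gt0 denq_neq0.
rewrite ck mulnK // rmorphM /= -{3}[M i j]divq_num_den natrM.
have -> : (`|denq (M i j)|%:R : rat) = (denq (M i j))%:~R.
  by rewrite -[LHS]/(`|denq (M i j)|%:Z%:~R) absz_denq.
have dq : (denq (M i j))%:~R != 0 :> rat by rewrite intr_eq0 denq_neq0.
by rewrite -[k%:~R]/(k%:R); field.
Qed.

Variables (d n mB : nat) (A : 'M[int]_(d, n)) (B : 'M[int]_(n, mB)).
Hypothesis dn : (d + mB = n)%N.
Hypothesis rankA : \rank (toQ A) = d.
Hypothesis rankB : \rank (toQ B) = mB.
Hypothesis AB : A *m B = 0.

(** Over Q the columns of B span the kernel of A by a count of dimensions; a common denominator of a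
    pseudo-inverse of B gives one [q] for all [e]. *)
Lemma kernel_multiple : exists2 q : nat, (0 < q)%N &
  forall e : 'cV[int]_n, A *m e = 0 -> exists w : 'cV[int]_mB, q%:Z *: e = B *m w.
Proof.
have BA : ((toQ B)^T <= kermx (toQ A)^T)%MS.
  by apply/sub_kermxP; rewrite -trmx_mul -map_mxM AB map_mx0 trmx0.
have AB' : (kermx (toQ A)^T <= (toQ B)^T)%MS.
  rewrite -(mxrank_leqif_sup BA) mxrank_ker !mxrank_tr rankA rankB.
  by rewrite -dn addKn.
have [q [P [q0 HP]]] := clear_denominators (pinvmx (toQ B)^T).
exists q => // e Ae.
have eA : ((toQ e)^T <= kermx (toQ A)^T)%MS.
  by apply/sub_kermxP; rewrite -trmx_mul -map_mxM Ae map_mx0 trmx0.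
have eB : toQ B *m ((toQ e)^T *m pinvmx (toQ B)^T)^T = toQ e.
  by rewrite -[LHS]trmxK trmx_mul trmxK (mulmxKpV (submx_trans eA AB')) trmxK.
exists (e^T *m P)^T; apply: toQ_inj.
rewrite map_mxM -map_trmx map_mxM HP -map_trmx -scalemxAr linearZ /= -scalemxAr eB.
by apply/matrixP => i j; rewrite !mxE rmorphM.
Qed.

Definition cols_in (t : {set 'I_n}) : 'M[int]_(d, n) :=
  \matrix_(i, j) if j \in t then A i j else 0.

(** If no nonzero form kills the columns of A in [t], they span Q^d, so A alpha is a rational
    combination of them; clearing denominators gives an element [m] of S supported in [t]. *)
Lemma annihilator_or_spanning (t : {set 'I_n}) (alpha : 'X_{1..n}) :
  (exists l : 'rV[int]_d, l != 0 /\ forall j, j \in t -> (l *m A) 0 j = 0) \/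
  (exists m k (w : 'cV[int]_mB), mcol m - mcol k - mcol alpha = B *m w /\
     forall j, j \notin t -> m j = 0%N).
Proof.
have [full|nfull] := boolP (row_full (toQ (cols_in t))^T); last first.
  left.
  have : kermx (toQ (cols_in t)) != 0.
    rewrite -mxrank_eq0 mxrank_ker subn_eq0 -ltnNge ltn_neqAle rank_leq_row andbT.
    by move: nfull; rewrite /row_full mxrank_tr.
  move=> /rowV0Pn[v /sub_kermxP vM v0].
  have [q [l [q0 Hl]]] := clear_denominators v.
  have qQ : (q%:R : rat) != 0 by rewrite pnatr_eq0 -lt0n.
  exists l; split.
    apply: contraNneq v0 => l0; move: Hl; rewrite l0 map_mx0 => /esym/eqP.
    by rewrite scaler_eq0 (negbTE qQ).
  have lM : l *m cols_in t = 0.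
    by apply: toQ_inj; rewrite map_mxM Hl -scalemxAl vM scaler0 map_mx0.
  move=> j jt; move/matrixP/(_ 0 j): lM; rewrite !mxE => h; rewrite -[RHS]h.
  by apply: eq_bigr => i _; rewrite !mxE jt.
right.
have /submxP[c0 Hc0] := submx_full (toQ (A *m mcol alpha))^T full.
have [q [c [q0 Hc]]] := clear_denominators c0^T.
pose c' : 'cV[int]_n := \col_j if j \in t then c j 0 else 0.
have cA : A *m c' = q%:Z *: (A *m mcol alpha).
  have -> : A *m c' = cols_in t *m c.
    apply/colP => i; rewrite !mxE; apply: eq_bigr => j _; rewrite !mxE.
    by case: ifP; rewrite ?mulr0 ?mul0r.
  apply: toQ_inj; rewrite map_mxM Hc -scalemxAr -[toQ (cols_in t)]trmxK -trmx_mul -Hc0 trmxK.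
  by apply/matrixP => i j; rewrite !mxE rmorphM.
have [r r0 /(_ (c' - q%:Z *: mcol alpha))[|w Hr]] := kernel_multiple.
  by rewrite mulmxBr cA -scalemxAr subrr.
(* Here c' - q alpha lies in L and r times it in L_B. The positive part of r c' is m, and its
   negative part plus (r q - 1) alpha is k; the last alpha is the one already present in the
   equation. *)
exists (posm (r%:Z *: c')), (negm (r%:Z *: c') + alpha *+ (r * q).-1)%MM, w; split.
  rewrite -Hr; apply/colP => i; rewrite !mxE mnmDE mulmnE !mnmE !mxE.
  have rq : ((r * q).-1.+1 = r * q)%N by rewrite prednK // muln_gt0 r0.
  have rqZ : (r%:Z * q%:Z = (r * q).-1%:Z + 1) by rewrite -PoszM -{1}rq -addn1 PoszD.
  rewrite PoszD PoszM mulrBr mulrA rqZ.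
  set x := r%:Z * _; case: (lerP 0 x) => x0.
    have -> : Num.max (- x) 0 = 0 by rewrite max_r // oppr_le0.
    rewrite absz0 (gez0_abs _) //; ring.
  have -> : Num.max (- x) 0 = - x by rewrite max_l // oppr_ge0 ltW.
  rewrite absz0 (gez0_abs _) ?oppr_ge0 ?ltW //; ring.
by move=> j jt; rewrite mnmE !mxE (negbTE jt) mulr0 maxxx.
Qed.

(** Let t be the set of coordinates where k is at least [N]. If t carries an element of S, that
    element is below k, so k lies in S. Otherwise the form of t kills the columns in t, and its
    value at A k involves only coordinates smaller than [N], so it is one of finitely many
    integers. *)
Lemma vanishing_forms (alpha : 'X_{1..n}) : exists bs : seq ('rV[int]_d * int),
  (forall b, b \in bs -> b.1 != 0) /\
  forall k, (forall m (w : 'cV[int]_mB), mcol k - mcol m - mcol alpha <> B *m w) ->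
     exists2 b, b \in bs & pairing A b.1 (mcol k) = b.2.
Proof.
have H (t : {set 'I_n}) : exists lm : 'rV[int]_d * 'X_{1..n},
    (lm.1 != 0 /\ forall j, j \in t -> (lm.1 *m A) 0 j = 0) \/
    ((exists k (w : 'cV[int]_mB), mcol lm.2 - mcol k - mcol alpha = B *m w) /\
     forall j, j \notin t -> lm.2 j = 0%N).
  have [[l Hl]|[m [k [w [Hm Hm0]]]]] := annihilator_or_spanning t alpha.
    by exists (l, 0%MM); left.
  by exists (0, m); right; split => //; exists k, w.
have {H} [lm lmP] := boolp.choice H.
pose N := (\max_(t : {set 'I_n}) \max_j (lm t).2 j)%N.
pose a t j : int := ((lm t).1 *m A) 0 j.
pose C := (\sum_(t : {set 'I_n}) \sum_j `|a t j| * N)%N.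
pose cs := [seq i%:Z - C%:Z | i <- iota 0 (C + C).+1].
exists [seq x <- [seq ((lm t).1, c) | t <- enum {: {set 'I_n}}, c <- cs] | x.1 != 0]; split.
  by move=> b; rewrite mem_filter => /andP[].
move=> k Hk; pose t := [set j | (N <= k j)%N].
case: (lmP t) => [[l0 lt]|[[k' [w Hw]] out]]; last first.
  have le : ((lm t).2 <= k)%MM.
    apply/mnm_lepP => j; have [jt|/out -> //] := boolP (j \in t).
    move: jt; rewrite inE; apply: leq_trans.
    by apply: leq_trans (leq_bigmax t); exact: (leq_bigmax (F := fun j => (lm t).2 j) j).
  exfalso; apply: (Hk (k' + (k - (lm t).2))%MM w).
  rewrite -Hw mcolD mcolB //; apply/colP => i; rewrite !mxE; ring.
pose c := pairing A (lm t).1 (mcol k).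
have cC : (`|c| <= C)%N.
  have -> : c = \sum_j a t j * (k j)%:Z.
    by rewrite /c /pairing mulmxA mxE; apply: eq_bigr => j _; rewrite [mcol _ _ _]mxE.
  apply: (@leq_trans (\sum_j `|a t j| * N)%N); last first.
    by rewrite /C (bigD1 t) //= leq_addr.
  elim/big_ind2 : _ => [|x1 x2 y1 y2 h1 h2|j _]; first by rewrite absz0.
    apply: leq_trans (leq_add h1 h2); rewrite -lez_nat PoszD !abszE; exact: ler_normD.
  rewrite abszM absz_nat; have [jt|jt] := boolP (j \in t).
    by rewrite /a lt // absz0 !mul0n.
  by rewrite leq_mul2l; move: jt; rewrite inE -ltnNge => /ltnW ->; rewrite orbT.
exists ((lm t).1, c) => //; rewrite mem_filter l0 andTb.
apply/allpairsP; exists (t, c); split => //; first by rewrite mem_enum.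
apply/mapP; exists (absz (c + C%:Z)); last first.
  by rewrite gez0_abs ?addrK //; move: cC; lia.
by rewrite mem_iota; move: cC; lia.
Qed.

End IntegerLinearAlgebra.

(** * Countable unions of complex hyperplanes *)

Section NullSets.
Variables (R : realType) (d : nat).
Local Notation C := R[i].
Local Notation V := ('I_d -> C).
Implicit Types (E : V -> Prop) (z c : V) (r : R).

Definition cube c r z := forall l, `|complex.Re (z l - c l)| < r /\ `|complex.Im (z l - c l)| < r.

(** Unlike in [nullset], radii are real and may vanish, which permits padding a finite family to a
    sequence, and the volume bound is not strict. *)
Definition null_cover E := forall e : R, 0 < e -> exists (c : nat -> V) (r : nat -> R),
  [/\ forall k, 0 <= r k, forall z, E z -> exists k, cube (c k) (r k) z
    & forall N, \sum_(k < N) (2 * r k) ^+ (2 * d) <= e].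

Lemma sum_half_pow (e : R) N : \sum_(k < N) e / 2 ^+ k.+1 = e - e / 2 ^+ N.
Proof.
elim: N => [|N IH]; first by rewrite big_ord0 expr0 divr1 subrr.
rewrite big_ord_recr /= IH exprS; field.
by rewrite expf_neq0 ?pnatr_eq0.
Qed.

Lemma sum_half_pow_le (e : R) N : 0 < e -> \sum_(k < N) e / 2 ^+ k.+1 <= e.
Proof.
by move=> e0; rewrite sum_half_pow gerBl divr_ge0 ?exprn_ge0 // ltW.
Qed.

(** A cube of radius 0 is empty, so it may be replaced by any small one; geometric weights keep the
    added volume within e / 4. *)
Lemma null_cover_nullset E : (0 < d)%N -> null_cover E -> nullset E.
Proof.
move=> d0 H _ /gt0c[e e0 ->]; have e4 : 0 < e / 4 by lra.
have [c [r [r0 cov sm]]] := H _ e4.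
pose t k := Num.min 1 (e / 4 / 2 ^+ k.+1).
have t0 k : 0 < t k by rewrite lt_min ltr01 !divr_gt0 // exprn_gt0.
have t1 k : t k <= 1 by rewrite ge_min lexx.
have t2 k : t k <= e / 4 / 2 ^+ k.+1 by rewrite ge_min lexx orbT.
pose r' k := if r k == 0 then t k / 2 else r k.
exists c, (fun k => (r' k)%:C%C); split.
- move=> k; rewrite ltcR /r'; case: eqP => [_|/eqP rk]; first by rewrite divr_gt0.
  by rewrite lt_neqAle eq_sym rk r0.
- move=> z /cov[k Hk]; exists k => l; have [h1 h2] := Hk l.
  rewrite -complexRe -complexIm !norm_ltc !cabsR /r'.
  by case: eqP h1 h2 => // -> h1 h2; have := normr_ge0 (complex.Re (z l - c k l)); lra.
move=> N.
have -> : \sum_(k < N) (2 * (r' k)%:C%C) ^+ (2 * d) = (\sum_(k < N) (2 * r' k) ^+ (2 * d))%:C%C :> C.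
  by rewrite rmorph_sum; apply: eq_bigr => k _; rewrite rmorphXn rmorphM /= rmorph_nat.
rewrite ltcR; apply: (@le_lt_trans _ _ (e / 4 + e / 4)); last by lra.
apply: le_trans (lerD (sm N) (sum_half_pow_le N e4)); rewrite -big_split; apply: ler_sum => k _ /=.
rewrite /r'; case: eqP => [->|_]; last first.
  by rewrite lerDl divr_ge0 ?exprn_ge0 // ltW.
rewrite mulr0 expr0n muln_eq0 /= eqn0Ngt d0 add0r mulrC divfK ?pnatr_eq0 //.
apply: le_trans (t2 k); rewrite -[leRHS]expr1; apply: ler_wiXn2l; [exact: ltW|exact: t1|].
by rewrite muln_gt0.
Qed.

(** The bijection from N to pairs (i, j) given by k + 1 = 2^i (2 j + 1). *)
Definition split2 (k : nat) : nat * nat :=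
  (logn 2 k.+1, (k.+1 %/ 2 ^ logn 2 k.+1)./2).

Lemma split2K k : k.+1 = (2 ^ (split2 k).1 * (split2 k).2.*2.+1)%N.
Proof.
rewrite /split2 /=; set i := logn 2 k.+1.
have dv : (2 ^ i %| k.+1)%N by rewrite pfactor_dvdn.
have := odd_double_half (k.+1 %/ 2 ^ i).
have -> : odd (k.+1 %/ 2 ^ i).
  apply/negPn/negP => ev; have : (2 ^ i.+1 %| k.+1)%N.
    by rewrite -(divnK dv) expnS dvdn_mul // dvdn2.
  by rewrite pfactor_dvdn // ltnn.
by rewrite add1n => ->; rewrite mulnC divnK.
Qed.

Lemma split2_surj i j : exists k, split2 k = (i, j).
Proof.
exists (2 ^ i * j.*2.+1).-1; rewrite /split2 prednK ?muln_gt0 ?expn_gt0 //.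
have -> : logn 2 (2 ^ i * j.*2.+1) = i.
  rewrite lognM ?expn_gt0 // pfactorK // lognE /= [(2 %| _)%N]dvdn2 /= odd_double /= addn0 //.
by rewrite mulKn ?expn_gt0 //= uphalf_double.
Qed.

(** The first N cubes of the merged sequence belong to distinct pairs in an N by N square, so the
    row bounds e / 2^(i + 1) control their volume. *)
Lemma null_cover_bigcup (F : nat -> V -> Prop) : (forall i, null_cover (F i)) ->
  null_cover (fun z => exists i, F i z).
Proof.
move=> H e e0.
have ei i : 0 < e / 2 ^+ i.+1 by rewrite divr_gt0 // exprn_gt0.
have {}H i : exists cr : (nat -> V) * (nat -> R),
    [/\ forall k, 0 <= cr.2 k, forall z, F i z -> exists k, cube (cr.1 k) (cr.2 k) z
    & forall N, \sum_(k < N) (2 * cr.2 k) ^+ (2 * d) <= e / 2 ^+ i.+1].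
  by have [c [r hcr]] := H i _ (ei i); exists (c, r).
have {H} [cr crP] := boolp.choice H.
exists (fun k => (cr (split2 k).1).1 (split2 k).2), (fun k => (cr (split2 k).1).2 (split2 k).2).
split.
- by move=> k; case: (crP (split2 k).1).
- move=> z [i Fi]; case: (crP i) => _ /(_ z Fi)[j Hj] _.
  by have [k kij] := split2_surj i j; exists k; rewrite kij.
move=> N; pose G (p : 'I_N * 'I_N) : R := (2 * (cr p.1).2 p.2) ^+ (2 * d).
have b1 (k : 'I_N) : ((split2 k).1 < N)%N.
  apply: leq_ltn_trans (ltn_ord k); rewrite -ltnS (split2K k).
  by apply: leq_trans (ltn_expl _ (isT : (1 < 2)%N)) _; rewrite leq_pmulr.
have b2 (k : 'I_N) : ((split2 k).2 < N)%N.
  apply: leq_ltn_trans (ltn_ord k); rewrite -ltnS (split2K k).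
  by apply: (@leq_trans (split2 k).2.*2.+1); [rewrite ltnS -addnn leq_addr|rewrite leq_pmull ?expn_gt0].
pose g (k : 'I_N) := (Ordinal (b1 k), Ordinal (b2 k)).
have ginj : injective g.
  move=> k k' /(congr1 (fun p : 'I_N * 'I_N => (val p.1, val p.2))) e1.
  have {}e1 : split2 k = split2 k' := e1.
  by apply/val_inj/succn_inj; rewrite /= (split2K k) e1 -split2K.
have G0 p : 0 <= G p.
  by rewrite exprn_ge0 // mulr_ge0 //; case: (crP p.1).
have -> : \sum_(k < N) (2 * (cr (split2 k).1).2 (split2 k).2) ^+ (2 * d) = \sum_(p in [set g k | k : 'I_N]) G p.
  rewrite big_imset /=; last by move=> k k' _ _; exact: ginj.
  by apply: eq_bigl => k; rewrite inE.
apply: (@le_trans _ _ (\sum_p G p)).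
  rewrite [leRHS](bigID (fun p => p \in [set g k | k : 'I_N])) /= lerDl.
  by apply: sumr_ge0 => p _; exact: G0.
rewrite -(pair_bigA _ (fun i j => G (i, j))) /=.
apply: le_trans (sum_half_pow_le N e0); apply: ler_sum => i _.
by case: (crP i) => _ _; apply.
Qed.

Lemma null_cover_sub E E' : (forall z, E z -> E' z) -> null_cover E' -> null_cover E.
Proof.
move=> EE H e /H[c [r [r0 cov sm]]]; exists c, r; split => // z /EE; exact: cov.
Qed.

Lemma null_cover_finite E : (0 < d)%N -> (forall e : R, 0 < e -> exists (T : finType) (c : T -> V) (r : R),
  [/\ 0 <= r, forall z, E z -> exists t, cube (c t) r z & (2 * r) ^+ (2 * d) *+ #|T| <= e]) ->
  null_cover E.
Proof.
move=> d0 H e /H[T [c [r [r0 cov sm]]]].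
pose c' k := if (insub k : option 'I_#|T|) is Some i then c (enum_val i) else 0.
pose r' k := if (k < #|T|)%N then r else 0.
exists c', r'; split.
- by move=> k; rewrite /r'; case: ifP.
- move=> z /cov[t Ht]; exists (enum_rank t : 'I_#|T|) => l.
  by rewrite /c' /r' ltn_ord insubT // => Hl; rewrite (_ : Sub _ _ = enum_rank t) ?enum_rankK //; exact: val_inj.
move=> N; apply: le_trans sm.
have dd : (2 * d == 0)%N = false by rewrite muln_eq0 /= eqn0Ngt d0.
have q0 : 0 <= (2 * r) ^+ (2 * d) by rewrite exprn_ge0 // mulr_ge0.
apply: (@le_trans _ _ (\sum_(0 <= k < N + #|T|) (2 * r' k) ^+ (2 * d))).
  rewrite -(big_mkord xpredT (fun k => (2 * r' k) ^+ (2 * d))) [leRHS](@big_cat_nat _ _ _ N) ?leq_addr //= lerDl.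
  by apply: sumr_ge0 => k _; rewrite /r'; case: ifP => // _; rewrite mulr0 expr0n dd.
rewrite (@big_cat_nat _ _ _ #|T|) ?leq_addl //=.
rewrite [X in _ + X]big_nat_cond [X in _ + X]big1 ?addr0; last first.
  by move=> k /andP[/andP[kT _] _]; rewrite /r' ltnNge kT /= mulr0 expr0n dd.
rewrite big_mkord (eq_bigr (fun=> (2 * r) ^+ (2 * d))); last by move=> k _; rewrite /r' ltn_ord.
by rewrite sumr_const card_ord.
Qed.

(** The interval is widened from N to N + 1 so that the cell index stays below [M] even at the
    endpoint x = N. *)
Lemma grid_point (N M : nat) (x : R) : (0 < M)%N -> `|x| <= N%:R ->
  exists k : 'I_M, `|x - (- (N%:R + 1) + (2 * k%:R + 1) * ((N%:R + 1) / M%:R))| <= (N%:R + 1) / M%:R.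
Proof.
move=> M0 xN; set h := (_ / M%:R).
have MR : 0 < M%:R :> R by rewrite ltr0n.
have N0 : 0 <= N%:R :> R by rewrite ler0n.
have h0 : 0 < h by rewrite divr_gt0 //; lra.
have hM : h * M%:R = N%:R + 1 by rewrite /h divfK // gt_eqF.
have {xN} [x1 x2] : - N%:R <= x /\ x <= N%:R by move: xN; rewrite ler_norml; lra.
pose y := (x + (N%:R + 1)) / (2 * h).
have yE : y * (2 * h) = x + (N%:R + 1) by rewrite /y divfK // gt_eqF //; lra.
have y0 : 0 <= y by rewrite divr_ge0 //; lra.
have /andP[k1 k2] := Num.Theory.truncn_itv y0.
have kM : (Num.truncn y < M)%N.
  rewrite -(ltr_nat R); apply: le_lt_trans k1 _.
  rewrite -(ltr_pM2r (_ : 0 < 2 * h)); last by lra.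
  rewrite yE; lra.
exists (Ordinal kM); rewrite /= ler_norml.
rewrite -(ler_pM2r (_ : 0 < 2 * h)) in k1; last by lra.
rewrite -(ltr_pM2r (_ : 0 < 2 * h)) in k2; last by lra.
have e1 : (Num.truncn y).+1%:R = (Num.truncn y)%:R + 1 :> R by rewrite natr1.
rewrite e1 in k2.
rewrite yE in k1 k2; lra.
Qed.

(** The equation is solved for a coordinate p with l_p nonzero, while the others run through a grid
    of mesh of order 1 / M: M^(2 (d - 1)) cubes of volume of order M^(-2 d) have total volume of
    order M^(-2). *)
Lemma null_hyperplane_piece (l : 'rV[int]_d) (c : int) (N : nat) : l != 0 ->
  null_cover (fun beta => affine_form beta l c = 0 /\
    forall i, `|complex.Re (beta i)| <= N%:R /\ `|complex.Im (beta i)| <= N%:R).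
Proof.
move=> l0.
have [p lp] : exists p, l 0 p != 0.
  apply/existsP; apply: contraNT l0; rewrite negb_exists => /forallP H.
  by apply/eqP/rowP => i; rewrite mxE; apply/eqP; have := H i; rewrite negbK.
have d0 : (0 < d)%N by apply: leq_ltn_trans (ltn_ord p).
apply: null_cover_finite => // e e0.
pose Lam : R := \sum_i `|(l 0 i)%:~R|.
have Lam0 : 0 <= Lam by apply: sumr_ge0.
pose K : R := (2 * ((2 * Lam + 2) * (N%:R + 1))) ^+ (2 * d).
have N0 : 0 <= N%:R :> R by rewrite ler0n.
have K0 : 0 <= K by rewrite exprn_ge0 //; nra.
have [M M0 KM] : exists2 M : nat, (0 < M)%N & K <= e * M%:R.
  exists (Num.bound (K / e)).+1 => //.
  rewrite -ler_pdivrMl // mulrC; apply: ltW.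
  apply: lt_trans (_ : (Num.bound (K / e))%:R < _); last by rewrite ltr_nat.
  by apply: archi_boundP; rewrite divr_ge0 // ltW.
have MR : 0 < M%:R :> R by rewrite ltr0n.
pose h : R := (N%:R + 1) / M%:R.
have h0 : 0 < h by rewrite divr_gt0 //; lra.
pose a (k : 'I_M) : R := - (N%:R + 1) + (2 * k%:R + 1) * h.
pose T := {ffun 'I_d.-1 -> 'I_M * 'I_M}.
pose ctr (t : T) i : C := if unlift p i is Some k then (a (t k).1 +i* a (t k).2)%C else 0.
(* Coordinate p of the centre is computed from the equation; as |l_p| >= 1, it is off by at most 2
   Lam h, which explains the radius. *)
pose cen (t : T) i : C := if i == p then
  (c%:~R - \sum_(i | i != p) (l 0 i)%:~R * ctr t i) / (l 0 p)%:~R else ctr t i.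
exists T, cen, ((2 * Lam + 2) * h); split.
- by nra.
- move=> beta [fb bN].
  have cell i : exists g : 'I_M * 'I_M,
      `|complex.Re (beta i) - a g.1| <= h /\ `|complex.Im (beta i) - a g.2| <= h.
    have [k1 h1] := grid_point M0 (bN i).1; have [k2 h2] := grid_point M0 (bN i).2.
    by exists (k1, k2).
  have [g gP] := boolp.choice cell.
  pose t : T := [ffun k => g (lift p k)].
  have ctrE i : i != p -> ctr t i = (a (g i).1 +i* a (g i).2)%C.
    rewrite eq_sym => ip; have [k ik kE] := unlift_some ip.
    by rewrite /ctr kE /t ffunE -ik.
  have close i : i != p -> `|complex.Re (beta i - ctr t i)| <= h /\
      `|complex.Im (beta i - ctr t i)| <= h.
    by move=> ip; rewrite ctrE // !ReImE /=; exact: gP.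
  exists t => i; rewrite /cen; have [->|ip] := eqVneq i p; last first.
    have [h1 h2] := close i ip; nra.
  have lpC : (l 0 p)%:~R != 0 :> C by rewrite intr_eq0.
  set x := (_ - _).
  have xE : (l 0 p)%:~R * x = - \sum_(i | i != p) (l 0 i)%:~R * (beta i - ctr t i).
    have -> : \sum_(i | i != p) (l 0 i)%:~R * (beta i - ctr t i) =
      \sum_(i | i != p) (l 0 i)%:~R * beta i - \sum_(i | i != p) (l 0 i)%:~R * ctr t i.
      by rewrite -sumrB; apply: eq_bigr => k _; rewrite mulrBr.
    move: fb; rewrite /affine_form (bigD1 p) //=; set S1 := \sum_(_ | _) _ => fb.
    rewrite /x mulrBr [X in _ - X]mulrC divfK //.
    have -> : (l 0 p)%:~R * beta p = c%:~R - S1.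
      by apply/eqP; rewrite -subr_eq0; apply/eqP; rewrite -[RHS]fb; ring.
    by ring.
  have x1 : cabs x <= 2 * Lam * h.
    have c1 : 1 <= cabs ((l 0 p)%:~R : C).
      have -> : (l 0 p)%:~R = ((l 0 p)%:~R : R)%:C%C :> C by rewrite rmorph_int.
      rewrite cabsR -intr_norm -[1]/(1%:~R) ler_int.
      by rewrite -gtz0_ge1 normr_gt0.
    have : cabs x <= cabs ((l 0 p)%:~R * x).
      by rewrite cabsM ler_peMl // cabs_ge0.
    move=> /le_trans; apply; rewrite xE cabsN.
    apply: (@le_trans _ _ (\sum_(i | i != p) `|(l 0 i)%:~R| * (2 * h))); last first.
      rewrite -mulr_suml [2 * Lam]mulrC -mulrA; apply: ler_wpM2r; first by lra.
      by rewrite /Lam [leRHS](bigD1 p) //= lerDr.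
    elim/big_ind2 : _ => [|x1 x2 y1 y2 b1 b2|k kp]; rewrite ?cabs0 //.
      by apply: le_trans (cabsD _ _) _; apply: lerD.
    rewrite cabsM; apply: ler_pM; rewrite ?cabs_ge0 //.
      have -> : (l 0 k)%:~R = ((l 0 k)%:~R : R)%:C%C :> C by rewrite rmorph_int.
      by rewrite cabsR.
    by apply: le_trans (cabs_le_ReIm _) _; have [] := close k kp; lra.
  have := cabs_Re x; have := cabs_Im x; nra.
rewrite /T card_ffun card_prod !card_ord.
have -> : 2 * ((2 * Lam + 2) * h) = 2 * ((2 * Lam + 2) * (N%:R + 1)) / M%:R.
  by rewrite /h; field; rewrite gt_eqF.
rewrite expr_div_n -/K -mulr_natr natrX natrM.
have -> : (2 * d = 2 + 2 * d.-1)%N by rewrite -{1}(prednK d0); lia.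
rewrite exprD -expr2 -exprM.
set Q := M%:R ^+ (2 * d.-1).
have Q0 : Q != 0 by rewrite expf_neq0 // gt_eqF.
have -> : K / (M%:R ^+ 2 * Q) * Q = K / M%:R ^+ 2 by field; rewrite Q0 gt_eqF.
rewrite ler_pdivrMr ?exprn_gt0 //; apply: le_trans KM _.
apply: ler_wpM2l; first exact: ltW.
by rewrite expr2; apply: ler_peMl; rewrite ?ler1n ?ler0n.
Qed.

Lemma null_cover_False : (0 < d)%N -> null_cover (fun _ => False).
Proof.
move=> d0 e e0; exists (fun _ => 0), (fun _ => 0); split => // N.
by rewrite big1 ?ltW // => i _; rewrite mulr0 expr0n muln_eq0 /= eqn0Ngt d0.
Qed.

(** Bounding beta by N cuts each hyperplane into countably many pieces, and [unpickle] enumerates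
    the triples (l, c, N). *)
Lemma null_forms : (0 < d)%N -> null_cover (fun beta => exists (l : 'rV[int]_d) (c : int), l != 0 /\ affine_form beta l c = 0).
Proof.
move=> d0; pose F (k : nat) (beta : V) :=
  if (unpickle k : option ('rV[int]_d * int * nat)) is Some (l, c, N) then
  l != 0 /\ affine_form beta l c = 0 /\
    forall i, `|complex.Re (beta i)| <= N%:R /\ `|complex.Im (beta i)| <= N%:R
  else False.
apply: (@null_cover_sub _ (fun beta => exists k : nat, F k beta)).
  move=> beta [l [c [l0 fb]]].
  pose S : R := \sum_i cabs (beta i).
  pose N := Num.bound S.
  have S0 : 0 <= S by apply: sumr_ge0 => i _; exact: cabs_ge0.
  exists (pickle (l, c, N)); rewrite /F pickleK; split => //; split => // i.
  have b : cabs (beta i) <= N%:R.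
    apply: le_trans (ltW (archi_boundP S0)).
    by rewrite /S (bigD1 i) //= lerDl; apply: sumr_ge0 => k _; exact: cabs_ge0.
  by split; apply: le_trans b; [exact: cabs_Re|exact: cabs_Im].
apply: null_cover_bigcup => k; rewrite /F.
case: unpickle => [[[l c] N]|]; last exact: null_cover_False.
have [->|l0] := eqVneq l 0.
  by apply: null_cover_sub (null_cover_False d0) => z [].
by apply: null_cover_sub (null_hyperplane_piece c N l0) => z [].
Qed.

End NullSets.

(** * Separating the characters *)

Section PrimitiveRoots.
Variable R : realType.

(** X^N - 1 splits into distinct linear factors, and a full set of N-th roots of unity contains a
    primitive one. *)
Lemma prim_root_exists (N : nat) : (0 < N)%N -> exists z : R[i], N.-primitive_root z.
Proof.
move=> N0; pose p : {poly R[i]} := 'X^N - 1.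
have [r Dp] := closed_field_poly_normal p.
have mp : p \is monic by rewrite /p monicXnsubC.
move: Dp; rewrite (monicP mp) scale1r => Dp.
have sr : size r = N.
  by apply: succn_inj; rewrite -(size_XnsubC (1 : R[i]) N0) -[in RHS]/p Dp size_prod_XsubC.
have : has N.-primitive_root r.
  apply: has_prim_root => //; last by rewrite sr.
    by apply/allP => x xr; rewrite /root_of_unity -polyC1 -/p Dp root_prod_XsubC.
  rewrite -separable_prod_XsubC -Dp /p separable_Xn_sub_1 // pnatr_eq0 -lt0n //.
by move=> /hasP[z _ Hz]; exists z.
Qed.

End PrimitiveRoots.

(** * Lattice ideals and separating polynomials *)

Section LatticeIdeals.
Variables (R : realType) (d n : nat) (A : 'M[int]_(d, n)).
Local Notation C := R[i].
Implicit Types (p q : {mpoly C[n]}) (rho : 'cV[int]_n -> C) (u : 'cV[int]_n).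

Lemma mcol_pos_neg u : mcol (posm u) - mcol (negm u) = u.
Proof.
apply/colP => i; rewrite !mxE !mnmE.
case: (lerP 0 (u i 0)) => h.
  have -> : Num.max (- u i 0) 0 = 0 by rewrite max_r // oppr_le0.
  by rewrite absz0 subr0 gez0_abs.
have -> : Num.max (- u i 0) 0 = - u i 0 by rewrite max_l // oppr_ge0 ltW.
by rewrite absz0 sub0r gez0_abs ?opprK // oppr_ge0 ltW.
Qed.

(** The common factor is the minimum of m and k; it turns d^m - c d^k into a monomial times a
    binomial for m - k. *)
Lemma posm_negm_split m k :
  exists r : 'X_{1..n}, m = (r + posm (mcol m - mcol k))%MM /\ k = (r + negm (mcol m - mcol k))%MM.
Proof.
exists [multinom minn (m i) (k i) | i < n]; split; apply/mnmP => i;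
  rewrite mnmDE !mnmE !mxE; case: (leqP (m i) (k i)) => h.
- have -> : Num.max ((m i)%:Z - (k i)%:Z) 0 = 0 by rewrite max_r //; lia.
  by rewrite absz0 addn0.
- have -> : Num.max ((m i)%:Z - (k i)%:Z) 0 = (m i)%:Z - (k i)%:Z by rewrite max_l //; lia.
  lia.
- have -> : Num.max (- ((m i)%:Z - (k i)%:Z)) 0 = (k i)%:Z - (m i)%:Z by rewrite max_l //; lia.
  lia.
- have -> : Num.max (- ((m i)%:Z - (k i)%:Z)) 0 = 0 by rewrite max_r //; lia.
  by rewrite absz0 addn0.
Qed.

Lemma in_Irho_gen rho u p : inL A u -> in_Irho A rho (p * binom (rho u) u).
Proof. by move=> Hu; exists [:: (p, u)]; split; [move=> q /[!inE] /eqP ->|rewrite big_seq1]. Qed.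

Lemma in_Irho0 rho : in_Irho A rho 0.
Proof. by exists [::]; split => //; rewrite big_nil. Qed.

Lemma in_IrhoD rho p q : in_Irho A rho p -> in_Irho A rho q -> in_Irho A rho (p + q).
Proof.
move=> [s [Hs ->]] [t [Ht ->]]; exists (s ++ t); split; last by rewrite big_cat.
by move=> x; rewrite mem_cat => /orP[/Hs|/Ht].
Qed.

Lemma in_IrhoM rho p q : in_Irho A rho q -> in_Irho A rho (p * q).
Proof.
move=> [s [Hs ->]]; exists [seq (p * x.1, x.2) | x <- s]; split.
  by move=> x /mapP[y /Hs Hy ->].
by rewrite big_map mulr_sumr; apply: eq_bigr => x _; rewrite mulrA.
Qed.

Lemma in_IrhoZ rho (c : C) q : in_Irho A rho q -> in_Irho A rho (c *: q).
Proof. by move=> /(in_IrhoM c%:MP); rewrite mul_mpolyC. Qed.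

Lemma in_Irho_sum (I : finType) (Q : pred I) rho (F : I -> {mpoly C[n]}) :
  (forall i, Q i -> in_Irho A rho (F i)) -> in_Irho A rho (\sum_(i | Q i) F i).
Proof.
move=> H; elim/big_ind : _ => //; first exact: in_Irho0.
by move=> x y; exact: in_IrhoD.
Qed.

(* p is A-homogeneous of the degree of x^m and congruent to x^m modulo I_rho *)
Definition monomial_like rho p (m : 'X_{1..n}) :=
  (forall k, k \in msupp p -> A *m mcol k = A *m mcol m) /\ in_Irho A rho (p - 'X_[m]).

Lemma monomial_likeX rho m : monomial_like rho 'X_[m] m.
Proof.
split; last by rewrite subrr; exact: in_Irho0.
by move=> k; rewrite msuppX inE => /eqP ->.
Qed.

Lemma monomial_likeM rho p q m k : monomial_like rho p m -> monomial_like rho q k ->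
  monomial_like rho (p * q) (m + k)%MM.
Proof.
move=> [p1 p2] [q1 q2]; split.
  move=> l /msuppM_le/allpairsP[[x y] /= [/p1 Hx /q1 Hy ->]].
  by rewrite !mcolD !mulmxDr Hx Hy.
rewrite mpolyXD.
have -> : p * q - 'X_[m] * 'X_[k] = q * (p - 'X_[m]) + 'X_[m] * (q - 'X_[k]) by ring.
by apply: in_IrhoD; exact: in_IrhoM.
Qed.

(** An interpolation factor: for u in L and c different from c', it lies in I_rho if rho(u) = c',
    and is congruent to d^(u_-) modulo I_rho if rho(u) = c. *)
Definition separator (c c' : C) u : {mpoly C[n]} := (c - c')^-1 *: binom c' u.

Lemma separator_in rho (c : C) u : inL A u -> in_Irho A rho (separator c (rho u) u).
Proof.
move=> Hu; apply: in_IrhoZ; rewrite -[binom _ _]mul1r; exact: in_Irho_gen.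
Qed.

Lemma separator_monomial rho (c' : C) u : inL A u -> rho u != c' ->
  monomial_like rho (separator (rho u) c' u) (negm u).
Proof.
move=> Hu cc.
have pn : A *m mcol (posm u) = A *m mcol (negm u).
  by apply/eqP; rewrite -subr_eq0 -mulmxBr mcol_pos_neg Hu.
split.
  move=> k /msuppZ_le /msuppB_le; rewrite mem_cat => /orP[|/msuppZ_le].
    by rewrite msuppX inE => /eqP ->.
  by rewrite msuppX inE => /eqP ->.
have -> : separator (rho u) c' u - 'X_[negm u] = (rho u - c')^-1 *: (1 * binom (rho u) u).
  rewrite mul1r /separator /binom.
  have {2}-> : 'X_[negm u] = (rho u - c')^-1 *: ((rho u - c') *: 'X_[negm u]) :> {mpoly C[n]}.
    by rewrite scalerA mulVf ?scale1r // subr_eq0.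
  by rewrite -scalerBr scalerBl; congr (_ *: _); rewrite opprB addrA subrK.
by apply: in_IrhoZ; exact: in_Irho_gen.
Qed.

Variables (V : lmodType C) (D X : 'I_n -> {linear V -> V}).
Hypothesis DC : forall i j v, D i (D j v) = D j (D i v).
Hypothesis XC : forall i j v, X i (X j v) = X j (X i v).
Hypothesis DX : forall i j v, D j (X i v) = (i == j)%:R *: v + X i (D j v).

Lemma act_binom (c : C) u v :
  act D (binom c u) v = opm D (posm u) v - c *: opm D (negm u) v.
Proof. by rewrite /act /binom linearB linearZ /= !mlinX. Qed.

Lemma act0 p : act D p 0 = 0.
Proof. by rewrite /act /mlin big1 // => m _; rewrite linear0 scaler0. Qed.

Lemma act_split (c : C) u v (m k : 'X_{1..n}) : mcol m - mcol k = u ->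
  act D (binom c u) v = 0 -> opm D m v = c *: opm D k v.
Proof.
move=> mk; rewrite act_binom => /eqP; rewrite subr_eq0 => /eqP H.
have [r [em ek]] := posm_negm_split m k; rewrite mk in em ek.
by rewrite em ek !(opmDD DC) H linearZ.
Qed.

Lemma char_eigenP rho v :
  (forall p, in_Irho A rho p -> act D p v = 0) <-> char_eigen D A rho v.
Proof.
split=> H.
  move=> m k Hmk; apply: (act_split erefl); apply: H.
  by rewrite -[binom _ _]mul1r; exact: in_Irho_gen.
move=> p [s [Hs ->]]; rewrite /act linear_sum big1_seq //= => -[q u] /Hs /= Hu.
change (act D (q * binom (rho u) u) v = 0); rewrite (actM DC) act_binom.
have := H (posm u) (negm u); rewrite mcol_pos_neg => /(_ Hu) ->.
by rewrite subrr act0.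
Qed.

Variables (mB : nat) (B : 'M[int]_(n, mB)).
Hypothesis AB : A *m B = 0.

(** What [eigen_decomposition] requires of the polynomials; it is supplied both for a given list of
    characters and for I_B. *)
Definition separating_data (I : finType) (P : I -> {mpoly C[n]}) (rho : I -> 'cV[int]_n -> C)
    (alpha : 'X_{1..n}) (f : V) :=
  [/\ forall i m, m \in msupp (P i) -> A *m mcol m = A *m mcol alpha,
      \sum_i act D (P i) f = opm D alpha f
    & forall i, char_eigen D A (rho i) (act D (P i) f)].

(** As in Lagrange interpolation, the product of the separators of rho_i from the other rho_j lies
    in every I_rho_j with j different from i and is congruent to a monomial modulo I_rho_i. Hence
    P_i I_rho_i is contained in I_J. *)
Lemma separate_characters (I : finType) (rho : I -> 'cV[int]_n -> C) :
  (forall i j, i != j -> exists u, inL A u /\ rho i u != rho j u) ->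
  exists (P : I -> {mpoly C[n]}) alpha, forall f : V,
    (forall p, (forall i, in_Irho A (rho i) p) -> act D p f = 0) ->
    separating_data P rho alpha f.
Proof.
move=> H.
have {}H (ij : I * I) : exists u, ij.1 != ij.2 -> inL A u /\ rho ij.1 u != rho ij.2 u.
  have [e|/H[u Hu]] := eqVneq ij.1 ij.2; first by exists 0.
  by exists u.
have [u uP] := boolp.choice H.
pose al i := (\sum_(j | j != i) negm (u (i, j)))%MM.
pose alpha := (\sum_i al i)%MM.
pose Q i := \prod_(j | j != i) separator (rho i (u (i, j))) (rho j (u (i, j))) (u (i, j)).
(* The prefactor brings the various monomials d^(al i) to the common d^alpha. *)
pose P i := 'X_[(\sum_(j | j != i) al j)%MM] * Q i.
have PM i : monomial_like (rho i) (P i) alpha.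
  have -> : alpha = ((\sum_(j | j != i) al j) + al i)%MM.
    by rewrite /alpha (bigD1 i) //= addmC.
  apply: monomial_likeM; first exact: monomial_likeX.
  rewrite /Q /al; elim/big_rec2 : _ => [|j p m ji]; first by rewrite -mpolyX0; exact: monomial_likeX.
  move=> Hp; apply: monomial_likeM => //.
  by have [|h1 h2] := uP (i, j); [rewrite eq_sym|exact: separator_monomial].
have PI i j : j != i -> in_Irho A (rho j) (P i).
  move=> ji; apply: in_IrhoM; rewrite /Q (bigD1 j) //= mulrC; apply: in_IrhoM.
  by have [|h1 h2] := uP (i, j); [rewrite eq_sym|exact: separator_in].
exists P, alpha => f Hf; split.
- by move=> i; case: (PM i).
- apply/eqP; rewrite -subr_eq0; apply/eqP.
  have -> : \sum_i act D (P i) f - opm D alpha f = act D (\sum_i P i - 'X_[alpha]) f.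
    by rewrite /act linearB linear_sum /= mlinX.
  apply: Hf => j; rewrite (bigD1 j) //= addrAC; apply: in_IrhoD; first by case: (PM j).
  by apply: in_Irho_sum => i ij; apply: PI; rewrite eq_sym.
- move=> i; apply/char_eigenP => p Hp; rewrite -(actM DC); apply: Hf => j.
  have [->|ji] := eqVneq j i; first by rewrite mulrC; exact: in_IrhoM.
  by apply: in_IrhoM; exact: PI.
Qed.

(** * Characters of L trivial on L_B *)

Section AllCharacters.
Hypothesis dn : (d + mB = n)%N.
Hypothesis rankA : \rank (map_mx (intr : int -> rat) A) = d.
Hypothesis rankB : \rank (map_mx (intr : int -> rat) B) = mB.

Lemma inIB_shift f : (forall p, in_IB B p -> act D p f = 0) ->
  forall m k (w : 'cV[int]_mB), mcol m - mcol k = B *m w -> opm D m f = opm D k f.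
Proof.
move=> Hf m k w mk; rewrite -[RHS]scale1r; apply: (act_split mk); apply: Hf.
by exists [:: (1, w)]; rewrite big_seq1 mul1r.
Qed.

(* The characters of Z^n modulo N Z^n, restricted to L: averaging over L / N L
   gives the idempotents, and N is chosen so that N L is contained in L_B. *)
Lemma all_characters :
  exists (k : nat) (rho : 'I_k -> 'cV[int]_n -> C) (P : 'I_k -> {mpoly C[n]}) alpha,
    (forall i, is_GB_char A B (rho i)) /\
    forall f : V, (forall p, in_IB B p -> act D p f = 0) -> separating_data P rho alpha f.
Proof.
have [N N0 NB] := kernel_multiple dn rankA rankB AB.
have [z zP] := prim_root_exists R N0.
have z0 : z != 0.
  apply/eqP => e; have := prim_expr_order zP.
  by rewrite e expr0n eqn0Ngt N0 /= => /eqP; rewrite eq_sym oner_eq0.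
pose T := {ffun 'I_n -> 'I_N}.
pose wt (t : T) (u : 'cV[int]_n) : int := \sum_j (t j)%:Z * u j 0.
pose chi (t : T) (u : 'cV[int]_n) : C := z ^ wt t u.
have wtD t u v : wt t (u + v) = wt t u + wt t v.
  by rewrite /wt -big_split; apply: eq_bigr => j _; rewrite mxE mulrDr.
have chiD t u v : chi t (u + v) = chi t u * chi t v by rewrite /chi wtD expfzDr.
have chi0 t u : chi t u != 0 by rewrite expfz_neq0.
have zN (e : int) : z ^ (N%:Z * e) = 1 by rewrite -exprz_exp -exprnP prim_expr_order // exp1rz.
have chiN t e : chi t (N%:Z *: e) = 1.
  rewrite /chi (_ : wt _ _ = N%:Z * wt t e) ?zN // /wt mulr_sumr.
  by apply: eq_bigr => j _; rewrite mxE mulrCA.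
have modN (u : int) : (`|(u %% N%:Z)%Z|%N < N)%N.
  have NZ : N%:Z != 0 by rewrite eqz_nat -lt0n.
  by rewrite -ltz_nat gez0_abs ?modz_ge0 // ltz_pmod // ltz_nat.
pose cl (u : 'cV[int]_n) : T := [ffun j => Ordinal (modN (u j 0))].
have clP u v : cl u = cl v -> exists e, u - v = N%:Z *: e.
  move=> /ffunP H; exists (\col_j ((u j 0 - v j 0)%R %/ N%:Z)%Z); apply/colP => j; rewrite !mxE.
  have := congr1 val (H j); rewrite !ffunE /= => /(congr1 Posz).
  have NZ : N%:Z != 0 by rewrite eqz_nat -lt0n.
  rewrite !gez0_abs ?modz_ge0 // => /eqP; rewrite eqz_mod_dvd => /dvdzP[q ->].
  by rewrite mulzK // mulrC.
have clN u v e : u - v = N%:Z *: e -> cl u = cl v.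
  move=> H; apply/ffunP => j; apply/val_inj; rewrite !ffunE /=; congr absz; apply/eqP.
  rewrite eqz_mod_dvd; apply/dvdzP; exists (e j 0).
  by move/colP/(_ j): H; rewrite !mxE mulrC.
(* If N e lies in L then so does e, and then N e lies in L_B by the choice of N. *)
have LN u v : inL A u -> inL A v -> cl u = cl v -> exists w, u - v = B *m w.
  move=> Lu Lv /clP[e e1]; rewrite e1; apply: NB.
  have : N%:Z *: (A *m e) = 0 by rewrite scalemxAr -e1 mulmxBr Lu Lv subrr.
  by move/eqP; rewrite scalemx_eq0 eqz_nat eqn0Ngt N0 => /eqP.
have L0 : inL A (0 : 'cV[int]_n) by rewrite /inL mulmx0.
pose G := [set g : T | `[< exists u, inL A u /\ cl u = g >]].
have vecE (g : T) : exists u, g \in G -> inL A u /\ cl u = g.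
  have [|gG] := boolP (g \in G); last by exists 0.
  by rewrite inE => /asboolP[u Hu]; exists u.
have [vec vecP] := boolp.choice vecE.
have inG u : inL A u -> cl u \in G by move=> Hu; rewrite inE; apply/asboolP; exists u.
pose sg w g := cl (vec g + w).
have sgG w : inL A w -> sg w @: G = G.
  move=> Lw; apply/eqP; rewrite eqEcard card_in_imset ?leqnn ?andbT.
    by apply/fintype.subsetP => _ /imsetP[g /vecP[Lg _] ->]; apply: inG; exact: inLD.
  move=> g g' /vecP[_ e1] /vecP[_ e2] /clP[e]; rewrite opprD addrACA subrr addr0 => /clN.
  by rewrite e1 e2.
have sg_inj w : inL A w -> {in G &, injective (sg w)}.
  move=> Lw g g' /vecP[_ e1] /vecP[_ e2] /clP[e]; rewrite opprD addrACA subrr addr0 => /clN.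
  by rewrite e1 e2.
(* It dominates the negative parts of all representatives, so that every alpha0 + [vec g] is in
   N^n. *)
pose alpha0 : 'X_{1..n} := [multinom (\sum_(g : T) absz (vec g i 0%R))%N | i < n].
pose mg g : 'X_{1..n} := [multinom absz ((alpha0 i)%:Z + vec g i 0)%R | i < n].
have mgE g : mcol (mg g) = mcol alpha0 + vec g.
  apply/colP => i; rewrite !mxE mnmE gez0_abs // mnmE (bigD1 g) //=.
  by set x := vec g i 0; rewrite PoszD; lia.
pose P0 (t : T) : {mpoly C[n]} := (N ^ n)%:R^-1 *: \sum_(g in G) (chi t (vec g))^-1 *: 'X_[mg g].
have actP0 t f : act D (P0 t) f = (N ^ n)%:R^-1 *: \sum_(g in G) (chi t (vec g))^-1 *: opm D (mg g) f.
  rewrite /act linearZ linear_sum /=; congr (_ *: _); apply: eq_bigr => g _.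
  by rewrite linearZ /= mlinX.
have NnC : (N ^ n)%:R != 0 :> C by rewrite pnatr_eq0 expn_eq0 negb_and -lt0n N0.
(* The sum over the grid factors into one geometric sum per coordinate, each equal to N or 0. *)
have orth v : \sum_(t : T) (chi t v)^-1 = if [forall j, (N%:Z %| (v j 0)%R)%Z] then (N ^ n)%:R else 0.
  have -> : \sum_(t : T) (chi t v)^-1 = \prod_j \sum_(s < N) (z ^ (- v j 0)) ^+ s.
    rewrite bigA_distr_bigA; apply: eq_bigr => t _.
    rewrite /chi invr_expz -/(wt t v).
    have -> : - wt t v = \sum_j (- v j 0) * (t j)%:Z.
      by rewrite /wt -sumrN; apply: eq_bigr => j _; rewrite mulNr mulrC.
    elim/big_rec2 : _ => [|j y1 y2 _ IH]; first by rewrite expr0z.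
    by rewrite expfzDr // -IH exprnP exprz_exp.
  case: ifPn => [/forallP H|].
    rewrite (eq_bigr (fun=> N%:R)) ?prodr_const ?card_ord ?natrX // => j _.
    have /dvdzP[q vq] := H j.
    rewrite (eq_bigr (fun=> 1)) ?sumr_const ?card_ord // => s _.
    by rewrite vq -mulNr mulrC zN expr1n.
  rewrite negb_forall => /existsP[j nj]; rewrite (bigD1 j) //=.
  set y := z ^ _.
  have y1 : y != 1.
    apply: contraNneq nj => y1; rewrite -[v j 0]opprK dvdzE abszN -dvdzE.
    move: y1; rewrite /y; set e := - v j 0 => y1.
    have NZ : N%:Z != 0 by rewrite eqz_nat -lt0n.
    have : z ^+ absz (e %% N%:Z)%Z = 1.
      by rewrite exprnP gez0_abs ?modz_ge0 // /modz expfzDr // y1 mul1r -mulNr mulrC zN.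
    move=> /eqP; rewrite -(prim_order_dvd zP) => dv; apply/dvdz_mod0P/eqP.
    rewrite -absz_eq0 -leqn0 leqNgt; apply/negP => r0.
    by have := dvdn_leq r0 dv; rewrite leqNgt modN.
  have : y ^+ N = 1 by rewrite /y exprnP exprz_exp mulrC zN.
  move=> /eqP; rewrite -subr_eq0 subrX1 mulf_eq0 subr_eq0 (negbTE y1) /= => /eqP ->.
  by rewrite mul0r.
pose bas (j : 'I_mB) : 'cV[int]_n := B *m delta_mx j 0.
pose good := [set t : T | [forall j : 'I_mB, chi t (bas j) == 1]].
(* d^kappa removes the contributions of the characters that are not trivial on L_B. *)
pose kappa := (\sum_(j < mB) negm (bas j))%MM.
pose P t := 'X_[kappa] * P0 t.
(* Different [t] may restrict to the same character of L; this does no harm, since only the sum is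
   prescribed. *)
exists #|good|, (fun i => chi (enum_val i)), (fun i => P (enum_val i)), (kappa + alpha0)%MM.
split.
  move=> i; split => [u v _ _|u _|w]; [exact: chiD|exact: chi0|].
  have := enum_valP i; rewrite inE => /forallP H.
  have chiZ t u (c : int) : chi t (c *: u) = chi t u ^ c.
    rewrite /chi exprz_exp; congr (_ ^ _); rewrite /wt mulr_suml.
    by apply: eq_bigr => j _; rewrite mxE mulrCA mulrC.
  have -> : B *m w = \sum_j w j 0 *: bas j.
    rewrite {1}[w]matrix_sum_delta mulmx_sumr; apply: eq_bigr => j _.
    by rewrite big_ord1 scalemxAr.
  elim/big_rec : _ => [|j y _ IH]; first by rewrite /chi /wt big1 ?expr0z // => j _; rewrite mxE mulr0.
  by rewrite chiD IH mulr1 chiZ (eqP (H j)) exp1rz.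
move=> f fB; have fS := inIB_shift fB.
(* Replacing d^k by d^m translates the classes by w = m - k; reindexing the average by [sg w]
   produces the factor [chi t w]. *)
have eig t : char_eigen D A (chi t) (act D (P0 t) f).
  move=> m k Lmk; rewrite !actP0 linearZ [X in _ = _ *: X]linearZ /=.
  rewrite [RHS]scalerA [chi t _ * _]mulrC -[RHS]scalerA; congr (_ *: _).
  set w := mcol m - mcol k.
  rewrite -[in RHS](sgG w Lmk) big_imset /=; last exact: sg_inj.
  rewrite linear_sum [X in _ = _ *: X]linear_sum scaler_sumr; apply: eq_bigr => g gG.
  rewrite linearZ [X in _ = _ *: X]linearZ /= [RHS]scalerA.
  have [Lg cg] := vecP g gG; have Lgw := inLD Lg Lmk.
  have [Ls cs] := vecP _ (inG _ Lgw).
  have [b Hb] := LN _ _ Lgw Ls (esym cs).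
  have [e He] := clP _ _ cs.
  have -> : chi t (vec (sg w g)) = chi t (vec g) * chi t w.
    have -> : vec (sg w g) = N%:Z *: e + (vec g + w) by rewrite -He subrK.
    by rewrite chiD chiN mul1r chiD.
  rewrite invfM mulrCA mulfV // mulr1; congr (_ *: _).
  rewrite -!(opmDD DC); apply: (fS _ _ b); rewrite -Hb !mcolD !mgE.
  by apply/colP => i; rewrite !mxE; ring.
(* On this vector d^(b_+) acts both as d^(b_-), by periodicity of f along L_B, and as [chi t b]
   times d^(b_-), where [chi t b] is not 1. *)
have bad t : t \notin good -> opm D kappa (act D (P0 t) f) = 0.
  rewrite inE negb_forall => /existsP[j cj].
  set b := bas j in cj.
  have Lb : inL A (mcol (posm b) - mcol (negm b)).
    by rewrite mcol_pos_neg /inL /b /bas mulmxA AB mul0mx.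
  have := eig t _ _ Lb; rewrite mcol_pos_neg => e1.
  have e2 : opm D (posm b) (act D (P0 t) f) = opm D (negm b) (act D (P0 t) f).
    rewrite !actP0 [LHS]linearZ [RHS]linearZ /=; congr (_ *: _).
    rewrite [LHS]linear_sum [RHS]linear_sum; apply: eq_bigr => g _.
    rewrite [LHS]linearZ [RHS]linearZ /= -!(opmDD DC); congr (_ *: _); apply: (fS _ _ (delta_mx j 0)).
    by rewrite !mcolD opprD addrACA subrr addr0 mcol_pos_neg.
  have e3 : opm D (negm b) (act D (P0 t) f) = 0.
    move: e1; rewrite e2 -[LHS]scale1r => /eqP; rewrite -subr_eq0 -scalerBl scaler_eq0.
    by rewrite subr_eq0 eq_sym (negbTE cj) => /eqP.
  by rewrite /kappa (bigD1 j) //= addmC (opmDD DC) e3 linear0.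
have actP t : act D (P t) f = opm D kappa (act D (P0 t) f).
  by rewrite /P (actM DC) actX.
split.
- move=> i m /msuppM_le/allpairsP[[x y] /= [xk yP ->]].
  move: xk; rewrite msuppX inE => /eqP ->; rewrite !mcolD !mulmxDr; congr (_ + _).
  move: yP => /msuppZ_le /msupp_sum_le /flattenP[s /mapP[g]].
  rewrite mem_filter => /andP[gG _] -> /msuppZ_le; rewrite msuppX inE => /eqP ->.
  by rewrite mgE mulmxDr (vecP _ gG).1 addr0.
- rewrite -(big_enum_val (fun t => act D (P t) f)).
  have -> : \sum_(t in good) act D (P t) f = \sum_t act D (P t) f.
    rewrite [RHS](bigID (fun t => t \in good)) /= [X in _ = _ + X]big1 ?addr0 // => t tb.
    by rewrite actP bad.
  rewrite (eq_bigr _ (fun t _ => actP t)) -linear_sum (opmDD DC); congr (opm _ _ _).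
  rewrite (eq_bigr _ (fun t _ => actP0 t f)) -scaler_sumr exchange_big /=.
  rewrite (eq_bigr (fun g => (\sum_t (chi t (vec g))^-1) *: opm D (mg g) f)); last first.
    by move=> g _; rewrite scaler_suml.
  have g0G := inG _ L0.
  have vanish g : g \in G -> g != cl 0 -> \sum_t (chi t (vec g))^-1 = 0.
    move=> gG g0; rewrite orth ifF //; apply: contraNF g0 => /forallP H.
    have [_ <-] := vecP _ gG; apply/eqP.
    apply: (@clN _ _ (\col_j ((vec g j 0)%R %/ N%:Z)%Z)); apply/colP => j; rewrite !mxE subr0.
    by rewrite mulrC divzK.
  rewrite (bigD1 (cl 0) g0G) [X in _ *: (_ + X)]big1 ?addr0; last first.
    by move=> g gg; have [gG g0] := andP gg; rewrite vanish // scale0r.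
  have [Lg cg] := vecP _ g0G; have [e] := clP _ _ cg; rewrite subr0 => He.
  rewrite orth ifT; last by apply/forallP => j; rewrite He mxE dvdz_mulr.
  rewrite scalerA mulVf // scale1r.
  have [w] := LN _ _ Lg L0 cg; rewrite subr0 => Hw.
  by apply: (fS _ _ w); rewrite mgE addrAC subrr add0r.
- move=> i m k Lmk; rewrite actP -!(opmDD DC) !(addmC _ kappa) !(opmDD DC).
  by rewrite (eig _ _ _ Lmk) linearZ.
Qed.

End AllCharacters.

End LatticeIdeals.

(** * Solutions as a module over the Weyl algebra *)

Section Solutions.
Variables (R : realType) (d n : nat) (A : 'M[int]_(d, n)) (beta : 'I_d -> R[i]).
Variables (U : ('I_n -> R[i]) -> Prop) (Uopen : is_open U).
Local Notation C := R[i].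

Let Dl (j : 'I_n) : {linear hol U -> hol U} := pder Uopen j.
Let Xl (j : 'I_n) : {linear hol U -> hol U} := mulx Uopen j.

Lemma hol_sumE (I : Type) (r : seq I) (Q : pred I) (G : I -> hol U) x :
  (\sum_(i <- r | Q i) G i : hol U) x = \sum_(i <- r | Q i) G i x.
Proof. by apply: (big_morph (fun F : hol U => F x)). Qed.

Lemma pdn_hol f (F : hol U) m : (forall x, U x -> f x = F x) ->
  forall x, U x -> pdn m f x = opm Dl m F x.
Proof.
move=> fF; rewrite /pdn /opm; elim: (enum _) => //= j s IH.
elim: (m j) => //= k IHk x Ux.
exact: (pd_hol Uopen j IHk Ux).
Qed.

Lemma apply_op_hol P f (F : hol U) : (forall x, U x -> f x = F x) ->
  forall x, U x -> apply_op P f x = act Dl P F x.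
Proof.
move=> fF x Ux; rewrite /apply_op /act /mlin hol_sumE; apply: eq_bigr => m _.
by rewrite (pdn_hol _ fF Ux).
Qed.

Lemma euler_hol k f (F : hol U) : (forall x, U x -> f x = F x) ->
  forall x, U x -> \sum_j (A k j)%:~R * x j * pd j f x = euler Dl Xl A k F x.
Proof.
move=> fF x Ux; rewrite /euler hol_sumE; apply: eq_bigr => j _.
rewrite -[RHS]/((A k j)%:~R * Xl j (Dl j F) x) mulxE // -mulrA; congr (_ * (_ * _)).
exact: (pd_hol Uopen j fF Ux).
Qed.

(** The passage from the analytic system to the Weyl module; derivatives are local and U is open, so
    agreement on U is enough. *)
Lemma is_solution_hol I f (F : hol U) : (forall x, U x -> f x = F x) -> holomorphic_on U f ->
  is_solution A beta I U f <->
  (forall p, I p -> act Dl p F = 0) /\ euler_eigen Dl Xl A beta F.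
Proof.
move=> fF hf; split=> [[_ H1 H2]|[H1 H2]]; split => //.
- move=> p Ip; apply: hol_eq => x Ux.
  by rewrite -(apply_op_hol p fF Ux) H1.
- move=> k; apply: hol_eq => x Ux.
  rewrite -(euler_hol k fF Ux) -[RHS]/(beta k * F x) -fF //.
  by apply/eqP; rewrite -subr_eq0; apply/eqP; exact: H2.
- by move=> p Ip x Ux; rewrite (apply_op_hol p fF Ux) H1.
- move=> k x Ux; rewrite (euler_hol k fF Ux) H2 fF //.
  by rewrite -[(beta k *: F : hol U) x]/(beta k * F x) subrr.
Qed.

Variables (mB : nat) (B : 'M[int]_(n, mB)).
Hypothesis dn : (d + mB = n)%N.
Hypothesis rankA : \rank (map_mx (intr : int -> rat) A) = d.
Hypothesis rankB : \rank (map_mx (intr : int -> rat) B) = mB.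
Hypothesis AB : A *m B = 0.
Hypothesis beta_generic : forall (l : 'rV[int]_d) c, l != 0 -> affine_form beta l c != 0.

(** [I] stands for I_J or I_B. It contains I_B, which makes f periodic along L_B, and it admits
    separating polynomials. *)
Lemma solution_decomposition k (rhos : 'I_k -> 'cV[int]_n -> C)
    (P : 'I_k -> {mpoly C[n]}) (alpha : 'X_{1..n}) (I : {mpoly C[n]} -> Prop) f :
  (forall i, is_GB_char A B (rhos i)) ->
  (forall p, in_IB B p -> I p) ->
  (forall F : hol U, (forall p, I p -> act Dl p F = 0) -> separating_data A Dl P rhos alpha F) ->
  is_solution A beta I U f ->
  exists fs : 'I_k -> ('I_n -> C) -> C,
    (forall i, is_solution A beta (in_Irho A (rhos i)) U (fs i)) /\
    (forall x, U x -> f x = \sum_i fs i x).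
Proof.
move=> GB IBI sep fsol; have hf : holomorphic_on U f by case: fsol.
have hf' := (holomorphic_fdiff U f).1 hf.
pose F : hol U := Hol (restr_hol Uopen hf').
have fF x : U x -> f x = F x by move=> Ux; rewrite /F /= restrE.
have [fI fE] := (is_solution_hol I fF hf).1 fsol.
have DC := @pderC R n U Uopen; have XC := @mulxC R n U Uopen.
have DX := @pder_mulx R n U Uopen.
have [Pdeg Psum Pker] := sep F fI.
have [bs [bs0 bsP]] := vanishing_forms dn rankA rankB AB alpha.
have fS := inIB_shift (D := Dl) DC (fun p Hp => fI p (IBI p Hp)).
have rho_char i : lattice_char A (rhos i) by case: (GB i).
have rhoB i w : rhos i (B *m w) = 1 by case: (GB i).
have prod0 : \prod_(b <- bs) affine_form beta b.1 b.2 != 0.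
  by rewrite prodf_seq_neq0; apply/allP => b /bs0 b0; exact: beta_generic.
have [gs [Fsum gsP]] := eigen_decomposition (D := Dl) (X := Xl) DC XC DX AB rho_char rhoB fS fE
  Pdeg Psum Pker bsP prod0.
exists (fun i => gs i : _ -> _); split; last first.
  by move=> x Ux; rewrite fF // Fsum hol_sumE.
move=> i; have [gE gC] := gsP i.
have hg : holomorphic_on U (gs i) by apply/holomorphic_fdiff => x Ux; exact: hol_fdiff.
apply: (is_solution_hol (in_Irho A (rhos i)) (F := gs i) _ hg).2 => //.
by split => //; apply: (char_eigenP (D := Dl) A DC (rhos i) (gs i)).2.
Qed.

Lemma in_IB_Irho (rho : 'cV[int]_n -> C) (p : {mpoly C[n]}) : is_GB_char A B rho -> in_IB B p -> in_Irho A rho p.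
Proof.
move=> [_ _ r1] [s ->]; exists [seq (x.1, B *m x.2) | x <- s]; split.
  by move=> _ /mapP[x _ ->]; rewrite /inL /= mulmxA AB mul0mx.
by rewrite big_map; apply: eq_bigr => x _; rewrite r1.
Qed.

End Solutions.

End Hypergeometric.
Import Hypergeometric.

Theorem theorem7p4 (R : realType) (n m : nat)
  (A : 'M[int]_(n - m, n)) (B : 'M[int]_(n, m)) :
  (m < n)%N ->
  \rank (map_mx (intr : int -> rat) B) = m ->
  (forall j : 'I_m, \sum_(i < n) B i j = 0) ->
  \rank (map_mx (intr : int -> rat) A) = (n - m)%N ->
  (forall (k : 'I_(n - m)) (j : 'I_n), val k = 0%N -> A k j = 1) ->
  A *m B = 0 ->
  (* main statement: J = {rhos i | i < k}, a nonempty subset of G_B *)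
  (forall (k : nat) (rhos : 'I_k -> 'cV[int]_n -> R[i]),
     (0 < k)%N ->
     (forall i, is_GB_char A B (rhos i)) ->
     (forall i j, i != j -> exists u, inL A u /\ rhos i u != rhos j u) ->
     exists E : ('I_(n - m) -> R[i]) -> Prop,
       nullset E /\
       forall beta : 'I_(n - m) -> R[i], ~ E beta ->
       forall U : ('I_n -> R[i]) -> Prop, is_open U ->
       forall f : ('I_n -> R[i]) -> R[i],
         is_solution A beta (fun P => forall i, in_Irho A (rhos i) P) U f ->
         exists fs : 'I_k -> ('I_n -> R[i]) -> R[i],
           (forall i, is_solution A beta (in_Irho A (rhos i)) U (fs i)) /\
           (forall x, U x -> f x = \sum_i fs i x))
  /\
  (* "in particular": the lattice ideal I_B *)
  (exists E : ('I_(n - m) -> R[i]) -> Prop,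
     nullset E /\
     forall beta : 'I_(n - m) -> R[i], ~ E beta ->
     forall U : ('I_n -> R[i]) -> Prop, is_open U ->
     forall f : ('I_n -> R[i]) -> R[i],
       is_solution A beta (in_IB B) U f ->
       exists (k : nat) (rhos : 'I_k -> 'cV[int]_n -> R[i])
              (fs : 'I_k -> ('I_n -> R[i]) -> R[i]),
         (forall i, is_GB_char A B (rhos i)) /\
         (forall i, is_solution A beta (in_Irho A (rhos i)) U (fs i)) /\
         (forall x, U x -> f x = \sum_i fs i x)).
Proof.
move=> mn rankB _ rankA _ AB.
have dn : (n - m + m = n)%N by rewrite subnK // ltnW.
have d0 : (0 < n - m)%N by rewrite subn_gt0.
(* All integral hyperplanes are excluded at once, before alpha and the forms attached to it are
   known. *)
pose E (beta : 'I_(n - m) -> R[i]) :=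
  exists (l : 'rV[int]_(n - m)) (c : int), l != 0 /\ affine_form beta l c = 0.
have nullE : nullset E by apply: null_cover_nullset => //; exact: null_forms.
have generic beta : ~ E beta -> forall (l : 'rV[int]_(n - m)) c, l != 0 -> affine_form beta l c != 0.
  by move=> nE l c l0; apply/eqP => e; apply: nE; exists l, c.
split.
  move=> k rhos k0 GB distinct; exists E; split => // beta /generic gen U Uopen f fsol.
  have [P [alpha sep]] := separate_characters (@pderC R n U Uopen) distinct.
  have sub p : in_IB B p -> forall i, in_Irho A (rhos i) p.
    by move=> pB i; apply: (in_IB_Irho AB (GB i)).
  have [fs fsP] := solution_decomposition dn rankA rankB AB gen GB sub sep fsol.
  by exists fs.
exists E; split => // beta /generic gen U Uopen f fsol.
have [k [rhos [P [alpha [GB sep]]]]] := all_characters (@pderC R n U Uopen) AB dn rankA rankB.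
have [fs [fs1 fs2]] := solution_decomposition dn rankA rankB AB gen GB (fun p => id) sep fsol.
by exists k, rhos, fs.
Qed.
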